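(* Let $B=2^{k_1}C_1\perp\cdots\perp2^{k_r}C_r\in\mathcal H_n(\mathfrak o)$ be a pre-optimal form, and write $\mathrm{GK}(B)=(\underbrace{m_1,\ldots,m_1}_{n_1},\ldots,\underbrace{m_s,\ldots,m_s}_{n_s})$ with $m_1<\cdots<m_s$ and $n=n_1+\cdots+n_s$; put $n_j^*=n_1+\cdots+n_j$. Then: (1) for every $1\le j\le s$ there is an integer $1\le l_j\le r$ such that $B^{(n_j^* )}=B^{[l_j]}$ (i.e. $n_j^*=\deg C_1+\cdots+\deg C_{l_j}$); (2) defining $\zeta_j=\eta_{B^{[l_j]}}$ if $n_j^*$ is odd and $\zeta_j=\xi_{B^{[l_j]}}$ if $n_j^*$ is even, we have $\mathrm{EGK}(B)=(n_1,\ldots,n_s;m_1,\ldots,m_s;\zeta_1,\ldots,\zeta_s)$.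
   Context: Let $F$ be a finite unramified extension of $\mathbb Q_2$ with ring of integers $\mathfrak o$, $\mathrm{ord}$ the valuation with $\mathrm{ord}(2)=1$, $\mathrm{ord}(0)=+\infty$. $\mathcal H_n(\mathfrak o)$ is the set of symmetric $B=(b_{ij})\in M_n(F)$ with $b_{ii}\in\mathfrak o$, $2b_{ij}\in\mathfrak o$; nondegenerate means $\det B\ne0$. $B^{(m)}$ is the upper-left $m\times m$ submatrix; $\perp$ is block-diagonal sum; $B\sim B'$ means $B'={}^tUBU$ with $U\in GL_n(\mathfrak o)$. For nondegenerate $B$ of degree $n$: $D_B=(-4)^{[n/2]}\det B$; $\xi_B=1,-1,0$ according as $D_B\in F^{\times2}$, $F(\sqrt{D_B})/F$ is unramified quadratic, or ramified; if $B$ is $GL_n(F)$-equivalent to $\mathrm{diag}(b_1',\dots,b_n')$, $\eta_B=\langle-1,-1\rangle^{[(n+1)/4]}\langle-1,\det B\rangle^{[(n-1)/2]}\prod_{i<j}\langle b_i',b_j'\rangle$ (Hilbert symbols; this is the Clifford invariant). $S_2(\mathfrak o)_e$: symmetric $2\times2$ matrices over $\mathfrak o$ with diagonal in $2\mathfrak o$; unimodular diagonal: diagonal with unit entries. GK invariant: $S(B)$ is the set of non-decreasing $(a_i)\in\mathbb Z_{\ge0}^n$ with $\mathrm{ord}(b_{ii})\ge a_i$ and $\mathrm{ord}(2b_{ij})\ge(a_i+a_j)/2$ ($i\le j$); $\mathbf S(\{B\})=\bigcup_{U\in GL_n(\mathfrak o)}S({}^tUBU)$; $\mathrm{GK}(B)$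 is its lexicographically greatest element; $B$ is optimal if $\mathrm{GK}(B)\in S(B)$. Extended GK datum: for nondegenerate $B$, choose optimal $B'\sim B$, write $\mathrm{GK}(B')=(m_1^{(n_1)},\dots,m_t^{(n_t)})$ ($m_1<\dots<m_t$, multiplicities $n_i$), $n_u^*=n_1+\dots+n_u$, $\zeta_u=\xi_{B'^{(n_u^* )}}$ if $n_u^*$ even and $\eta_{B'^{(n_u^* )}}$ if odd; $\mathrm{EGK}(B)=(n_1,\dots,n_t;m_1,\dots,m_t;\zeta_1,\dots,\zeta_t)$ (independent of the choice of $B'$). Pre-optimal forms: $B=2^{k_1}C_1\perp\cdots\perp2^{k_r}C_r$ with $k_i\ge0$, each $C_i$ unimodular diagonal or in $\frac12(S_2(\mathfrak o)_e\cap GL_2(\mathfrak o))$; $B^{[j]}=2^{k_1}C_1\perp\cdots\perp2^{k_j}C_j$; $\mathcal D_m=\{j:k_j=m, C_j\text{ diagonal}\}$, $\mathcal E_m=\{j:k_j=m, C_j\text{ not diagonal}\}$. Pre-optimal means: (PO1) $\sum_{j\in\mathcal D_m}\deg C_j\le2$ and $\mathcal E_m$ is a (possibly empty) set of consecutive integers, for each $m$; (PO2) for $i<j$: $\mathcal D_{m_1}\ni i$, $\mathcal D_{m_2}\ni j\Rightarrow m_1\le m_2$; $\mathcal E_{m_1}\ni i,\mathcal E_{m_2}\ni j\Rightarrow m_1\le m_2$; $\mathcal D_{m_1}\ni i,\mathcal E_{m_2}\ni j\Rightarrow m_1\le m_2-1$; $\mathcal E_{m_1}\ni i,\mathcal D_{m_2}\ni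 j\Rightarrow m_1\le m_2+1$; (PO3) if $C_i$ is unimodular diagonal of degree 2 then $i\ge2$ and either ($\deg B^{[i]}$ even and $\xi_{B^{[i-1]}}=\xi_{B^{[i]}}=0$) or ($\deg B^{[i-1]}$ odd and $\mathrm{ord}\det B^{[i-1]}+k_i$ even); (PO4) if $k_i=k_{i-1}-1$, $C_i$ diagonal, $C_{i-1}$ not diagonal, then $\deg C_i=2$, or $\deg C_i=1$ and either ($\deg B^{[i]}$ and $\mathrm{ord}\det B^{[i]}$ even) or ($\deg B^{[i]}$ odd and $\xi_{B^{[i-1]}}=0$); (PO5) if $C_i$ diagonal, $C_{i+1}$ not diagonal, $k_i=k_{i+1}-1$, then $\deg C_i=1$ and either ($\deg B^{[i]}$ even and $\mathrm{ord}\det B^{[i]}$ odd) or ($\deg B^{[i]}$ odd and $\xi_{B^{[i-1]}}\ne0$ if $i\ge2$); (PO6) if $\deg B^{[i]}$ even, $C_i,C_{i+1}$ unimodular diagonal and $k_{i+1}=k_i+1$, then $\xi_{B^{[i]}}=0$. *)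

(* Defs.v *)
From HB Require Import structures.
From mathcomp Require Import all_boot all_order all_algebra.
From mathcomp Require Import boolp.
From mathcomp Require classical_sets.

Set Implicit Arguments.
Unset Strict Implicit.
Unset Printing Implicit Defensive.

Import Order.TTheory GRing.Theory Num.Theory.
Local Open Scope ring_scope.

(* The base field.  A valuation v : F -> int (its value at 0 is       *)
(* irrelevant; ord(0) = +oo is encoded by vge below).                 *)

Definition vge (F : fieldType) (v : F -> int) (x : F) (k : int) : bool :=
  (x == 0) || (k <= v x).

Definition integral (F : fieldType) (v : F -> int) (x : F) : bool := vge v x 0.

Definition unit_o (F : fieldType) (v : F -> int) (x : F) : bool :=
  (x != 0) && (v x == 0).

(* (F, v) is a finite unramified extension of Q_2 with its normalized
   valuation: a complete discretely valued field with v(2) = 1 (so 2 is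
   a uniformizer), 2 != 0, and finite residue field o/2o. *)
Record unram2 (F : fieldType) (v : F -> int) : Prop := {
  v_mul : forall x y : F, x != 0 -> y != 0 -> v (x * y) = v x + v y;
  v_add : forall x y : F, x != 0 -> y != 0 -> x + y != 0 ->
            v x <= v (x + y) \/ v y <= v (x + y);
  two_nz : (2 : F) != 0;
  v_two : v 2 = 1;
  res_fin : exists s : seq F, all (integral v) s /\
            forall x, integral v x -> exists2 y, y \in s & vge v (x - y) 1;
  v_complete : forall u : nat -> F,
     (forall N : int, exists M : nat, forall p, (M <= p)%N -> vge v (u p.+1 - u p) N) ->
     exists l : F, forall N : int, exists M : nat, forall p, (M <= p)%N -> vge v (u p - l) N
}.

Definition hilb (F : fieldType) (a b : F) : int :=
  if `[< exists x y z : F, [|| x != 0, y != 0 | z != 0] /\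
                          z ^+ 2 = a * x ^+ 2 + b * y ^+ 2 >] then 1 else -1.

(* entry (i,j) of M addressed by natural numbers (0 outside the range) *)
Definition mxe (F : fieldType) (n : nat) (M : 'M[F]_n) (i j : nat) : F :=
  match (insub i : option 'I_n), (insub j : option 'I_n) with
  | Some i', Some j' => M i' j'
  | _, _ => 0
  end.

Definition ulsub (F : fieldType) (n : nat) (m : nat) (M : 'M[F]_n) : 'M[F]_m :=
  \matrix_(i < m, j < m) mxe M i j.

Definition in_Hn (F : fieldType) (v : F -> int) (n : nat) (M : 'M[F]_n) : bool :=
  [&& M^T == M, [forall i, integral v (M i i)] &
      [forall i, forall j, integral v (2 * M i j)]].

Definition GLo (F : fieldType) (v : F -> int) (n : nat) (U : 'M[F]_n) : bool :=
  [forall i, forall j, integral v (U i j)] && unit_o v (\det U).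

Definition sim (F : fieldType) (v : F -> int) (n : nat) (B B' : 'M[F]_n) : Prop :=
  exists U : 'M[F]_n, GLo v U /\ B' = U^T *m B *m U.

(* lexicographic order on sequences of naturals (of equal length) *)
Fixpoint lexle (s t : seq nat) : bool :=
  match s, t with
  | x :: s', y :: t' => (x < y)%N || ((x == y) && lexle s' t')
  | _, _ => true
  end.

Definition inS (F : fieldType) (v : F -> int) (n : nat) (M : 'M[F]_n) (a : seq nat) : Prop :=
  [/\ size a = n, sorted leq a,
      (forall i : 'I_n, vge v (M i i) (nth 0%N a i)%:Z) &
      (forall i j : 'I_n, (i <= j)%N ->
          (2 * M i j == 0) || ((nth 0%N a i + nth 0%N a j)%:Z <= 2 * v (2 * M i j)))].

Definition inSU (F : fieldType) (v : F -> int) (n : nat) (M : 'M[F]_n) (a : seq nat) : Prop :=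
  exists U : 'M[F]_n, GLo v U /\ inS v (U^T *m M *m U) a.

Definition GK (F : fieldType) (v : F -> int) (n : nat) (M : 'M[F]_n) : seq nat :=
  classical_sets.xget [::] (fun a => inSU v M a /\ forall a', inSU v M a' -> lexle a' a).

Definition optimal (F : fieldType) (v : F -> int) (n : nat) (M : 'M[F]_n) : Prop :=
  inS v M (GK v M).

(* xi of a discriminant D: 1 if square, -1 if F(sqrt D)/F unramified
   quadratic, 0 if ramified.  Unramifiedness of F(sqrt D) (D not a square)
   means ramification index 1, i.e. the extended valuation
   w = v o N / 2 takes only integer values: v(a^2 - D b^2) is always even. *)
Definition disc_xi (F : fieldType) (v : F -> int) (D : F) : int :=
  if `[< exists y : F, D = y ^+ 2 >] then 1
  else if `[< forall a b : F, (a != 0) || (b != 0) ->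
                 ~~ odd (absz (v (a ^+ 2 - D * b ^+ 2))) >] then -1
  else 0.

Definition xi (F : fieldType) (v : F -> int) (m : nat) (M : 'M[F]_m) : int :=
  disc_xi v ((-4) ^+ (m./2) * \det M).

Definition eta_diag (F : fieldType) (m : nat) (detM : F) (d : 'rV[F]_m) : int :=
  hilb (-1 : F) (-1) ^+ (m.+1 %/ 4) * hilb (-1 : F) detM ^+ (m.-1 %/ 2) *
  \prod_(i < m) \prod_(j < m | (i < j)%N) hilb (d 0 i) (d 0 j).

Definition eta (F : fieldType) (m : nat) (M : 'M[F]_m) : int :=
  eta_diag (\det M)
    (classical_sets.xget 0 (fun d : 'rV[F]_m => exists U : 'M[F]_m,
                U \in unitmx /\ U^T *m M *m U = diag_mx d)).

Definition zeta (F : fieldType) (v : F -> int) (m : nat) (M : 'M[F]_m) : int :=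
  if odd m then eta M else xi v M.

Fixpoint runs (s : seq nat) : seq (nat * nat) :=
  match s with
  | [::] => [::]
  | x :: t =>
      match runs t with
      | (k, y) :: r => if x == y then (k.+1, y) :: r else (1%N, x) :: (k, y) :: r
      | [::] => [:: (1%N, x)]
      end
  end.

Definition EGK (F : fieldType) (v : F -> int) (n : nat) (M : 'M[F]_n)
  : seq nat * seq nat * seq int :=
  let M' := classical_sets.xget M (fun M' => sim v M M' /\ optimal v M') in
  let rs := runs (GK v M') in
  let ns := map fst rs in
  (ns, map snd rs,
   [seq zeta v (ulsub (sumn (take j ns)) M') | j <- iota 1 (size ns)]).

(* BD s : diagonal matrix diag(s);  BE x y z : the 2x2 matrix [[x,y],[y,z]] *)
Inductive blk (F : Type) := BD of seq F | BE of F & F & F.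

Definition isD (F : Type) (b : blk F) : bool :=
  if b is BD _ then true else false.

Definition deg (F : Type) (b : blk F) : nat :=
  match b with BD s => size s | BE _ _ _ => 2 end.

Definition blk_entry (F : fieldType) (b : blk F) (i j : nat) : F :=
  match b with
  | BD s => if i == j then nth 0 s i else 0
  | BE x y z =>
      if (i == 0%N) && (j == 0%N) then x
      else if (i == 1%N) && (j == 1%N) then z
      else if ((i == 0%N) && (j == 1%N)) || ((i == 1%N) && (j == 0%N)) then y
      else 0
  end.

(* C unimodular diagonal (of positive degree), or
   C in (1/2)(S_2(o)_e \cap GL_2(o)) *)
Definition blk_ok (F : fieldType) (v : F -> int) (b : blk F) : bool :=
  match b with
  | BD s => (0 < size s)%N && all (unit_o v) s
  | BE x y z => [&& vge v (2 * x) 1, vge v (2 * z) 1, integral v (2 * y) &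
                    unit_o v ((2 * x) * (2 * z) - (2 * y) ^+ 2)]
  end.

Definition degs (F : Type) (bl : seq (nat * blk F)) : nat :=
  sumn (map (fun p => deg p.2) bl).

Fixpoint ent (F : fieldType) (bl : seq (nat * blk F)) (i j : nat) : F :=
  match bl with
  | [::] => 0
  | (k, b) :: t =>
      let d := deg b in
      if (i < d)%N && (j < d)%N then 2 ^+ k * blk_entry b i j
      else if (d <= i)%N && (d <= j)%N then ent t (i - d) (j - d)
      else 0
  end.

Definition assemble (F : fieldType) (bl : seq (nat * blk F)) : 'M[F]_(degs bl) :=
  \matrix_(i, j) ent bl i j.

(* 1-based accessors k_i, C_i, and B^{[j]} *)
Definition kb (F : Type) (bl : seq (nat * blk F)) (i : nat) : nat :=
  (nth (0%N, BD [::]) bl i.-1).1.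
Definition Cb (F : Type) (bl : seq (nat * blk F)) (i : nat) : blk F :=
  (nth (0%N, BD [::]) bl i.-1).2.
Definition Bpre (F : fieldType) (bl : seq (nat * blk F)) (j : nat) :=
  assemble (take j bl).

Definition ord_det_odd (F : fieldType) (v : F -> int) (m : nat) (M : 'M[F]_m) : bool :=
  odd (absz (v (\det M))).

Definition pre_optimal (F : fieldType) (v : F -> int) (bl : seq (nat * blk F)) : Prop :=
  let r := size bl in
  (forall m : nat,
     (\sum_(1 <= j < r.+1 | (kb bl j == m) && isD (Cb bl j)) deg (Cb bl j) <= 2)%N) /\
  (forall m i l j : nat, (1 <= i)%N -> (i < l)%N -> (l < j)%N -> (j <= r)%N ->
     kb bl i = m -> kb bl j = m -> ~~ isD (Cb bl i) -> ~~ isD (Cb bl j) ->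
     kb bl l = m /\ ~~ isD (Cb bl l)) /\
  (forall i j : nat, (1 <= i)%N -> (i < j)%N -> (j <= r)%N ->
     [/\ isD (Cb bl i) -> isD (Cb bl j) -> (kb bl i <= kb bl j)%N,
         ~~ isD (Cb bl i) -> ~~ isD (Cb bl j) -> (kb bl i <= kb bl j)%N,
         isD (Cb bl i) -> ~~ isD (Cb bl j) -> (kb bl i + 1 <= kb bl j)%N &
         ~~ isD (Cb bl i) -> isD (Cb bl j) -> (kb bl i <= kb bl j + 1)%N]) /\
  (forall i : nat, (1 <= i <= r)%N -> isD (Cb bl i) -> deg (Cb bl i) = 2%N ->
     (2 <= i)%N /\
     ((~~ odd (degs (take i bl)) /\ xi v (Bpre bl i.-1) = 0 /\ xi v (Bpre bl i) = 0) \/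
      (odd (degs (take i.-1 bl)) /\ ~~ odd (absz (v (\det (Bpre bl i.-1))) + kb bl i)%N))) /\
  (forall i : nat, (2 <= i <= r)%N -> (kb bl i + 1 = kb bl i.-1)%N ->
     isD (Cb bl i) -> ~~ isD (Cb bl i.-1) ->
     deg (Cb bl i) = 2%N \/
     (deg (Cb bl i) = 1%N /\
      ((~~ odd (degs (take i bl)) /\ ~~ ord_det_odd v (Bpre bl i)) \/
       (odd (degs (take i bl)) /\ xi v (Bpre bl i.-1) = 0)))) /\
  (forall i : nat, (1 <= i)%N -> (i < r)%N ->
     isD (Cb bl i) -> ~~ isD (Cb bl i.+1) -> (kb bl i + 1 = kb bl i.+1)%N ->
     deg (Cb bl i) = 1%N /\
     ((~~ odd (degs (take i bl)) /\ ord_det_odd v (Bpre bl i)) \/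
      (odd (degs (take i bl)) /\ ((2 <= i)%N -> xi v (Bpre bl i.-1) != 0)))) /\
  (forall i : nat, (1 <= i)%N -> (i < r)%N -> ~~ odd (degs (take i bl)) ->
     isD (Cb bl i) -> isD (Cb bl i.+1) -> (kb bl i.+1 = kb bl i + 1)%N ->
     xi v (Bpre bl i) = 0).

(* Main.v *)
Require Import Defs.
From HB Require Import structures.
From mathcomp Require Import all_boot all_order all_algebra.
From mathcomp Require Import boolp.
From mathcomp Require Import sesquilinear.
From mathcomp Require Import zify ring.
From mathcomp Require classical_sets.

(* For integral A and exponents a with A in S(a), filter the lattice by the vectors whose i-th
   coordinate has valuation at least (m - a_i)/2. If the quadratic form induced on every graded
   piece has trivial radical, the filtration is intrinsic: a is then lexicographically greatest,
   and any two bases in which a is attained differ by a matrix respecting the filtration. At a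
   jump of a the corresponding upper-left blocks have the same graded form, and the graded form
   determines the value zeta: its hyperbolic or anisotropic planes have unramified discriminant,
   and Hilbert symbols of such a discriminant with units are trivial.

   For a pre-optimal form such exponents are built block by block. A new vector of scale K is
   corrected by an integral combination of the earlier ones, so that it either stays single or
   forms a plane with an earlier single vector or with its neighbour; (PO1)-(PO6) ensure that
   the exponents stay non-decreasing. The base change is unitriangular, hence does not affect
   zeta of the leading blocks, and jumps of a only occur at block boundaries. *)

Set Implicit Arguments.
Unset Strict Implicit.
Unset Printing Implicit Defensive.

Import Order.TTheory GRing.Theory Num.Theory.
Local Open Scope ring_scope.

(* [lia] would otherwise preprocess every hypothesis of arithmetic type in the context. *)
Ltac goal_lia := clear; lia.

(** * Sequences and pairings *)

Lemma lexle_first_diff s t : size s = size t -> lexle s t -> s = t \/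
  exists p, [/\ (p < size s)%N, forall i, (i < p)%N -> nth 0%N s i = nth 0%N t i &
                (nth 0%N s p < nth 0%N t p)%N].
Proof.
elim: s t => [|x s IH] [|y t] //=; first by left.
move=> [sz] /orP[xy|/andP[/eqP-> st]]; first by right; exists 0%N.
case: (IH _ sz st) => [->|[p [ps eq_lt lt_p]]]; first by left.
by right; exists p.+1; split=> // -[|i] //; rewrite ltnS; apply: eq_lt.
Qed.

Lemma lexle_total s t : lexle s t || lexle t s.
Proof.
elim: s t => [|x s IH] [|y t] //=; case: (ltngtP x y) => //= _; exact: IH.
Qed.

Lemma lexle_anti s t : size s = size t -> lexle s t -> lexle t s -> s = t.
Proof.
elim: s t => [|x s IH] [|y t] //= [sz]; case: (ltngtP x y) => //= -> st ts.
by rewrite (IH t).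
Qed.

Definition expand_runs (rs : seq (nat * nat)) : seq nat := flatten [seq nseq p.1 p.2 | p <- rs].

Lemma runs_nseq_cat m k r : (if runs r is p :: _ then p.2 != k else true) ->
  runs (nseq m.+1 k ++ r) = (m.+1, k) :: runs r.
Proof.
move=> h; elim: m => [|m IH] /=.
  by case: (runs r) h => [|[c y] l] //= h; rewrite eq_sym (negPf h).
by move: IH => /= ->; rewrite eqxx.
Qed.

Lemma expand_runsK rs : all (fun p => 0 < p.1)%N rs -> sorted ltn (unzip2 rs) ->
  runs (expand_runs rs) = rs.
Proof.
elim: rs => [|[[|c] m] rs IH] //= pos so.
have IHs : runs (expand_runs rs) = rs by apply: IH => //; apply: path_sorted so.
rewrite -[LHS]/(runs (nseq c.+1 m ++ expand_runs rs)) runs_nseq_cat IHs //.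
by case: rs so {IH IHs pos} => [|[c' m'] rs] //= /andP[mm _]; rewrite gtn_eqF.
Qed.

Lemma mem_expand_runs rs x : x \in expand_runs rs -> x \in unzip2 rs.
Proof.
case/flattenP => _ /mapP[p prs ->]; rewrite mem_nseq => /andP[_ /eqP->].
exact: map_f.
Qed.

Lemma size_expand_runs rs : size (expand_runs rs) = sumn (unzip1 rs).
Proof. by elim: rs => //= p rs IH; rewrite size_cat size_nseq -IH. Qed.

Lemma nth_expand_runs_ltn rs j i l : sorted ltn (unzip2 rs) ->
  (i < sumn (take j (unzip1 rs)) <= l)%N -> (l < size (expand_runs rs))%N ->
  (nth 0 (expand_runs rs) i < nth 0 (expand_runs rs) l)%N.
Proof.
move=> so; rewrite -map_take => /andP[].
have -> : expand_runs rs = expand_runs (take j rs) ++ expand_runs (drop j rs).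
  by rewrite -flatten_cat -map_cat cat_take_drop.
rewrite -/(unzip1 _) -size_expand_runs size_cat !nth_cat => hi hl hs.
rewrite hi [(l < _)%N]ltnNge hl /=; move: so.
rewrite /unzip2 -{1}(cat_take_drop j rs) map_cat (sorted_pairwise ltn_trans) pairwise_cat.
case/andP=> /allrelP h _; apply: h; apply: mem_expand_runs; apply: mem_nth => //.
by rewrite -(ltn_add2l (size (expand_runs (take j rs)))) subnKC.
Qed.

Lemma pigeonhole3 (T R : finType) (g : T -> R) : (2 * #|R| < #|T|)%N ->
  exists x y z, [/\ g x = g y, g y = g z & [/\ x != y, y != z & z != x]].
Proof.
move=> small; have [y hy] : exists y, (2 < #|[set x | g x == y]|)%N.
  apply/existsP; apply: contraTT small => /existsPn few.
  rewrite -leqNgt -[#|T|]sum1_card (partition_big g xpredT) //= mulnC -sum_nat_const.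
  by apply: leq_sum => y _; rewrite sum1dep_card leqNgt.
have /card_gt2P[x1 [x2 [x3 [[]]]]] := hy; rewrite !inE => /eqP g1 /eqP g2 /eqP g3 ne.
by exists x1, x2, x3; rewrite g1 g2 g3.
Qed.

Definition update (T : Type) (f : nat -> T) k x : nat -> T := fun l => if l == k then x else f l.

Lemma update_eq T (f : nat -> T) k x : update f k x k = x.
Proof. by rewrite /update eqxx. Qed.

Lemma update_neq T (f : nat -> T) k x l : l != k -> update f k x l = f l.
Proof. by rewrite /update => /negPf ->. Qed.

Lemma update_leq (a : nat -> nat) k c M : (forall l, (l < k)%N -> (a l <= M)%N) -> (c <= M)%N ->
  forall l, (l < k.+1)%N -> (update a k c l <= M)%N.
Proof.
move=> h cM l; rewrite ltnS leq_eqVlt /update => /orP[/eqP->|lk]; first by rewrite eqxx.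
by rewrite ltn_eqF // h.
Qed.

Definition update2 (T : Type) (h : nat -> T) (i j : nat) (u w : T) := update (update h i u) j w.

Lemma update2_out T (h : nat -> T) i j u w l : (l != i) && (l != j) -> update2 h i j u w l = h l.
Proof. by case/andP=> li lj; rewrite /update2 !update_neq. Qed.

Lemma update2_fst T (h : nat -> T) i j u w : i != j -> update2 h i j u w i = u.
Proof. by move=> ij; rewrite /update2 update_neq // update_eq. Qed.

Lemma update2_snd T (h : nat -> T) i j u w : update2 h i j u w j = w.
Proof. exact: update_eq. Qed.

Lemma monotone_sublevel (a : nat -> nat) n m :
  (forall i j, (i <= j)%N -> (j < n)%N -> (a i <= a j)%N) ->
  exists2 k, (k <= n)%N & forall i, (i < n)%N -> (i < k)%N = (a i <= m)%N.
Proof.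
elim: n => [|n IH] mono; first by exists 0%N.
have [an|an] := leqP (a n) m.
  by exists n.+1 => // i hi; rewrite hi (leq_trans (mono i n _ _) an).
have [|k kn kE] := IH; first by move=> i j ij jn; apply: mono => //; apply: leqW.
exists k => [|i]; first exact: leqW.
rewrite ltnS leq_eqVlt => /orP[/eqP->|/kE//].
by rewrite ltnNge kn leqNgt an.
Qed.

Lemma perm_iotaS I J k : perm_eq J (k :: I) -> perm_eq I (iota 0 k) -> perm_eq J (iota 0 k.+1).
Proof.
move=> JI Ik; apply: (perm_trans JI); rewrite -addn1 iotaD cats1 perm_sym perm_rcons perm_cons.
by rewrite perm_sym.
Qed.

Definition paired (ps : seq (nat * nat)) : seq nat := flatten [seq [:: p.1; p.2] | p <- ps].
Definition support (ps : seq (nat * nat)) (ss : seq nat) : seq nat := ss ++ paired ps.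
Definition matched (ps : seq (nat * nat)) (i j : nat) : bool := ((i, j) \in ps) || ((j, i) \in ps).

Section Pairings.

Implicit Types (ps : seq (nat * nat)) (ss : seq nat) (p q : nat * nat).

Lemma mem_paired ps p : p \in ps -> (p.1 \in paired ps) && (p.2 \in paired ps).
Proof.
move=> h; apply/andP; split; apply/flattenP; exists [:: p.1; p.2];
  rewrite ?inE ?eqxx ?orbT //; by apply: (map_f (fun p : nat * nat => [:: p.1; p.2])).
Qed.

Lemma pairedP ps x : reflect (exists2 p, p \in ps & x \in [:: p.1; p.2]) (x \in paired ps).
Proof.
apply: (iffP flattenP) => [[_ /mapP[p pI ->] xp]|[p pI xp]]; first by exists p.
by exists [:: p.1; p.2] => //; apply: (map_f (fun p : nat * nat => [:: p.1; p.2])).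
Qed.

Lemma size_paired ps : size (paired ps) = (size ps).*2.
Proof. by elim: ps => //= p ps ->. Qed.

Lemma paired_neq ps p : uniq (paired ps) -> p \in ps -> p.1 != p.2.
Proof.
elim: ps => //= q ps IH; rewrite !inE => /andP[hq /andP[_ uf]] /orP[/eqP->|pI]; last exact: IH.
by move: hq; rewrite negb_or => /andP[].
Qed.

Lemma paired_inj ps p q x : uniq (paired ps) -> p \in ps -> q \in ps ->
  x \in [:: p.1; p.2] -> x \in [:: q.1; q.2] -> p = q.
Proof.
elim: ps => // r ps IH /=; rewrite inE negb_or -!andbA => /and4P[_ n1 n2 u].
have disjoint_head q' : q' \in ps -> x \in [:: q'.1; q'.2] -> x \in [:: r.1; r.2] -> False.
  move=> qI xq xr; have xps : x \in paired ps by apply/pairedP; exists q'.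
  by move: xr xps; rewrite !inE => /orP[] /eqP->; rewrite ?(negPf n1) ?(negPf n2).
move=> + + xp xq; rewrite !in_cons => /orP[/eqP pE|pI] /orP[/eqP qE|qI].
- by rewrite pE qE.
- by rewrite pE in xp; case: (disjoint_head q).
- by rewrite qE in xq; case: (disjoint_head p).
exact: IH.
Qed.

Lemma matched_sym ps i j : matched ps i j = matched ps j i.
Proof. exact: orbC. Qed.

Lemma matched_paired ps i j : matched ps i j -> (i \in paired ps) && (j \in paired ps).
Proof. by case/orP=> /mem_paired /andP[-> ->]. Qed.

Lemma matched_partner ps i : i \in paired ps -> exists j, matched ps i j.
Proof.
case/pairedP=> p pI; rewrite !inE => /orP[] /eqP->; [exists p.2|exists p.1];
  by rewrite /matched -surjective_pairing pI ?orbT.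
Qed.

Lemma matched_inj ps i j l : uniq (paired ps) -> matched ps i j -> matched ps l j -> l = i.
Proof.
move=> u.
have pairP k : matched ps k j ->
    exists p, [/\ p \in ps, k \in [:: p.1; p.2], j \in [:: p.1; p.2] & k != j].
  by case/orP=> kj; have /= ne := paired_neq u kj; [exists (k, j)|exists (j, k)];
    split; rewrite ?inE ?eqxx ?orbT // eq_sym.
case/pairP=> p [pI ip jp ij] /pairP[q [qI lq jq lj]].
have qp := paired_inj u qI pI jq jp; move: lq ip jp ij lj; rewrite qp.
by rewrite !inE; do 3![case/orP=> /eqP->]; rewrite ?eqxx.
Qed.

Lemma support_uniq_single ps ss : uniq (support ps ss) -> uniq ss.
Proof. by rewrite cat_uniq => /and3P[]. Qed.

Lemma support_uniq_paired ps ss : uniq (support ps ss) -> uniq (paired ps).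
Proof. by rewrite cat_uniq => /and3P[]. Qed.

Lemma two_singles_neq ps i j : uniq (support ps [:: i; j]) -> i != j.
Proof. by move/support_uniq_single; rewrite /= inE andbT. Qed.

Lemma matched_cons_out p ps i j : (i != p.1) && (i != p.2) ->
  matched (p :: ps) i j = matched ps i j.
Proof.
by case: p => k l /= /andP[ik il]; rewrite /matched !inE !xpair_eqE (negPf ik) (negPf il) andbF.
Qed.

Lemma matched_behead p ps i j : ~~ matched (p :: ps) i j -> ~~ matched ps i j.
Proof. by apply: contra; rewrite /matched !in_cons => /orP[] ->; rewrite !orbT. Qed.

Lemma paired_notin_single ps ss i : uniq (support ps ss) -> i \in paired ps -> i \notin ss.
Proof. by rewrite cat_uniq => /and3P[_ /hasPn h _] /h. Qed.

Lemma single_notin_paired ps ss i : uniq (support ps ss) -> i \in ss -> i \notin paired ps.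
Proof. by move=> u; apply: contraTN => /(paired_notin_single u). Qed.

Lemma single_unmatched ps ss i j : uniq (support ps ss) -> i \in ss ->
  ~~ matched ps i j && ~~ matched ps j i.
Proof.
move=> u /(single_notin_paired u) iN; rewrite [matched ps j i]matched_sym andbb.
by apply: contra iN => /matched_paired/andP[].
Qed.

Lemma single_support ps ss i : i \in ss -> i \in support ps ss.
Proof. by rewrite mem_cat => ->. Qed.

Lemma paired_support ps ss i : i \in paired ps -> i \in support ps ss.
Proof. by rewrite mem_cat orbC => ->. Qed.

Lemma pair_support ps ss p : p \in ps -> (p.1 \in support ps ss) * (p.2 \in support ps ss).
Proof. by move=> /mem_paired/andP[p1 p2]; rewrite !paired_support. Qed.

Lemma support0 ss : support [::] ss = ss.
Proof. exact: cats0. Qed.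

Lemma support_cons_perm p ps ss : perm_eq (support (p :: ps) ss) (p.1 :: p.2 :: support ps ss).
Proof. by apply/permPl; apply: (perm_catCA ss [:: p.1; p.2] (paired ps)). Qed.

Lemma mem_support_cons p ps ss :
  support (p :: ps) ss =i [predU1 p.1 & [predU1 p.2 & support ps ss]].
Proof. by move=> l; rewrite (perm_mem (support_cons_perm _ _ _)) !inE. Qed.

Lemma support_cons_uniq p ps ss : uniq (support (p :: ps) ss) ->
  [/\ p.1 != p.2, uniq (support ps ss) &
      forall l, l \in support ps ss -> (l != p.1) && (l != p.2)].
Proof.
rewrite (perm_uniq (support_cons_perm _ _ _)) /= inE negb_or -andbA => /and4P[-> n1 n2 u].
by split=> // l lI; apply/andP; split; [apply: contraNneq n1|apply: contraNneq n2] => <-.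
Qed.

Lemma support_pair_single_perm ps ss ss' i k : perm_eq ss (i :: ss') ->
  perm_eq (support ((i, k) :: ps) ss') (k :: support ps ss).
Proof.
move=> pp; rewrite /support /= perm_sym -[k :: _]/([:: k] ++ ss ++ paired ps) perm_catCA /=.
apply: (@perm_trans _ ((i :: ss') ++ k :: paired ps)); first by rewrite perm_cat2r.
by rewrite -[i :: ss']/([:: i] ++ ss') -catA perm_catCA.
Qed.

Lemma support_size ps ss k : perm_eq (support ps ss) (iota 0 k) ->
  k = (size ss + (size ps).*2)%N.
Proof. by move/perm_size; rewrite size_cat size_paired size_iota. Qed.

Lemma mem_support_iota ps ss k l : perm_eq (support ps ss) (iota 0 k) ->
  (l \in support ps ss) = (l < k)%N.
Proof. by move/perm_mem ->; rewrite mem_iota. Qed.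

End Pairings.

Section UnramifiedDyadic.

Variables (F : fieldType) (v : F -> int).
Hypothesis HF : unram2 v.

(** * Valuations and square classes *)

(* Half-integral bounds (a_i + a_j) / 2 are doubled, so that all bounds are integers. *)
Definition vge2 (x : F) (k : int) : bool := (x == 0) || (k <= 2 * v x).
Definition veq2 (x : F) (k : int) : bool := (x != 0) && (2 * v x == k).

Lemma valM x y : x != 0 -> y != 0 -> v (x * y) = v x + v y.
Proof. exact: (v_mul HF). Qed.

Lemma val1 : v 1 = 0.
Proof.
have n1 : (1 : F) != 0 by exact: oner_neq0.
by have := valM n1 n1; rewrite mulr1; lia.
Qed.

Lemma two_neq0 : (2 : F) != 0. Proof. exact: (two_nz HF). Qed.

Lemma valN x : v (- x) = v x.
Proof.
have [->|x0] := eqVneq x 0; first by rewrite oppr0.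
have n1 : (-1 : F) != 0 by rewrite oppr_eq0 oner_eq0.
have := valM n1 n1; rewrite mulN1r opprK val1 => h.
rewrite -mulN1r valM //; lia.
Qed.

Lemma valV x : x != 0 -> v x^-1 = - v x.
Proof.
move=> x0; have := @valM x x^-1 x0; rewrite invr_eq0 => /(_ x0).
by rewrite divff // val1; lia.
Qed.

Lemma valX x n : x != 0 -> v (x ^+ n) = n%:Z * v x.
Proof.
move=> x0; elim: n => [|n IH]; first by rewrite expr0 val1 mul0r.
rewrite exprS valM ?expf_neq0 // IH; lia.
Qed.

Lemma val_2X n : v (2 ^+ n) = n%:Z.
Proof. by rewrite valX ?two_neq0 // (v_two HF) mulr1. Qed.

Lemma val_surj (m : int) : exists2 t, t != 0 & v t = m.
Proof.
case: m => m; first by exists (2 ^+ m); rewrite ?expf_neq0 ?two_neq0 // val_2X.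
by exists (2 ^+ m.+1)^-1; rewrite ?valV ?invr_eq0 ?expf_neq0 ?two_neq0 // val_2X.
Qed.

Lemma vge2P x k : reflect (x != 0 -> k <= 2 * v x) (vge2 x k).
Proof.
rewrite /vge2; apply: (iffP idP) => [/orP[/eqP->|//]|]; first by rewrite eqxx.
by case: (eqVneq x 0) => //= x0 /(_ isT).
Qed.

Lemma vge2_0 k : vge2 0 k. Proof. by rewrite /vge2 eqxx. Qed.

Lemma vge2_all_eq0 x : (forall k, vge2 x k) -> x = 0.
Proof.
by move=> h; apply/eqP; apply: contraT => /(vge2P _ _ (h (2 * v x + 1))); lia.
Qed.

Lemma vge2_le x k l : vge2 x k -> l <= k -> vge2 x l.
Proof. move=> /vge2P h lk; apply/vge2P => /h; lia. Qed.

(* [2 * v x] is even, which may sharpen a bound. *)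
Lemma vge2_parity x k l : vge2 x k -> (forall z : int, k <= 2 * z -> l <= 2 * z) -> vge2 x l.
Proof. by move=> /vge2P h kl; apply/vge2P => /h /kl. Qed.

Lemma vge2N x k : vge2 (- x) k = vge2 x k.
Proof. by rewrite /vge2 oppr_eq0 valN. Qed.

Lemma vge2D x y k : vge2 x k -> vge2 y k -> vge2 (x + y) k.
Proof.
move=> /vge2P hx /vge2P hy; apply/vge2P => xy.
have [x0|x0] := eqVneq x 0; first by move: xy; rewrite x0 add0r.
have [y0|y0] := eqVneq y 0; first by move: xy; rewrite y0 addr0.
have := hx x0; have := hy y0; case: (v_add HF x0 y0 xy); lia.
Qed.

Lemma vge2B x y k : vge2 x k -> vge2 y k -> vge2 (x - y) k.
Proof. by move=> hx hy; apply: vge2D => //; rewrite vge2N. Qed.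

Lemma vge2M x y k l : vge2 x k -> vge2 y l -> vge2 (x * y) (k + l).
Proof.
move=> /vge2P hx /vge2P hy; apply/vge2P; rewrite mulf_eq0 negb_or => /andP[x0 y0].
rewrite valM //; have := hx x0; have := hy y0; lia.
Qed.

Lemma vge2M_le x y k l m : vge2 x k -> vge2 y l -> m <= k + l -> vge2 (x * y) m.
Proof. by move=> hx hy; apply: vge2_le; apply: vge2M. Qed.

Lemma vge2_intM c x k : vge2 c 0 -> vge2 x k -> vge2 (c * x) k.
Proof. by move=> hc hx; apply: (vge2M_le hc hx); rewrite add0r. Qed.

Lemma vge2_1 k : k <= 0 -> vge2 1 k.
Proof. by move=> h; apply/vge2P; rewrite val1; lia. Qed.

Lemma vge2_intX x n : vge2 x 0 -> vge2 (x ^+ n) 0.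
Proof.
by move=> hx; elim: n => [|n IH]; rewrite ?vge2_1 // exprS; apply: vge2_intM.
Qed.

Lemma vge2_sum (I : Type) (r : seq I) (P : pred I) (f : I -> F) k :
  (forall i, P i -> vge2 (f i) k) -> vge2 (\sum_(i <- r | P i) f i) k.
Proof.
by move=> h; apply: (big_ind (vge2^~ k)) => // [|x y]; [exact: vge2_0 | exact: vge2D].
Qed.

Lemma vge2_prod (I : Type) (r : seq I) (x : I -> F) (k : I -> int) :
  (forall i, vge2 (x i) (k i)) -> vge2 (\prod_(i <- r) x i) (\sum_(i <- r) k i).
Proof.
move=> h; elim: r => [|i r IH]; first by rewrite !big_nil vge2_1.
by rewrite !big_cons; apply: vge2M.
Qed.

Lemma vge_vge2 x k : vge v x k = vge2 x (2 * k).
Proof. by rewrite /vge /vge2; case: (x == 0) => //=; apply/idP/idP; lia. Qed.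

Lemma integral_vge2 x : integral v x = vge2 x 0.
Proof. by rewrite /integral vge_vge2 mulr0. Qed.

Lemma veq2P x k : reflect (x != 0 /\ 2 * v x = k) (veq2 x k).
Proof. by apply: (iffP andP) => -[? /eqP]. Qed.

Lemma unit_veq2 x : unit_o v x = veq2 x 0.
Proof. by rewrite /unit_o /veq2; congr andb; apply/eqP/eqP; lia. Qed.

Lemma veq2_neq0 x k : veq2 x k -> x != 0. Proof. by case/andP. Qed.

Lemma veq2_ge x k l : veq2 x k -> l <= k -> vge2 x l.
Proof. move=> /veq2P[_ h] lk; apply/vge2P; lia. Qed.

Lemma veq2W x k : veq2 x k -> vge2 x k.
Proof. by move=> h; apply: veq2_ge h (lexx k). Qed.

Lemma veq2_congr x k y l : veq2 x k -> y = x -> l = k -> veq2 y l.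
Proof. by move=> h -> ->. Qed.

Lemma veq2M x y k l : veq2 x k -> veq2 y l -> veq2 (x * y) (k + l).
Proof.
move=> /veq2P[x0 hx] /veq2P[y0 hy]; apply/veq2P; split; first by rewrite mulf_neq0.
rewrite valM //; lia.
Qed.

Lemma veq2V x k : veq2 x k -> veq2 x^-1 (- k).
Proof. move=> /veq2P[x0 hx]; apply/veq2P; rewrite invr_eq0 valV //; split=> //; lia. Qed.

Lemma veq2N x k : veq2 (- x) k = veq2 x k.
Proof. by rewrite /veq2 oppr_eq0 valN. Qed.

Lemma veq2X x k n : veq2 x k -> veq2 (x ^+ n) (n%:Z * k).
Proof.
move=> /veq2P[x0 hx]; apply/veq2P; rewrite expf_neq0 // valX //; split=> //; lia.
Qed.

Lemma veq2_sqr x k : veq2 (x ^+ 2) (2 * k) = veq2 x k.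
Proof.
have [->|x0] := eqVneq x 0; first by rewrite expr0n /veq2 eqxx.
by rewrite /veq2 expf_eq0 /= x0 valX //; apply/eqP/eqP; lia.
Qed.

Lemma veq2_1 : veq2 1 0. Proof. by rewrite /veq2 oner_eq0 val1. Qed.
Lemma veq2_2X n : veq2 (2 ^+ n) (2 * n%:Z).
Proof. by rewrite /veq2 expf_neq0 ?two_neq0 //= val_2X. Qed.
Lemma veq2_2 : veq2 2 2. Proof. exact: (veq2_2X 1). Qed.
Lemma veq2_4 : veq2 4 4. Proof. by apply: (veq2_congr (veq2_2X 2)) => //; ring. Qed.
Lemma veq2_8 : veq2 8 6. Proof. by apply: (veq2_congr (veq2_2X 3)) => //; ring. Qed.

Lemma four_neq0 : (4 : F) != 0. Proof. exact: veq2_neq0 veq2_4. Qed.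

Lemma veq2D x y k : veq2 x k -> vge2 y (k + 1) -> veq2 (x + y) k.
Proof.
move=> /veq2P[x0 hx] hy.
have xNlarge : ~~ vge2 x (k + 1) by apply/negP => /vge2P/(_ x0); lia.
have xy : x + y != 0 by apply: contraNneq xNlarge => /addr0_eq yE; rewrite -vge2N yE.
apply/veq2P; split => //; apply/eqP; rewrite eq_le; apply/andP; split.
  rewrite leNgt; apply: contra xNlarge => gt; have -> : x = (x + y) - y by ring.
  by apply: vge2B => //; apply/vge2P; lia.
apply/(vge2P _ _ _ xy); apply: vge2D; [by apply/vge2P; lia | by apply: vge2_le hy _; lia].
Qed.

Lemma vge2_div x y k l m : vge2 x k -> veq2 y l -> m <= k - l -> vge2 (x / y) m.
Proof. by move=> hx /veq2V/veq2W hy; apply: vge2M_le. Qed.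

Lemma veq2_even x k : veq2 x k -> exists z : int, k = 2 * z.
Proof. by move=> /veq2P[_ <-]; exists (v x). Qed.

Lemma vge2_eq x k : vge2 x (2 * k) -> ~~ vge2 x (2 * k + 2) -> veq2 x (2 * k).
Proof.
move=> /vge2P ge_k; rewrite /vge2 negb_or -ltNge => /andP[x0 lt_k].
apply/veq2P; split=> //; have := ge_k x0; lia.
Qed.

Lemma vge2_unit x : vge2 x 0 -> ~~ vge2 x 2 -> veq2 x 0.
Proof. exact: (@vge2_eq x 0). Qed.

Lemma vge2_mul2 x k l : vge2 x k -> l <= k + 2 -> vge2 (2 * x) l.
Proof. by move=> h hl; apply: (vge2M_le (veq2W veq2_2) h); rewrite addrC. Qed.

Lemma vge2_mul4 x k l : vge2 x k -> l <= k + 4 -> vge2 (4 * x) l.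
Proof. by move=> h hl; apply: (vge2M_le (veq2W veq2_4) h); rewrite addrC. Qed.

Lemma vge2_div2 x k l : vge2 x k -> l <= k - 2 -> vge2 (x / 2) l.
Proof. by move=> h; apply: vge2_div h veq2_2. Qed.

Lemma vge2_half x k l : vge2 (2 * x) k -> l <= k - 2 -> vge2 x l.
Proof. by move=> h; have := vge2_div2 h; rewrite mulrC mulKf ?two_neq0 //; apply. Qed.

Lemma unit_1p2 x : vge2 x 0 -> veq2 (1 + 2 * x) 0.
Proof. by move=> hx; apply: (veq2D veq2_1); apply: vge2_mul2 hx _. Qed.

Lemma unit_1p4 x : vge2 x 0 -> veq2 (1 + 4 * x) 0.
Proof. by move=> hx; apply: (veq2D veq2_1); apply: vge2_mul4 hx _. Qed.

Lemma unit_1m4 x : vge2 x 0 -> veq2 (1 - 4 * x) 0.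
Proof. by move=> hx; rewrite -mulrN; apply: unit_1p4; rewrite vge2N. Qed.

Definition eqsq (x y : F) : Prop := exists2 c, c != 0 & x = y * c ^+ 2.

Lemma eqsq_refl x : eqsq x x.
Proof. by exists 1; rewrite ?oner_eq0 // expr1n mulr1. Qed.

Lemma eqsq_sym x y : eqsq x y -> eqsq y x.
Proof.
move=> [c c0 ->]; exists c^-1; rewrite ?invr_eq0 //.
by rewrite exprVn mulfK // expf_neq0.
Qed.

Lemma eqsq_trans y x z : eqsq x y -> eqsq y z -> eqsq x z.
Proof. by move=> [c c0 ->] [d d0 ->]; exists (d * c); rewrite ?mulf_neq0 // exprMn; ring. Qed.

Lemma eqsqM x y z t : eqsq x y -> eqsq z t -> eqsq (x * z) (y * t).
Proof. by move=> [c c0 ->] [d d0 ->]; exists (c * d); rewrite ?mulf_neq0 // exprMn; ring. Qed.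

Lemma eqsq_neq0 x y : eqsq x y -> y != 0 -> x != 0.
Proof. by move=> [c c0 ->] y0; rewrite mulf_neq0 ?expf_neq0. Qed.

Lemma eqsq_val_odd x y : x != 0 -> eqsq x y -> odd `|v x| = odd `|v y|.
Proof.
move=> x0 xy; have y0 := eqsq_neq0 (eqsq_sym xy) x0; case: xy => c c0 ->.
by rewrite valM ?expf_neq0 // valX //; lia.
Qed.

Lemma eqsq_unit x : x != 0 -> ~~ odd `|v x| -> exists2 u, veq2 u 0 & eqsq x u.
Proof.
move=> x0 ev; have [t t0 vt] := val_surj (v x %/ 2)%Z; have t20 := expf_neq0 2 t0.
exists (x / t ^+ 2); last by exists t; rewrite ?divfK.
apply/veq2P; rewrite mulf_neq0 ?invr_eq0 // valM ?invr_eq0 // valV // valX // vt.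
by split=> //; lia.
Qed.

Lemma eqsq_2unit x : x != 0 -> odd `|v x| -> exists2 u, veq2 u 0 & eqsq x (2 * u).
Proof.
move=> x0 od; have t0 := two_neq0; have [||u hu [t t1 e]] := @eqsq_unit (x / 2).
- by rewrite mulf_neq0 ?invr_eq0.
- by rewrite valM ?invr_eq0 // valV // (v_two HF); lia.
by exists u => //; exists t; rewrite // -mulrA -e mulrC divfK.
Qed.

Lemma contraction_fixpoint (g : F -> F) : (forall x, vge2 x 2 -> vge2 (g x) 2) ->
  (forall x y k, vge2 x 2 -> vge2 y 2 -> vge2 (x - y) k -> vge2 (g x - g y) (k + 2)) ->
  exists2 l, vge2 l 2 & g l = l.
Proof.
move=> g2 contr; pose u n := iter n g 0.
have u2 n : vge2 (u n) 2 by elim: n => [|n IH]; [exact: vge2_0 | exact: g2].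
have step n : vge2 (u n.+1 - u n) (2 * n%:Z + 2).
  elim: n => [|n IH]; first by rewrite subr0; apply: (u2 1).
  by apply: vge2_le (contr _ _ _ (u2 _) (u2 _) IH) _; lia.
have [|l hl] := @v_complete _ _ HF u.
  by move=> N; exists `|N|%N => p hp; rewrite vge_vge2; apply: vge2_le (step p) _; lia.
have lim k : exists n, vge2 (u n - l) k /\ vge2 (u n.+1 - l) k.
  have [n hn] := hl `|k|%:Z; exists n.
  by split; [have := hn n (leqnn n)|have := hn n.+1 (leqnSn n)];
    rewrite vge_vge2 => h; apply: vge2_le h _; lia.
have l2 : vge2 l 2.
  have [n [h _]] := lim 2; have -> : l = u n - (u n - l) by ring.
  exact: vge2B.
exists l => //; apply/eqP; rewrite -subr_eq0; apply/eqP; apply: vge2_all_eq0 => k.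
have [n [near_l near_l1]] := lim k.
have -> : g l - l = (u n.+1 - l) - (g (u n) - g l) by rewrite /u /=; ring.
by apply: vge2B => //; apply: vge2_le (contr _ _ _ (u2 n) l2 near_l) _; lia.
Qed.

Lemma square_1p8 t : vge2 t 0 -> exists y, 1 + 8 * t = y ^+ 2.
Proof.
move=> ht; have [||y _ yE] := @contraction_fixpoint (fun y => 2 * t - y ^+ 2).
- move=> y hy; apply: vge2B; first exact: vge2_mul2 ht _.
  by rewrite expr2; apply: (vge2M_le hy hy).
- move=> x y k hx hy hxy.
  have -> : 2 * t - x ^+ 2 - (2 * t - y ^+ 2) = - ((x - y) * (x + y)) by ring.
  by rewrite vge2N; apply: (vge2M hxy); apply: vge2D.
exists (1 + 2 * y); have -> : 8 * t = 4 * (2 * t) by ring.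
by rewrite -[2 * t](subrK (y ^+ 2)) yE; ring.
Qed.

Lemma near_unit_eqsq x y : veq2 y 0 -> vge2 (x - y) 6 -> eqsq x y.
Proof.
move=> hy h; have y0 := veq2_neq0 hy; have n8 := veq2_neq0 veq2_8.
have [|t e] := @square_1p8 ((x - y) / y / 8).
  by apply: vge2_div veq2_8 _; [exact: vge2_div h hy (lexx _) | ].
have xE : x = y * t ^+ 2 by rewrite -e; field; rewrite y0 n8.
exists t => //; apply: contraTneq hy => t0; apply/negP => hy.
have : veq2 x 0 by rewrite -[x](subrK y) addrC; apply: veq2D hy _; apply: vge2_le h _.
by rewrite xE t0 expr0n mulr0 /veq2 eqxx.
Qed.

(** * The residue field *)

Definition residue (x : F) : F := choose (fun y => vge2 (x - y) 2) x.

Lemma vge2_sub_residue x : vge2 (x - residue x) 2.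
Proof. by apply: (@chooseP _ (fun y => vge2 (x - y) 2)); rewrite subrr vge2_0. Qed.

Lemma residue_eq x y : (residue x == residue y) = vge2 (x - y) 2.
Proof.
apply/eqP/idP => [rxy|xy].
  have -> : x - y = (x - residue x) - (y - residue y) by rewrite rxy; ring.
  by apply: vge2B; apply: vge2_sub_residue.
rewrite /residue (@eq_choose _ (fun z => vge2 (x - z) 2) (fun z => vge2 (y - z) 2)); last first.
  move=> z; have -> : x - z = (y - z) + (x - y) by ring.
  apply/idP/idP => h; last exact: vge2D.
  by have -> : y - z = (y - z + (x - y)) - (x - y) by [ring]; apply: vge2B.
by apply: choose_id; rewrite ?subrr ?vge2_0 // -vge2N opprB.
Qed.

Lemma residue_int x : vge2 x 0 -> vge2 (residue x) 0.
Proof.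
move=> hx; have -> : residue x = x - (x - residue x) by ring.
by apply: vge2B => //; apply: vge2_le (vge2_sub_residue x) _.
Qed.

Lemma residueK x : residue (residue x) = residue x.
Proof. by apply/eqP; rewrite residue_eq -vge2N opprB vge2_sub_residue. Qed.

Lemma finite_residues : exists r : seq F,
  [/\ uniq r, {in r, forall y, vge2 y 0 /\ residue y = y} &
      forall x, vge2 x 0 -> residue x \in r].
Proof.
have [s [sint sP]] := res_fin HF; exists (undup (map residue s)); split.
- exact: undup_uniq.
- move=> y; rewrite mem_undup => /mapP[x /(allP sint)]; rewrite integral_vge2 => hx ->.
  by rewrite residueK residue_int.
move=> x; rewrite -integral_vge2 => /sP[y ys]; rewrite vge_vge2 -residue_eq mem_undup.
by move=> /eqP->; apply: map_f.
Qed.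

Lemma vge2_sqr x : vge2 (x ^+ 2) 2 -> vge2 x 2.
Proof.
have [->|x0] := eqVneq x 0; first by rewrite vge2_0.
by move=> /vge2P; rewrite expf_neq0 // valX // => /(_ isT) h; apply/vge2P; lia.
Qed.

(* Squaring is injective on the finite residue field, hence surjective. *)
Lemma residue_perfect x : vge2 x 0 -> exists2 s, vge2 s 0 & vge2 (s ^+ 2 - x) 2.
Proof.
move=> hx; have [r [ur rP rall]] := finite_residues.
pose frob y := residue (y ^+ 2).
have sub : {subset map frob r <= r}.
  by move=> _ /mapP[y /rP[yint _] ->]; apply: rall; apply: vge2_intX.
have inj : {in r &, injective frob}.
  move=> y z /rP[yint yE] /rP[zint zE] /eqP; rewrite residue_eq => yz.
  rewrite -yE -zE; apply/eqP; rewrite residue_eq; apply: vge2_sqr.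
  have -> : (y - z) ^+ 2 = y ^+ 2 - z ^+ 2 - 2 * (z * (y - z)) by ring.
  apply: vge2B => //; apply: vge2_mul2 (_ : vge2 _ 0) _ => //.
  by apply: vge2_intM => //; apply: vge2B.
have [|//|_ imE] := @uniq_min_size _ (map frob r) r _ sub _; rewrite ?size_map //.
  by rewrite map_inj_in_uniq.
have := rall x hx; rewrite -imE => /mapP[y /rP[yint _] /eqP].
by rewrite residue_eq -vge2N opprB; exists y.
Qed.

Definition artin_schreier (x : F) : Prop := exists2 z, vge2 z 0 & vge2 (z ^+ 2 + z - x) 2.

Lemma artin_schreier_congr x y : vge2 (x - y) 2 -> artin_schreier x -> artin_schreier y.
Proof.
move=> xy [z zint h]; exists z => //.
by have -> : z ^+ 2 + z - y = (z ^+ 2 + z - x) + (x - y) by [ring]; apply: vge2D.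
Qed.

Lemma artin_schreier_ker d : vge2 d 0 -> vge2 (d ^+ 2 + d) 2 -> ~~ vge2 d 2 -> vge2 (d + 1) 2.
Proof.
move=> dint hd /(vge2_unit dint) du; have d0 := veq2_neq0 du.
have -> : d + 1 = (d ^+ 2 + d) / d by field.
exact: vge2_div hd du _.
Qed.

Lemma artin_schreier_diff y z c d : vge2 y 0 -> vge2 z 0 ->
  vge2 (y ^+ 2 + y + c - (z ^+ 2 + z + d)) 2 -> vge2 ((y - z) ^+ 2 + (y - z) - (d - c)) 2.
Proof.
move=> yint zint h.
have -> : (y - z) ^+ 2 + (y - z) - (d - c) =
    (y ^+ 2 + y + c - (z ^+ 2 + z + d)) - 2 * (z * (y - z)) by ring.
apply: vge2B => //; apply: vge2_mul2 (_ : vge2 _ 0) _ => //.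
by apply: vge2_intM => //; apply: vge2B.
Qed.

Lemma residue_pigeonhole3 (phi : F -> 'I_3 -> F) :
  (forall y i, vge2 y 0 -> vge2 (phi y i) 0) ->
  let collide (p q : F * 'I_3) :=
    vge2 (phi p.1 p.2 - phi q.1 q.2) 2 && ((p.2 == q.2) ==> ~~ vge2 (p.1 - q.1) 2) in
  exists p q s, [/\ vge2 p.1 0, vge2 q.1 0 & vge2 s.1 0] /\
    [/\ collide p q, collide q s & collide s p].
Proof.
move=> phi_int collide; have [r [ur rP rall]] := finite_residues.
have val_int (y : seq_sub r) : vge2 (val y) 0 by have [] := rP _ (valP y).
have inr (p : seq_sub r * 'I_3) : residue (phi (val p.1) p.2) \in r.
  by apply: rall; apply: phi_int.
pose g (p : seq_sub r * 'I_3) : seq_sub r := SeqSub (inr p).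
pose lift (p : seq_sub r * 'I_3) := (val p.1, p.2).
have collideP p q : g p = g q -> p != q -> collide (lift p) (lift q).
  case: p q => [y i] [z j] /(congr1 val)/eqP; rewrite /= residue_eq => h ne.
  rewrite /collide h /=; apply/implyP => /eqP ij; move: ne; rewrite ij xpair_eqE eqxx andbT.
  by rewrite -residue_eq; have [_ ->] := rP _ (valP y); have [_ ->] := rP _ (valP z).
have r0 : (0 < #|{: seq_sub r}|)%N.
  by apply/card_gt0P; exists (SeqSub (rall 0 (vge2_0 0))).
have [|p [q [s [pq qs [npq nqs nsp]]]]] := @pigeonhole3 _ _ g.
  by rewrite card_prod card_ord mulnC ltn_mul2l r0.
exists (lift p), (lift q), (lift s); split; first by split; apply: val_int.
by split; apply: collideP; rewrite // ?pq ?qs.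
Qed.

(* z |-> z^2 + z is additive and two-to-one on the residue field, hence its translates by 0, x1
   and x2 cannot be disjoint. *)
Lemma artin_schreier_index x1 x2 : vge2 x1 0 -> vge2 x2 0 ->
  [\/ artin_schreier x1, artin_schreier x2 | artin_schreier (x1 + x2)].
Proof.
move=> x1int x2int; pose shift (i : 'I_3) := nth 0 [:: 0; x1; x2] i.
have shift_int i : vge2 (shift i) 0 by case: i => -[|[|[]]] // ?; rewrite /shift /= ?vge2_0.
have [|p [q [s [[pint qint sint] []]]]] :=
    @residue_pigeonhole3 (fun z i => z ^+ 2 + z + shift i).
  by move=> z i zint; rewrite !vge2D ?vge2_intX.
have by_shift y z i j : vge2 y 0 -> vge2 z 0 -> i != j ->
    vge2 (y ^+ 2 + y + shift i - (z ^+ 2 + z + shift j)) 2 ->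
    [\/ artin_schreier x1, artin_schreier x2 | artin_schreier (x1 + x2)].
  move=> yint zint ij /(artin_schreier_diff yint zint) h.
  have {h} h : artin_schreier (shift j - shift i) by exists (y - z) => //; apply: vge2B.
  have asT T c : vge2 c 0 -> shift j - shift i = T + 2 * c -> artin_schreier T.
    move=> cint dT; apply: artin_schreier_congr h; rewrite dT addrAC subrr add0r.
    exact: vge2_mul2 cint _.
  move: i j ij asT {h} => -[[|[|[|//]]] ?] [[|[|[|//]]] ?] // _; rewrite /shift /= => asT.
  - by apply: Or31; apply: (asT _ 0 (vge2_0 0)); ring.
  - by apply: Or32; apply: (asT _ 0 (vge2_0 0)); ring.
  - by apply: Or31; apply: (asT _ (- x1)); rewrite ?vge2N //; ring.
  - by apply: Or33; apply: (asT _ (- x1)); rewrite ?vge2N //; ring.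
  - by apply: Or32; apply: (asT _ (- x2)); rewrite ?vge2N //; ring.
  - by apply: Or33; apply: (asT _ (- x2)); rewrite ?vge2N //; ring.
have by_ker y z i : vge2 y 0 -> vge2 z 0 ->
    vge2 (y ^+ 2 + y + shift i - (z ^+ 2 + z + shift i)) 2 -> ~~ vge2 (y - z) 2 ->
    vge2 (y - z + 1) 2.
  move=> yint zint /(artin_schreier_diff yint zint); rewrite subrr subr0.
  by apply: artin_schreier_ker; apply: vge2B.
case: p q s pint qint sint => [y i] [z j] [t k] /= yint zint tint.
move=> /andP[yz yzN] /andP[zt ztN] /andP[ty tyN].
have [ij|ij] := eqVneq i j; last exact: by_shift ij yz.
have [jk|jk] := eqVneq j k; last exact: by_shift jk zt.
subst j k; rewrite eqxx /= in yzN ztN tyN.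
have h := vge2D (vge2D (by_ker _ _ _ yint zint yz yzN) (by_ker _ _ _ zint tint zt ztN))
  (by_ker _ _ _ tint yint ty tyN).
have /veq2P[n0 v0] := unit_1p2 (vge2_1 (lexx 0)).
suff /vge2P/(_ n0) : vge2 (1 + 2 * 1) 2 by rewrite v0.
by apply: etrans h; congr vge2; ring.
Qed.

(** * Bimultiplicativity of the Hilbert symbol *)

Definition isnorm (a b : F) : Prop := exists s t, b = s ^+ 2 - a * t ^+ 2.

Lemma isnormM a b c : isnorm a b -> isnorm a c -> isnorm a (b * c).
Proof.
move=> [s [t ->]] [s' [t' ->]]; exists (s * s' + a * t * t'), (s * t' + t * s'); ring.
Qed.

Lemma isnorm_sqr a t : isnorm a (t ^+ 2).
Proof. exists t, 0; ring. Qed.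

Lemma isnorm_eqsq a b c : eqsq b c -> isnorm a c -> isnorm a b.
Proof. by move=> [t _ ->] h; apply: isnormM h (isnorm_sqr _ _). Qed.

Lemma isnorm_eqsql a b c : eqsq a c -> isnorm c b -> isnorm a b.
Proof. by move=> [t t0 ->] [x [y ->]]; exists x, (y / t); field. Qed.

Lemma isnorm_div a b c : c != 0 -> isnorm a (b * c) -> isnorm a c -> isnorm a b.
Proof.
move=> c0 norm_bc norm_c; apply: isnorm_eqsq (isnormM norm_bc norm_c).
by exists c^-1; rewrite ?invr_eq0 //; field.
Qed.

Lemma isnorm_square a b : a != 0 -> isnorm (a ^+ 2) b.
Proof.
have t0 := two_neq0; move=> a0; exists ((b + 1) / 2), ((b - 1) / (2 * a)); field.
by rewrite a0.
Qed.

Lemma isnorm_near a x y : veq2 y 0 -> vge2 (x - y) 6 -> isnorm a y -> isnorm a x.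
Proof. by move=> hy h; apply: isnorm_eqsq; apply: near_unit_eqsq. Qed.

Lemma hilbP a b : a != 0 -> b != 0 -> (hilb a b = 1) <-> isnorm a b.
Proof.
move=> a0 b0; rewrite /hilb; case: asboolP => [[x [y [z [nz e]]]]|h]; split=> //.
- move=> _; have [y0|y0] := eqVneq y 0; last first.
    exists (z / y), (x / y).
    have -> : b = (z ^+ 2 - a * x ^+ 2) / y ^+ 2.
      by rewrite e [_ + b * _]addrC addrK mulfK ?expf_neq0.
    by field.
  move: e nz; rewrite y0 expr0n mulr0 addr0 eqxx /= => e nz.
  have x0 : x != 0.
    apply: contraTneq nz => x0; move: e; rewrite x0 expr0n mulr0 => /eqP.
    by rewrite expf_eq0 /= => /eqP->; rewrite !eqxx.
  have aE : a = (z / x) ^+ 2 by rewrite expr_div_n e mulfK // expf_neq0.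
  rewrite aE; apply: isnorm_square; apply: contraNneq a0 => z0; rewrite aE z0.
  by rewrite expr0n.
- by move=> [s [t e]]; case: h; exists t, 1, s; rewrite oner_eq0 orbT; split=> //; rewrite e; ring.
Qed.

Lemma hilb_sign (a b : F) : hilb a b = 1 \/ hilb a b = -1.
Proof. by rewrite /hilb; case: ifP; [left | right]. Qed.

Lemma hilbC (a b : F) : hilb a b = hilb b a.
Proof.
rewrite /hilb; congr (if _ then _ else _).
by apply/asboolP/asboolP => -[x [y [z [nz e]]]]; exists y, x, z; rewrite orbCA addrC.
Qed.

Lemma hilb_eqsqr (a b c : F) : a != 0 -> b != 0 -> eqsq b c -> hilb a b = hilb a c.
Proof.
move=> a0 b0 bc; have c0 := eqsq_neq0 (eqsq_sym bc) b0.
case: (hilb_sign a b) (hilb_sign a c) => eb [] ec; rewrite eb ec //.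
  by move/(hilbP a0 b0)/(isnorm_eqsq (eqsq_sym bc))/(hilbP a0 c0): eb; rewrite ec.
by move/(hilbP a0 c0)/(isnorm_eqsq bc)/(hilbP a0 b0): ec; rewrite eb.
Qed.

Lemma hilb_eqsql (a b c : F) : a != 0 -> b != 0 -> eqsq a c -> hilb a b = hilb c b.
Proof. by move=> a0 b0 ac; rewrite ![hilb _ b]hilbC; apply: hilb_eqsqr. Qed.

Lemma artin_schreier_square x : artin_schreier x -> eqsq (1 + 4 * x) 1.
Proof.
move=> [z zint h]; have z0 := veq2_neq0 (unit_1p2 zint).
apply: (@eqsq_trans ((1 + 2 * z) ^+ 2)); last by exists (1 + 2 * z); rewrite ?mul1r.
apply: near_unit_eqsq; first exact: (veq2X 2 (unit_1p2 zint)).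
have -> : 1 + 4 * x - (1 + 2 * z) ^+ 2 = - (4 * (z ^+ 2 + z - x)) by ring.
by rewrite vge2N; apply: vge2_mul4 h _.
Qed.

Lemma unit_square_class u : veq2 u 0 -> exists2 x, vge2 x 0 & eqsq u (1 + 2 * x).
Proof.
move=> hu; have [s hs h] := residue_perfect (veq2W hu).
have hs2 : veq2 (s ^+ 2) 0.
  by have -> : s ^+ 2 = u + (s ^+ 2 - u) by [ring]; apply: (veq2D hu); apply: vge2_le h _.
have s20 := veq2_neq0 hs2; have s0 : s != 0 by apply: contraNneq s20 => ->; rewrite expr0n.
have t0 := two_neq0; exists (- ((s ^+ 2 - u) / s ^+ 2 / 2)).
  by rewrite vge2N; apply: (vge2_div2 (k := 2)) => //; apply: vge2_div h hs2 _.
by exists s => //; field; rewrite s0 t0.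
Qed.

Definition unram_disc (x : F) : Prop := exists2 w, vge2 w 0 & eqsq x (1 - 4 * w).

Definition ram_disc (x : F) : Prop :=
  (exists2 u, veq2 u 0 & eqsq x (2 * u)) \/ (exists2 u, veq2 u 0 & eqsq x (1 + 2 * u)).

Lemma unram_or_ram_disc x : x != 0 -> unram_disc x \/ ram_disc x.
Proof.
move=> x0; have [od|ev] := boolP (odd `|v x|); first by right; left; apply: eqsq_2unit.
have [u /unit_square_class[y hy uy] xu] := eqsq_unit x0 ev; have xy := eqsq_trans xu uy.
have [hy2|/(vge2_unit hy) y_unit] := boolP (vge2 y 2); last by right; right; exists y.
left; exists (- (y / 2)); first by rewrite vge2N; apply: vge2_div2 hy2 _.
by have -> : 1 - 4 * - (y / 2) = 1 + 2 * y by field; exact: two_neq0.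
Qed.

(* x^2 + xy + w y^2 is the norm form of the unramified algebra of discriminant 1 - 4w. *)
Lemma isnorm_unram w p q : isnorm (1 - 4 * w) (p ^+ 2 + p * q + w * q ^+ 2).
Proof. by exists (p + q / 2), (q / 2); field; rewrite two_neq0. Qed.

Lemma isnorm_unram_1p4 w z : vge2 w 0 -> vge2 z 0 -> isnorm (1 - 4 * w) (1 + 4 * z).
Proof.
move=> hw hz; have := isnorm_unram w 1 (4 * z).
have -> : 1 ^+ 2 + 1 * (4 * z) + w * (4 * z) ^+ 2 = 1 + 4 * (z + 4 * (w * z ^+ 2)) by ring.
have hwz : vge2 (w * z ^+ 2) 0 by apply: vge2_intM => //; apply: vge2_intX.
apply: isnorm_near; first by apply: unit_1p4; apply: vge2D => //; apply: vge2_mul4 hwz _.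
have -> : 1 + 4 * z - (1 + 4 * (z + 4 * (w * z ^+ 2))) = - (4 * (4 * (w * z ^+ 2))) by ring.
by rewrite vge2N; apply: vge2_mul4 (vge2_mul4 hwz (lexx _)) _.
Qed.

Lemma isnorm_unram_unit w u : vge2 w 0 -> veq2 u 0 -> isnorm (1 - 4 * w) u.
Proof.
move=> hw hu; have [x hx ux] := unit_square_class hu; apply: (isnorm_eqsq ux).
have hx2 : vge2 (x ^+ 2) 0 := vge2_intX 2 hx.
pose y := 1 ^+ 2 + 1 * (2 * x) + w * (2 * x) ^+ 2.
have y0 : y != 0.
  have -> : y = 1 + 2 * (x + 2 * (w * x ^+ 2)) by rewrite /y; ring.
  apply: veq2_neq0 (unit_1p2 _); apply: vge2D => //.
  by apply: vge2_mul2 (vge2_intM hw hx2) _.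
apply: (isnorm_div y0); last exact: isnorm_unram.
have -> : (1 + 2 * x) * y = 1 + 4 * (x + x ^+ 2 + w * x ^+ 2 * (1 + 2 * x)) by rewrite /y; ring.
apply: isnorm_unram_1p4 => //; apply: vge2D; first exact: vge2D.
by apply: vge2_intM (veq2W (unit_1p2 hx)); apply: vge2_intM.
Qed.

Lemma hilb_unram_unit D u : unram_disc D -> veq2 u 0 -> hilb D u = 1.
Proof.
move=> [w hw Dw] hu; have w0 := veq2_neq0 (unit_1m4 hw); have u0 := veq2_neq0 hu.
rewrite (hilb_eqsql (eqsq_neq0 Dw w0) u0 Dw).
by apply/hilbP => //; apply: isnorm_unram_unit.
Qed.

(* If every unit is a norm from F(sqrt a) up to some 1 + d x with x integral, then the class of
   lam x modulo the image of z |-> z^2 + z controls whether 1 + d x itself is a norm. *)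
Lemma isnorm_index_criterion a c d lam b b' :
  veq2 c 0 -> isnorm a (2 * c) -> vge2 d 2 -> vge2 lam 0 ->
  (forall u, veq2 u 0 -> exists2 x, vge2 x 0 & isnorm a (u * (1 + d * x))) ->
  (forall x, vge2 x 0 -> artin_schreier (lam * x) -> isnorm a (1 + d * x)) ->
  b != 0 -> b' != 0 -> [\/ isnorm a b, isnorm a b' | isnorm a (b * b')].
Proof.
move=> hc nc hd hlam unit_red norm_1pd b0 b'0; have c0 := veq2_neq0 hc.
have red y : y != 0 -> exists2 x, vge2 x 0 & isnorm a (y * (1 + d * x)).
  move=> y0; have [/(eqsq_2unit y0)|/(eqsq_unit y0)] := boolP (odd `|v y|); move=> [u hu yu].
    have [|x hx hn] := unit_red (u / c); first exact: veq2_congr (veq2M hu (veq2V hc)) _ _.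
    exists x => //; apply: isnorm_eqsq (isnormM nc hn).
    have -> : 2 * c * (u / c * (1 + d * x)) = 2 * u * (1 + d * x) by field.
    exact: eqsqM yu (eqsq_refl _).
  have [x hx hn] := unit_red u hu; exists x => //.
  exact: isnorm_eqsq (eqsqM yu (eqsq_refl _)) hn.
have conclude y z : vge2 z 0 -> isnorm a (y * (1 + d * z)) -> artin_schreier (lam * z) ->
    isnorm a y.
  move=> hz ny /(norm_1pd _ hz); apply: isnorm_div ny.
  by apply: veq2_neq0 (veq2D veq2_1 (_ : vge2 (d * z) 1)); apply: (vge2M_le hd hz).
have [x hx n1] := red b b0; have [x' hx' n2] := red b' b'0.
have [] := artin_schreier_index (vge2_intM hlam hx) (vge2_intM hlam hx') => as_x.
- by apply: Or31; apply: conclude hx n1 as_x.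
- by apply: Or32; apply: conclude hx' n2 as_x.
have hxx : vge2 (d * (x * x')) 2 by apply: (vge2M_le hd (vge2_intM hx hx')).
apply: Or33; apply: (conclude _ (x + x' + d * (x * x'))).
- by apply: vge2D; [exact: vge2D | exact: vge2_le hxx _].
- have -> : b * b' * (1 + d * (x + x' + d * (x * x'))) =
      b * (1 + d * x) * (b' * (1 + d * x')) by ring.
  exact: isnormM.
apply: artin_schreier_congr as_x.
have -> : lam * x + lam * x' - lam * (x + x' + d * (x * x')) = - (lam * (d * (x * x'))) by ring.
by rewrite vge2N; apply: vge2_intM.
Qed.

Lemma isnorm_index_2unit u b b' : veq2 u 0 -> b != 0 -> b' != 0 ->
  [\/ isnorm (2 * u) b, isnorm (2 * u) b' | isnorm (2 * u) (b * b')].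
Proof.
move=> hu; have u0 := veq2_neq0 hu; have t0 := two_neq0.
apply: (@isnorm_index_criterion _ (- u) 4 1); rewrite ?veq2N ?vge2_1 //.
- by exists 0, 1; ring.
- exact: veq2_ge veq2_4 _.
- move=> y hy; have [x hx yx] := unit_square_class hy.
  have [r hr hrx] := residue_perfect (vge2_div hx hu (lexx _)).
  have ur2 : vge2 (u * r ^+ 2) 0 by apply: vge2_intM (veq2W hu) (vge2_intX 2 hr).
  exists ((x - u * r ^+ 2) / 2 - x * (u * r ^+ 2)).
    apply: vge2B; last exact: vge2_intM.
    apply: (vge2_div2 (k := 2)) => //.
    have -> : x - u * r ^+ 2 = - (u * (r ^+ 2 - x / u)) by field.
    by rewrite vge2N; apply: vge2_intM (veq2W hu) _.
  apply: (@isnorm_eqsq _ _ ((1 + 2 * x) ^+ 2 * (1 - 2 * (u * r ^+ 2)))).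
    have -> : (1 + 2 * x) ^+ 2 * (1 - 2 * (u * r ^+ 2)) =
        (1 + 2 * x) * (1 + 4 * ((x - u * r ^+ 2) / 2 - x * (u * r ^+ 2))) by field.
    exact: eqsqM yx (eqsq_refl _).
  by apply: isnormM; [apply: isnorm_sqr | exists 1, r; ring].
move=> x hx; rewrite mul1r => /artin_schreier_square h; apply: (isnorm_eqsq h).
by rewrite -(expr1n F 2); apply: isnorm_sqr.
Qed.

Lemma isnorm_1p2_self u y : isnorm (1 + 2 * u) (1 + 2 * (y - u * y ^+ 2)).
Proof. by exists (1 + y), y; ring. Qed.

Lemma isnorm_1p2_1p4 u z : veq2 u 0 -> vge2 z 0 -> isnorm (1 + 2 * u) (1 + 4 * z).
Proof.
move=> hu hz; have u0 := veq2_neq0 hu; have huz := vge2_intM (veq2W hu) hz.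
have := isnorm_1p2_self u (u^-1 - 2 * z).
have -> : 1 + 2 * (u^-1 - 2 * z - u * (u^-1 - 2 * z) ^+ 2) = 1 + 4 * (z - 2 * (z * (u * z))).
  by field.
have hzz := vge2_intM hz huz.
apply: isnorm_near; first by apply: unit_1p4; apply: vge2B => //; apply: vge2_mul2 hzz _.
have -> : 1 + 4 * z - (1 + 4 * (z - 2 * (z * (u * z)))) = 4 * (2 * (z * (u * z))) by ring.
by apply: vge2_mul4 (vge2_mul2 hzz (lexx _)) _.
Qed.

Lemma isnorm_1p2_artin_schreier u x : veq2 u 0 -> vge2 x 0 -> artin_schreier (- u * x) ->
  isnorm (1 + 2 * u) (1 + 2 * x).
Proof.
move=> hu hx [z hz h]; have u0 := veq2_neq0 hu; have t0 := two_neq0.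
pose y := - z / u; have hy : vge2 y 0 by apply: (vge2_div (k := 0) _ hu); rewrite ?vge2N.
pose w := y - u * y ^+ 2; have hw : vge2 w 0.
  by apply: vge2B => //; apply: vge2_intM (veq2W hu) (vge2_intX 2 hy).
apply: (isnorm_div (veq2_neq0 (unit_1p2 hw))); last exact: isnorm_1p2_self.
have hxw : vge2 ((x - w) / 2) 0.
  apply: (vge2_div2 (k := 2)) => //.
  have -> : x - w = (z ^+ 2 + z - (- u * x)) / u by rewrite /w /y; field.
  exact: vge2_div h hu _.
have -> : (1 + 2 * x) * (1 + 2 * w) = 1 + 4 * (w + (x - w) / 2 + x * w) by field.
by apply: isnorm_1p2_1p4 => //; apply: vge2D; [exact: vge2D | exact: vge2_intM].
Qed.

Lemma isnorm_index_1p2 u b b' : veq2 u 0 -> b != 0 -> b' != 0 ->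
  [\/ isnorm (1 + 2 * u) b, isnorm (1 + 2 * u) b' | isnorm (1 + 2 * u) (b * b')].
Proof.
move=> hu; apply: (@isnorm_index_criterion _ (- u) 2 (- u)).
- by rewrite veq2N.
- by exists 1, 1; ring.
- exact: veq2W veq2_2.
- by rewrite vge2N veq2W.
- move=> y hy; have [x hx yx] := unit_square_class hy; exists x => //.
  apply: (isnorm_eqsq (eqsqM yx (eqsq_refl _))).
  by rewrite -expr2; apply: isnorm_sqr.
by move=> x; apply: isnorm_1p2_artin_schreier.
Qed.

Lemma isnorm_unram_index w b b' : vge2 w 0 -> b != 0 -> b' != 0 ->
  [\/ isnorm (1 - 4 * w) b, isnorm (1 - 4 * w) b' | isnorm (1 - 4 * w) (b * b')].
Proof.
move=> hw b0 b'0.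
have even_norm y : y != 0 -> ~~ odd `|v y| -> isnorm (1 - 4 * w) y.
  by move=> y0 /(eqsq_unit y0)[u hu yu]; apply: isnorm_eqsq yu (isnorm_unram_unit hw hu).
have [hb|hb] := boolP (odd `|v b|); last by apply: Or31; apply: even_norm.
have [hb'|hb'] := boolP (odd `|v b'|); last by apply: Or32; apply: even_norm.
by apply: Or33; apply: even_norm; rewrite ?mulf_neq0 ?valM //; lia.
Qed.

Lemma isnorm_index a b c : a != 0 -> b != 0 -> c != 0 ->
  [\/ isnorm a b, isnorm a c | isnorm a (b * c)].
Proof.
move=> a0 b0 c0.
suff [a' aa' h] : exists2 a', eqsq a a' & [\/ isnorm a' b, isnorm a' c | isnorm a' (b * c)].
  by case: h => h; [apply: Or31|apply: Or32|apply: Or33]; apply: isnorm_eqsql aa' h.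
case: (unram_or_ram_disc a0) => [[w hw aw]|[[u hu au]|[u hu au]]].
- by exists (1 - 4 * w) => //; apply: isnorm_unram_index.
- by exists (2 * u) => //; apply: isnorm_index_2unit.
- by exists (1 + 2 * u) => //; apply: isnorm_index_1p2.
Qed.

Lemma hilbMr (a b c : F) : a != 0 -> b != 0 -> c != 0 -> hilb a (b * c) = hilb a b * hilb a c.
Proof.
move=> a0 b0 c0; have bc0 : b * c != 0 by rewrite mulf_neq0.
case: (hilb_sign a b) => eb; case: (hilb_sign a c) => ec; rewrite eb ec.
- by apply/hilbP => //; apply: isnormM; apply/hilbP.
- case: (hilb_sign a (b * c)) => // /(hilbP a0 bc0) h.
  have /(hilbP a0 c0) : isnorm a c; last by rewrite ec.
  by apply: (isnorm_div b0); [rewrite mulrC | apply/hilbP].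
- case: (hilb_sign a (b * c)) => // /(hilbP a0 bc0) h.
  have /(hilbP a0 b0) : isnorm a b; last by rewrite eb.
  by apply: (isnorm_div c0 h); apply/hilbP.
case: (isnorm_index a0 b0 c0) => /(hilbP _ _) h; first by rewrite h in eb.
  by rewrite h in ec.
by rewrite h.
Qed.

Lemma hilbMl (a b c : F) : a != 0 -> b != 0 -> c != 0 -> hilb (a * b) c = hilb a c * hilb b c.
Proof. by move=> *; rewrite ![hilb _ c]hilbC hilbMr. Qed.

Lemma hilb_oppr (a : F) : a != 0 -> hilb a (- a) = 1.
Proof. by move=> a0; apply/hilbP; rewrite ?oppr_eq0 //; exists 0, 1; ring. Qed.

(** * Discriminants of quadratic algebras *)

Lemma unram_disc1 : unram_disc 1.
Proof. by exists 0; rewrite ?vge2_0 // mulr0 subr0; apply: eqsq_refl. Qed.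

Lemma unram_disc_neq0 x : unram_disc x -> x != 0.
Proof. by move=> [w hw xw]; apply: eqsq_neq0 xw (veq2_neq0 (unit_1m4 hw)). Qed.

Lemma ram_disc_neq0 x : ram_disc x -> x != 0.
Proof.
case=> [[u hu xu]|[u hu xu]]; apply: (eqsq_neq0 xu).
  exact: veq2_neq0 (veq2M veq2_2 hu).
exact: veq2_neq0 (unit_1p2 (veq2W hu)).
Qed.

Lemma unram_disc_val_even x : unram_disc x -> ~~ odd `|v x|.
Proof.
move=> ux; have x0 := unram_disc_neq0 ux; case: ux => w hw xw; rewrite (eqsq_val_odd x0 xw).
by have /veq2P[_ h] := unit_1m4 hw; lia.
Qed.

Lemma unram_discM x y : unram_disc x -> unram_disc y -> unram_disc (x * y).
Proof.
move=> [w hw xw] [w' hw' yw']; exists (w + w' - 4 * (w * w')).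
  by apply: vge2B; [exact: vge2D | exact: vge2_mul4 (vge2_intM hw hw') _].
by apply: eqsq_trans (eqsqM xw yw') _; apply: (@eq_ind_r _ _ (eqsq^~ _)) (eqsq_refl _) _ _; ring.
Qed.

Lemma eqsq_unram_disc x y : eqsq x y -> unram_disc y -> unram_disc x.
Proof. by move=> xy [w hw yw]; exists w => //; apply: eqsq_trans yw. Qed.

Lemma unram_discM_ram x y : unram_disc x -> ram_disc y -> ram_disc (x * y).
Proof.
move=> [w hw xw] [[u hu yu]|[u hu yu]]; [left|right].
  exists ((1 - 4 * w) * u); first exact: (veq2M (unit_1m4 hw) hu).
  by rewrite mulrCA; apply: eqsqM.
exists (u - 2 * (w * (1 + 2 * u))).
  apply: (veq2D hu); rewrite vge2N.
  by apply: vge2_mul2 (vge2_intM hw (veq2W (unit_1p2 (veq2W hu)))) _.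
have -> : 1 + 2 * (u - 2 * (w * (1 + 2 * u))) = (1 - 4 * w) * (1 + 2 * u) by ring.
exact: eqsqM.
Qed.

Lemma disc_xi_eqsq x y : eqsq x y -> disc_xi v x = disc_xi v y.
Proof.
move=> xy; rewrite /disc_xi.
have sq_transfer a b : eqsq a b -> (exists z, a = z ^+ 2) -> exists z, b = z ^+ 2.
  by move=> /eqsq_sym[c _ ->] [z ->]; exists (z * c); rewrite exprMn.
have even_transfer a b : eqsq a b ->
    (forall c d, (c != 0) || (d != 0) -> ~~ odd `|v (c ^+ 2 - a * d ^+ 2)|) ->
    forall c d, (c != 0) || (d != 0) -> ~~ odd `|v (c ^+ 2 - b * d ^+ 2)|.
  move=> /eqsq_sym[t t0 ->] h c d cd; have := h c (t * d).
  by rewrite mulf_eq0 (negPf t0) => /(_ cd); rewrite exprMn mulrA.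
have yx := eqsq_sym xy.
rewrite (_ : `[< exists z, x = z ^+ 2 >] = `[< exists z, y = z ^+ 2 >]); last first.
  by apply/asboolP/asboolP; apply: sq_transfer.
case: asboolP => // _; congr (if _ then _ else _).
by apply/asboolP/asboolP; apply: even_transfer.
Qed.

Lemma unram_norm_val_even w a b : vge2 w 0 -> ~ artin_schreier (- w) -> vge2 a 0 -> veq2 b 0 ->
  ~~ odd `|v (a ^+ 2 - (1 - 4 * w) * b ^+ 2)|.
Proof.
move=> hw nAS ha hb; have b0 := veq2_neq0 hb; have t0 := two_neq0; set D := _ - _.
have ib := veq2W hb; pose s := a - b; have hs : vge2 s 0 by apply: vge2B.
have DE : D = s * (s + 2 * b) + 4 * (w * b ^+ 2) by rewrite /D /s; ring.
have [hs2|/(vge2_unit hs) s_unit] := boolP (vge2 s 2); last first.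
  suff /veq2P[_] : veq2 D 0 by move: (v D) => k; goal_lia.
  rewrite DE; apply: veq2D; last exact: vge2_mul4 (vge2_intM hw (vge2_intX 2 ib)) _.
  by apply: (veq2M s_unit (l := 0)); apply: (veq2D s_unit); apply: vge2_mul2 ib _.
pose r := s / 2 / b; have hr : vge2 r 0.
  by apply: vge2_div (vge2_div2 hs2 (lexx _)) hb _.
have {}DE : D = 4 * ((r ^+ 2 + r - - w) * b ^+ 2).
  by rewrite DE /r; field; rewrite b0 t0.
have r_unit : veq2 (r ^+ 2 + r - - w) 0.
  apply: vge2_unit; last by apply/negP => h; apply: nAS; exists r.
  by rewrite opprK; apply: vge2D => //; apply: vge2D => //; apply: vge2_intX.
have /veq2P[_] : veq2 D 4; last by move: (v D) => k; goal_lia.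
by rewrite DE; apply: (veq2M veq2_4 (veq2M r_unit (veq2X 2 hb))).
Qed.

Lemma disc_xi_unram x : unram_disc x -> disc_xi v x != 0.
Proof.
move=> [w hw /disc_xi_eqsq->]; rewrite /disc_xi; case: asboolP => // nsq; case: asboolP => // -[].
have nAS : ~ artin_schreier (- w).
  by move/artin_schreier_square=> [s _]; rewrite mul1r mulrN => e; apply: nsq; exists s.
have D_unit := unit_1m4 hw; have /veq2P[D0 vD] := D_unit.
move=> a b; have [->|b0] := eqVneq b 0.
  by rewrite orbF expr0n mulr0 subr0 => a0; rewrite valX //; lia.
have [->|a0] := eqVneq a 0.
  by rewrite expr0n sub0r valN valM ?expf_neq0 // valX //; lia.
move=> _; set D := a ^+ 2 - _; have [ba|ab] := lerP (v b) (v a); last first.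
  have /veq2P[_] : veq2 D (2 * (2 * v a)).
    apply: veq2D; first by rewrite veq2_sqr /veq2 a0 eqxx.
    by rewrite vge2N; apply/vge2P => _; rewrite valM ?expf_neq0 // valX //; lia.
  by lia.
have nz : D != 0.
  rewrite subr_eq0; apply/eqP => e; apply: nsq; exists (a / b).
  by rewrite expr_div_n e mulfK // expf_neq0.
have := @unram_norm_val_even w (a / b) 1 hw nAS _ veq2_1.
have -> : (a / b) ^+ 2 - (1 - 4 * w) * 1 ^+ 2 = D / b ^+ 2 by rewrite /D; field.
rewrite valM ?invr_eq0 ?expf_neq0 // valV ?expf_neq0 // [v (b ^+ 2)]valX // => h.
suff : vge2 (a / b) 0 by move/h; lia.
by apply/vge2P => _; rewrite valM ?invr_eq0 // valV //; lia.
Qed.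

Lemma one_add_2unit_nonsquare u y : veq2 u 0 -> 1 + 2 * u <> y ^+ 2.
Proof.
move=> hu e; have h2u := veq2M veq2_2 hu.
have hy : veq2 y 0 by rewrite -veq2_sqr -e; apply: unit_1p2; apply: veq2W.
have hs : vge2 (y - 1) 0 by apply: vge2B (veq2W hy) (vge2_1 (lexx 0)).
have uE : 2 * u = (y - 1) * (y - 1 + 2) by rewrite -[2 * u](addKr 1) e; ring.
have [h|/(vge2_unit hs) h] := boolP (vge2 (y - 1) 2).
  have /vge2P/(_ (veq2_neq0 h2u)) : vge2 (2 * u) 4.
    by rewrite uE; apply: (vge2M h (vge2D h (veq2W veq2_2))).
  by case/veq2P: h2u => _ ->.
suff /veq2P[_] : veq2 (2 * u) 0 by case/veq2P: h2u => _ ->.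
by rewrite uE; apply: (veq2M h (l := 0)); apply: veq2D h (veq2_ge veq2_2 _).
Qed.

Lemma disc_xi_ram x : ram_disc x -> disc_xi v x = 0.
Proof.
case=> [[u hu]|[u hu]] /disc_xi_eqsq->; have /veq2P[n0 v2u] := veq2M veq2_2 hu;
  rewrite /disc_xi.
  case: asboolP => [[y e]|_].
    have y0 : y != 0 by move: n0; rewrite e expf_eq0.
    by move: v2u; rewrite e valX //; lia.
  case: asboolP => // h; have := h 0 1; rewrite oner_eq0 orbT => /(_ isT).
  by rewrite expr0n expr1n mulr1 sub0r valN; lia.
case: asboolP => [[y /(one_add_2unit_nonsquare hu)//]|_].
case: asboolP => // h; have := h 1 1; rewrite oner_eq0 => /(_ isT).
have -> : 1 ^+ 2 - (1 + 2 * u) * 1 ^+ 2 = - (2 * u) by ring.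
by rewrite valN; lia.
Qed.

(** * Symmetric forms and the Hasse invariant *)

Section SymmetricForm.

Variables (V : lmodType F) (B : {symmetric V}).
Local Notation "''[' x , y ]" := (B x y) : ring_scope.
Local Notation "''[' x ]" := (B x x) : ring_scope.

Lemma symformC x y : '[x, y] = '[y, x].
Proof. by rewrite hermC mul1r. Qed.

Lemma symnormDZ c x y : '[x + c *: y] = '[x] + 2 * c * '[x, y] + c ^+ 2 * '[y].
Proof. by rewrite linearDl !linearDr !linearZl_LR !linearZr_LR /= (symformC y x); ring. Qed.

Lemma symformDZ c d x y z w :
  '[x + c *: y, z + d *: w] = '[x, z] + d * '[x, w] + c * '[y, z] + c * d * '[y, w].
Proof. by rewrite linearDl !linearDr !linearZl_LR !linearZr_LR /=; ring. Qed.

Lemma symform_suml (I : Type) (r : seq I) (P : pred I) (f : I -> V) y :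
  '[\sum_(i <- r | P i) f i, y] = \sum_(i <- r | P i) '[f i, y].
Proof. exact: linear_sumlz. Qed.

Lemma symform_sumr (I : Type) (r : seq I) (P : pred I) (f : I -> V) y :
  '[y, \sum_(i <- r | P i) f i] = \sum_(i <- r | P i) '[y, f i].
Proof. exact: linear_sumr. Qed.

End SymmetricForm.

Fixpoint hasse (s : seq F) : int :=
  if s is x :: r then (\prod_(y <- r) hilb x y) * hasse r else 1.

Lemma hasse_perm s t : perm_eq s t -> hasse s = hasse t.
Proof.
have hasse_mid x r r' : hasse (r ++ x :: r') = hasse (x :: r ++ r').
  elim: r => //= y r; rewrite /= => ->.
  by rewrite !big_cat /= !big_cons (hilbC y x) !big_cat /=; ring.
elim: s t => [|x s IH] t; first by rewrite perm_sym => /perm_nilP->.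
move=> st; have xt : x \in t by rewrite -(perm_mem st) mem_head.
case/splitPr: xt st => t1 t2.
rewrite perm_sym perm_catC cat_cons perm_cons perm_catC perm_sym => st.
by rewrite hasse_mid /= (IH _ st) (perm_big _ st).
Qed.

Lemma hasse_cons x s : x != 0 -> all (fun y => y != 0) s ->
  hasse (x :: s) = hilb x (\prod_(y <- s) y) * hasse s.
Proof.
move=> x0 /= hs; congr (_ * _); elim: s hs => [_|y s IH /= /andP[y0 hs]].
  by rewrite !big_nil; apply/esym/hilbP; rewrite ?oner_eq0 // -(expr1n F 2); apply: isnorm_sqr.
by rewrite !big_cons IH // hilbMr // prodf_seq_neq0.
Qed.

Lemma hilb_plane (q1 q2 c1 c2 : F) : q1 != 0 -> q2 != 0 ->
  let N := c1 ^+ 2 * q1 + c2 ^+ 2 * q2 in N != 0 -> hilb N (q1 * q2 * N) = hilb q1 q2.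
Proof.
move=> q10 q20 N N0; have nq : - (q1 * q2) != 0 by rewrite oppr_eq0 mulf_neq0.
have -> : hilb N (q1 * q2 * N) = hilb N (- (q1 * q2)).
  by rewrite -mulrNN hilbMr ?oppr_eq0 ?mulf_neq0 // hilb_oppr // mulr1.
have <- : hilb q1 (- (q1 * q2)) = hilb q1 q2.
  by rewrite -mulNr hilbMr ?oppr_eq0 // hilb_oppr // mul1r.
have : hilb (q1 * N) (- (q1 * q2)) = 1.
  rewrite hilbC; apply/hilbP; rewrite ?mulf_neq0 //.
  by exists (c1 * q1), c2; rewrite /N; ring.
rewrite hilbMl //; move: (hilb_sign N (- (q1 * q2))) (hilb_sign q1 (- (q1 * q2))).
by do 2![case=> ->].
Qed.

Lemma pchar_dyadic : [pchar F] =i pred0.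
Proof.
move=> p; rewrite !inE; apply: contraTF isT => /andP[pp /eqP p0].
have : p%:R != 0 :> F; last by rewrite p0 eqxx.
case: (even_prime pp) => [->|op]; first exact: two_neq0.
have -> : p%:R = 1 + 2 * (p./2)%:R :> F.
  by rewrite -{1}(odd_double_half p) op -mul2n natrD natrM.
apply: veq2_neq0 (unit_1p2 _); elim: (p./2) => [|n IH]; first exact: vge2_0.
by rewrite -addn1 natrD; apply: vge2D => //; apply: vge2_1.
Qed.

Section OrthogonalSystems.

Variables (V : lmodType F) (B : {symmetric V}).
Local Notation "''[' x , y ]" := (B x y) : ring_scope.
Local Notation "''[' x ]" := (B x x) : ring_scope.
Implicit Types (s t r : seq V) (x y z : V).

Definition orth_system s : Prop :=
  [/\ uniq s, {in s &, forall x y, x != y -> '[x, y] = 0} & {in s, forall x, '[x] != 0}].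

(* For an orthogonal system [s] this is membership in the linear span of [s]. *)
Definition in_span s x : Prop := x = \sum_(y <- s) ('[x, y] / '[y]) *: y.

Definition norms s := [seq '[x] | x <- s].

Lemma orth_system_perm s t : perm_eq s t -> orth_system s -> orth_system t.
Proof.
move=> st [us os ns]; have m := perm_mem st; split.
- by rewrite -(perm_uniq st).
- by move=> x y; rewrite -!m; apply: os.
- by move=> x; rewrite -m; apply: ns.
Qed.

Lemma orth_system_cons x s :
  orth_system (x :: s) <-> [/\ '[x] != 0, {in s, forall y, '[x, y] = 0} & orth_system s].
Proof.
split=> [[/= /andP[xs us] os ns]|[x0 xs [us os ns]]].
  have sub y : y \in s -> y \in x :: s by rewrite inE orbC => ->.
  split; first by apply: ns; rewrite mem_head.
    by move=> y ys; apply: os; rewrite ?mem_head ?sub //; apply: contraNneq xs => ->.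
  by split=> // [y z /sub ys /sub zs|y /sub]; [apply: os | apply: ns].
split=> /=.
- by rewrite us andbT; apply: contra x0 => /xs ->.
- move=> y z; rewrite !inE => /orP[/eqP->|ys] /orP[/eqP->|zs]; rewrite ?eqxx // => yz.
  + exact: xs.
  + by rewrite symformC xs.
  + exact: os.
- by move=> y; rewrite inE => /orP[/eqP->|/ns].
Qed.

Lemma orth_system_catr s t : orth_system (s ++ t) -> orth_system t.
Proof. by elim: s => //= x s IH /orth_system_cons[_ _ /IH]. Qed.

Lemma norms_neq0 s : orth_system s -> all (fun q => q != 0) (norms s).
Proof. by case=> _ _ ns; rewrite all_map; apply/allP. Qed.

Lemma in_span_perm s t x : perm_eq s t -> in_span s x -> in_span t x.
Proof. by move=> st; rewrite /in_span => {1}->; apply: perm_big. Qed.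

Lemma in_spanD s x y : in_span s x -> in_span s y -> in_span s (x + y).
Proof.
rewrite /in_span => hx hy; rewrite {1}hx {1}hy -big_split /=; apply: eq_bigr => z _.
by rewrite linearDl mulrDl scalerDl.
Qed.

Lemma in_spanZ s c x : in_span s x -> in_span s (c *: x).
Proof.
rewrite /in_span => hx; rewrite {1}hx scaler_sumr; apply: eq_bigr => z _.
by rewrite scalerA linearZl_LR /= mulrA.
Qed.

Lemma in_span_mem s x : orth_system s -> x \in s -> in_span s x.
Proof.
move=> [us os ns] xs; rewrite /in_span (bigD1_seq x) //= divff ?ns // scale1r.
rewrite big_seq_cond big1 ?addr0 // => y /andP[ys yx].
by rewrite os // 1?eq_sym // mul0r scale0r.
Qed.

Lemma in_span_trans s t x : {in t, forall y, in_span s y} -> in_span t x -> in_span s x.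
Proof.
move=> ts; rewrite {1}/in_span => ->; rewrite big_seq.
apply: (big_ind (in_span s)) => [|y z|y yt]; last exact: in_spanZ (ts y yt).
  by rewrite /in_span big1 // => z _; rewrite linear0l mul0r scale0r.
exact: in_spanD.
Qed.

Lemma in_span_orth s x y : in_span s x -> {in s, forall z, '[y, z] = 0} -> '[y, x] = 0.
Proof.
move=> hx yz; rewrite hx symform_sumr big_seq big1 // => z zs.
by rewrite linearZr_LR /= yz // mulr0.
Qed.

Lemma in_span_behead s x y : '[x, y] = 0 -> in_span (y :: s) x -> in_span s x.
Proof. by rewrite /in_span big_cons => ->; rewrite mul0r scale0r add0r. Qed.

Lemma norm_in_span s x : in_span s x -> '[x] = \sum_(y <- s) '[x, y] ^+ 2 / '[y].
Proof.
move=> hx; rewrite {1}hx symform_suml; apply: eq_bigr => y _.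
by rewrite linearZl_LR /= [B y x]symformC expr2 mulrAC.
Qed.

Record orth_exchange s t : Prop := {
  exchange_orth : orth_system t;
  exchange_size : size t = size s;
  exchange_hasse : hasse (norms t) = hasse (norms s);
  exchange_disc : eqsq (\prod_(q <- norms t) q) (\prod_(q <- norms s) q);
  exchange_span : forall x, in_span s x <-> in_span t x }.

Lemma exchange_perm s t : perm_eq s t -> orth_system s -> orth_exchange s t.
Proof.
move=> st os; have nst : perm_eq (norms t) (norms s) by rewrite perm_map // perm_sym.
split.
- exact: orth_system_perm os.
- by rewrite (perm_size st).
- exact: hasse_perm.
- by rewrite (perm_big _ nst); apply: eqsq_refl.
- by move=> x; split; apply: in_span_perm; rewrite // perm_sym.
Qed.

Lemma exchange_trans s t r : orth_exchange s t -> orth_exchange t r -> orth_exchange s r.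
Proof.
move=> st tr; split.
- exact: exchange_orth tr.
- by rewrite (exchange_size tr) (exchange_size st).
- by rewrite (exchange_hasse tr) (exchange_hasse st).
- exact: eqsq_trans (exchange_disc tr) (exchange_disc st).
- by move=> x; rewrite (exchange_span st) (exchange_span tr).
Qed.

Lemma exchange_cons x s t : orth_system (x :: s) -> orth_exchange s t ->
  orth_exchange (x :: s) (x :: t).
Proof.
move=> oxs st; have [x0 xs os] := (orth_system_cons x s).1 oxs; have ot := exchange_orth st.
have xt : {in t, forall y, '[x, y] = 0}.
  by move=> y yt; apply: in_span_orth xs; apply/(exchange_span st); apply: in_span_mem.
have oxt : orth_system (x :: t) by apply/orth_system_cons.
have members_span s1 s2 : orth_system (x :: s2) -> orth_system s1 ->
    (forall y, in_span s1 y -> in_span s2 y) -> {in x :: s1, forall y, in_span (x :: s2) y}.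
  move=> o2 o1 sub y; rewrite inE => /orP[/eqP->|ys].
    by apply: in_span_mem; rewrite ?mem_head.
  apply: in_span_trans (sub y (in_span_mem o1 ys)) => z zs.
  by apply: in_span_mem; rewrite // inE zs orbT.
split=> //.
- by rewrite /= (exchange_size st).
- rewrite [norms _]/= [norms (x :: s)]/= !hasse_cons ?norms_neq0 // (exchange_hasse st).
  congr (_ * _); apply: hilb_eqsqr => //; last exact: exchange_disc st.
  by rewrite prodf_seq_neq0; apply: sub_all (norms_neq0 ot).
- by rewrite /= !big_cons; apply: eqsqM (eqsq_refl _) (exchange_disc st).
- by move=> y; split; apply: in_span_trans; apply: members_span => // z; rewrite (exchange_span st).
Qed.

Lemma exchange_catl r s t : orth_system (r ++ s) -> orth_exchange s t ->
  orth_exchange (r ++ s) (r ++ t).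
Proof.
elim: r => //= x r IH oxs st; apply: exchange_cons => //; apply: IH => //.
by case/orth_system_cons: oxs.
Qed.

Lemma exchange_scale y (c : F) : '[y] != 0 -> c != 0 -> orth_exchange [:: y] [:: c *: y].
Proof.
move=> y0 c0; have nE : '[c *: y] = '[y] * c ^+ 2 by rewrite linearZl_LR linearZr_LR /=; ring.
have oy : orth_system [:: y] by apply/orth_system_cons; split.
have ocy : orth_system [:: c *: y].
  by apply/orth_system_cons; split; rewrite // nE mulf_neq0 ?expf_neq0.
split=> //=.
- by rewrite !big_nil.
- by rewrite !big_cons !big_nil !mulr1 nE; exists c.
- move=> x; split; apply: in_span_trans => z; rewrite inE => /eqP->; last first.
    by apply/in_spanZ/in_span_mem; rewrite ?mem_head.
  rewrite -[X in in_span _ X]scale1r -(mulVf c0) -scalerA; apply: in_spanZ.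
  by apply: in_span_mem; rewrite ?mem_head.
Qed.

Lemma plane_combination c q1 q2 (y1 y2 : V) :
  let t := c *: y1 + y2 in let z := q2 *: y1 - (c * q1) *: y2 in let N := c ^+ 2 * q1 + q2 in
  (c * q1) *: t + z = N *: y1 /\ q2 *: t - c *: z = N *: y2.
Proof.
move=> t z N; rewrite /t /z /N scalerBr !scalerDr !scalerA; split.
  by rewrite addrACA subrr addr0 -scalerDl; congr (_ *: _); ring.
rewrite opprD opprK addrACA [c * q2]mulrC subrr add0r -scalerDl.
by congr (_ *: _); ring.
Qed.

Lemma exchange_plane y1 y2 c : orth_system [:: y1; y2] -> '[c *: y1 + y2] != 0 ->
  exists z, orth_exchange [:: y1; y2] [:: c *: y1 + y2; z].
Proof.
move=> oy; have [q10 o12 /orth_system_cons[q20 _ _]] := (orth_system_cons _ _).1 oy.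
have {}o12 : '[y1, y2] = 0 by apply: o12; rewrite mem_head.
set t := c *: y1 + y2; pose z := '[y2] *: y1 - (c * '[y1]) *: y2.
have [ty1 ty2] := plane_combination c '[y1] '[y2] y1 y2; rewrite /= -/t -/z in ty1 ty2.
have formE a b a' b' : '[a *: y1 + b *: y2, a' *: y1 + b' *: y2] = a * a' * '[y1] + b * b' * '[y2].
  by rewrite symformDZ !linearZl_LR !linearZr_LR /= [B y2 y1]symformC o12; ring.
have t1E : t = c *: y1 + 1 *: y2 by rewrite scale1r.
have zE : z = '[y2] *: y1 + (- (c * '[y1])) *: y2 by rewrite scaleNr.
have tN : '[t] = c ^+ 2 * '[y1] + '[y2] by rewrite t1E formE; ring.
have zN : '[z] = '[y1] * '[y2] * '[t] by rewrite tN zE formE; ring.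
have tz : '[t, z] = 0 by rewrite t1E zE formE; ring.
rewrite -tN in ty1 ty2; move=> t0; exists z; have z0 : '[z] != 0 by rewrite zN !mulf_neq0.
have otz : orth_system [:: t; z].
  apply/orth_system_cons; split=> //; first by move=> x; rewrite inE => /eqP->.
  by apply/orth_system_cons; split.
have my1 := in_span_mem oy (mem_head _ _); have my2 := @in_span_mem _ y2 oy (mem_last _ [:: y2]).
have mt := in_span_mem otz (mem_head _ _); have mz := @in_span_mem _ z otz (mem_last _ [:: z]).
have divN y : in_span [:: t; z] ('[t] *: y) -> in_span [:: t; z] y.
  by move/(in_spanZ '[t]^-1); rewrite scalerA mulVf // scale1r.
split=> //=.
- rewrite !big_cons !big_nil !mulr1 zN tN.
  by have := @hilb_plane '[y1] '[y2] c 1 q10 q20; rewrite /= expr1n mul1r -tN; apply.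
- by rewrite !big_cons !big_nil !mulr1 zN; exists '[t] => //; ring.
move=> x; split; apply: in_span_trans => w; rewrite !inE => /orP[] /eqP->.
- by apply: divN; rewrite -ty1; apply: in_spanD => //; apply: in_spanZ.
- by apply: divN; rewrite -ty2 -scaleNr; apply: in_spanD; apply: in_spanZ.
- by apply: in_spanD => //; apply: in_spanZ.
- by rewrite zE; apply: in_spanD; apply: in_spanZ.
Qed.

Lemma exists_nonisotropic_rest s x : (1 < size s)%N -> in_span s x -> '[x] != 0 ->
  exists2 y, y \in s & '[x] != '[x, y] ^+ 2 / '[y].
Proof.
move=> s1 xs x0; apply: contrapT => all_eq.
have termE y : y \in s -> '[x, y] ^+ 2 / '[y] = '[x].
  by move=> ys; apply/esym/eqP; apply: contraT => ne; case: all_eq; exists y.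
have : '[x] *+ (size s).-1 = 0.
  apply: (addrI '[x]); rewrite addr0 -mulrS prednK ?(ltn_trans _ s1) //.
  rewrite [in RHS](norm_in_span xs) big_seq (eq_bigr (fun=> '[x])) => [|y ys]; last exact: termE.
  by rewrite -big_seq big_const_seq count_predT iter_addr_0.
move/eqP; rewrite -mulr_natr mulf_eq0 (negPf x0) /= ((pcharf0P _).1 pchar_dyadic) => /eqP.
by case: (size s) s1 => [|[]].
Qed.

Lemma exchange_reach s x : orth_system s -> in_span s x -> '[x] != 0 ->
  exists r, orth_exchange s (x :: r).
Proof.
elim: {s}(size s) {-2}s (erefl (size s)) x => [|n IH] s sz x os xs x0.
  by move: x0; rewrite (norm_in_span xs) (size0nil sz) big_nil eqxx.
have [n0|n_gt0] := posnP n.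
  case: s sz os xs => [|y [|]] //; rewrite ?n0 // => _ oy; rewrite /in_span big_seq1 => xE.
  exists [::]; rewrite xE; apply: exchange_scale; first by have [] := (orth_system_cons _ _).1 oy.
  by apply: contraNneq x0 => c0; rewrite xE c0 scale0r linear0l.
have [|y ys ne] := exists_nonisotropic_rest _ xs x0; first by rewrite sz.
have sy := perm_to_rem ys; set r := rem y s in sy.
have oyr := orth_system_perm sy os; have [y0 yr or] := (orth_system_cons _ _).1 oyr.
pose c := '[x, y] / '[y]; pose z := x - c *: y.
have xE : x = c *: y + z by rewrite addrC subrK.
have yz : '[z, y] = 0 by rewrite /z linearBl linearZl_LR /= /c divfK ?subrr.
have zr : in_span r z.
  apply: (in_span_behead yz); apply: in_spanD; first exact: in_span_perm xs.
  by rewrite -scaleNr; apply: in_spanZ; apply: in_span_mem (mem_head _ _).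
have z0 : '[z] != 0.
  rewrite /z -scaleNr symnormDZ /c; apply: contraNneq ne => e.
  by rewrite -subr_eq0 -e; apply/eqP; field.
have [|r' rr'] := IH r _ z or zr z0.
  by apply/eqP; rewrite -eqSS -[_.+1]/(size (y :: r)) -(perm_size sy) sz.
have yzr := exchange_cons oyr rr'; have oyzr := exchange_orth yzr.
have pyz : perm_eq (y :: z :: r') (r' ++ [:: y; z]).
  by rewrite -[y :: _]/([:: y; z] ++ r') perm_catC.
have orp := orth_system_perm pyz oyzr.
have [|t yzt] := @exchange_plane y z c (orth_system_catr orp); first by rewrite -xE.
exists (t :: r'); apply: (exchange_trans (exchange_perm sy os)).
apply: (exchange_trans yzr); apply: (exchange_trans (exchange_perm pyz oyzr)).
have rt := exchange_catl orp yzt; apply: (exchange_trans rt).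
apply: exchange_perm (exchange_orth rt); rewrite -xE.
by rewrite perm_catC.
Qed.

Lemma exchange_bases s t : size s = size t -> orth_system s -> orth_system t ->
  {in t, forall x, in_span s x} -> orth_exchange s t.
Proof.
elim: t s => [|x t IH] s /=.
  by move=> /size0nil -> os _ _; apply: exchange_perm.
move=> sz os oxt st; have [x0 xt ot] := (orth_system_cons _ _).1 oxt.
have [r sr] := exchange_reach os (st x (mem_head _ _)) x0.
have oxr := exchange_orth sr; have [_ _ or] := (orth_system_cons _ _).1 oxr.
apply: (exchange_trans sr); apply: exchange_cons => //; apply: IH => //.
  by apply/eqP; rewrite -eqSS -sz -[_.+1]/(size (x :: r)) (exchange_size sr).
move=> y yt; apply: (@in_span_behead _ _ x); first by rewrite symformC xt.
by apply/(exchange_span sr); apply: st; rewrite inE yt orbT.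
Qed.

End OrthogonalSystems.

Section MatrixForm.

Variable m : nat.
Implicit Types (M X : 'M[F]_m) (d : 'rV[F]_m).

Definition mxform M (x y : 'cV[F]_m) : F := (x^T *m M *m y) 0 0.

Lemma mxform_is_bilinear M : bilinear_for *%R *%R (mxform M).
Proof.
split=> [y c x x'|x c y y']; rewrite /mxform.
  by rewrite linearP /= !mulmxDl -!scalemxAl !mxE.
by rewrite mulmxDr -scalemxAr !mxE.
Qed.

Lemma mxformC M x y : M^T = M -> mxform M x y = mxform M y x.
Proof.
move=> sM; rewrite /mxform -[in LHS](trmxK (x^T *m M *m y)) [LHS]mxE.
by congr ((_ : 'M__) _ _); rewrite !trmx_mul sM trmxK mulmxA.
Qed.

Definition symmxform M (sM : M^T = M) : {symmetric 'cV[F]_m} :=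
  HB.pack_for {symmetric 'cV[F]_m} (mxform M)
    (@bilinear_isBilinear.Build F 'cV[F]_m 'cV[F]_m F *%R *%R (mxform M) (mxform_is_bilinear M))
    (@isHermitianSesquilinear.Build F 'cV[F]_m false idfun (mxform M)
      (fun x y => etrans (mxformC x y sM) (esym (mul1r _)))).

Lemma mxform_col M X i j : mxform M (col i X) (col j X) = (X^T *m M *m X) i j.
Proof.
rewrite /mxform !colE trmx_mul trmx_delta !mulmxA -[_ *m X *m _]mulmxA -!mulmxA -rowE !mulmxA.
by rewrite -colE !mxE.
Qed.

Lemma diag_congr_sym M X d : X \in unitmx -> X^T *m M *m X = diag_mx d -> M^T = M.
Proof.
move=> uX e; have uXt : X^T \in unitmx by rewrite unitmx_tr.
have -> : M = invmx X^T *m diag_mx d *m invmx X.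
  by rewrite -e !mulmxA mulVmx // mul1mx mulmxK.
by rewrite !trmx_mul tr_diag_mx !trmx_inv trmxK mulmxA.
Qed.

Lemma diag_congr_det M X d : X^T *m M *m X = diag_mx d -> \prod_i d 0 i = \det X ^+ 2 * \det M.
Proof. by rewrite -det_diag => <-; rewrite !det_mulmx det_tr; ring. Qed.

Lemma hasse_pairwise (g : 'I_m -> F) s : pairwise (fun i j : 'I_m => (i < j)%N) s ->
  hasse (map g s) = \prod_(i <- s) \prod_(j <- s | (i < j)%N) hilb (g i) (g j).
Proof.
elim: s => [|x s IH]; first by rewrite big_nil.
rewrite pairwise_cons => /andP[/allP hx hs]; rewrite /= IH // !big_cons ltnn; congr (_ * _).
  rewrite big_map big_seq [RHS]big_seq_cond; apply: eq_bigl => j.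
  by case: (boolP (j \in s)) => // /hx ->.
rewrite big_seq [RHS]big_seq; apply: eq_bigr => i /hx xi.
by rewrite big_cons ltnNge (ltnW xi).
Qed.

Lemma hasse_row d : hasse [seq d 0 i | i <- enum 'I_m] =
  \prod_(i < m) \prod_(j < m | (i < j)%N) hilb (d 0 i) (d 0 j).
Proof.
rewrite hasse_pairwise; last first.
  have := iota_ltn_sorted 0 m; rewrite (sorted_pairwise ltn_trans) -val_enum_ord pairwise_map.
  by [].
by rewrite big_enum; apply: eq_bigr => i _; apply: big_enum_cond.
Qed.

Section Diagonalized.

Variables (M X : 'M[F]_m) (d : 'rV[F]_m) (sM : M^T = M).
Hypotheses (uX : X \in unitmx) (XM : X^T *m M *m X = diag_mx d) (d0 : forall i, d 0 i != 0).

Let cols := [seq col i X | i <- enum 'I_m].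

Let mxform_cols i j : symmxform sM (col i X) (col j X) = d 0 i *+ (i == j).
Proof. by rewrite [LHS]mxform_col XM mxE. Qed.

Lemma norms_cols : norms (symmxform sM) cols = [seq d 0 i | i <- enum 'I_m].
Proof. by rewrite /norms -map_comp; apply: eq_map => i; have := mxform_cols i i; rewrite eqxx. Qed.

Lemma orth_system_cols : orth_system (symmxform sM) cols.
Proof.
split.
- rewrite map_inj_uniq ?enum_uniq // => i j eij; apply/eqP; apply: contraT => ij.
  have := mxform_cols i j; rewrite -eij mxform_cols eqxx (negPf ij) => /eqP.
  by rewrite (negPf (d0 _)).
- move=> _ _ /mapP[i _ ->] /mapP[j _ ->] ne; rewrite mxform_cols.
  by case: (eqVneq i j) ne => [->|_ _]; rewrite ?eqxx.
- by move=> _ /mapP[i _ ->]; rewrite mxform_cols eqxx mulr1n.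
Qed.

Lemma in_span_cols x : in_span (symmxform sM) cols x.
Proof.
have xE : x = \sum_i (invmx X *m x) i 0 *: col i X.
  rewrite -{1}[x](mulKVmx uX); apply/colP => k; rewrite mxE summxE; apply: eq_bigr => i _.
  by rewrite !mxE mulrC.
apply: (@in_span_trans _ _ _ cols) => [y|]; first exact: in_span_mem orth_system_cols.
rewrite xE; apply: (big_ind (in_span (symmxform sM) cols)) => [|y z|i _].
- by rewrite /in_span big1 // => z _; rewrite linear0l mul0r scale0r.
- exact: in_spanD.
- by apply/in_spanZ/in_span_mem; [exact: orth_system_cols | apply/map_f/mem_enum].
Qed.

End Diagonalized.

Lemma eta_congr_diag M X d : X \in unitmx -> X^T *m M *m X = diag_mx d -> (forall i, d 0 i != 0) ->
  Defs.eta M = eta_diag (\det M) d.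
Proof.
move=> uX e d0; have sM := diag_congr_sym uX e.
rewrite /Defs.eta; set d' := classical_sets.xget _ _.
have [U [uU e']] : exists U : 'M[F]_m, U \in unitmx /\ U^T *m M *m U = diag_mx d'.
  exact: (@classical_sets.xgetPex _ 0 (fun d : 'rV[F]_m => exists U : 'M[F]_m,
    U \in unitmx /\ U^T *m M *m U = diag_mx d) (ex_intro _ d (ex_intro _ X (conj uX e)))).
have d'0 i : d' 0 i != 0.
  have : \prod_i d' 0 i != 0.
    have : \prod_i d 0 i != 0 by apply/prodf_neq0 => j _; apply: d0.
    rewrite (diag_congr_det e) (diag_congr_det e') mulf_eq0 negb_or => /andP[_ dM].
    by rewrite mulf_neq0 // expf_neq0 // -unitfE -unitmxE.
  by move/prodf_neq0 => /(_ i isT).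
rewrite /eta_diag; congr (_ * _); rewrite -!hasse_row -(norms_cols sM e) -(norms_cols sM e').
apply: exchange_hasse; apply: exchange_bases; rewrite ?size_map //.
- exact: orth_system_cols e d0.
- exact: orth_system_cols e' d'0.
by move=> x _; apply: in_span_cols uX e d0 x.
Qed.

End MatrixForm.

(** * Lattice filtrations and reduced systems *)

Section LinearCombinations.

Variable V : lmodType F.
Implicit Types (f g : nat -> V) (I J : seq nat) (C : nat -> F -> bool) (x y : V).

Inductive lincomb f I C : V -> Prop :=
| lincomb0 : lincomb f I C 0
| lincombS x m c : lincomb f I C x -> m \in I -> C m c -> lincomb f I C (x + c *: f m).

Lemma lincombD f I C x y : lincomb f I C x -> lincomb f I C y -> lincomb f I C (x + y).
Proof.
move=> hx; elim: y / => [|y m c _ IH mI hc]; first by rewrite addr0.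
by rewrite addrA; apply: lincombS.
Qed.

Lemma lincomb_sum f I C (T : Type) (r : seq T) (P : pred T) (g : T -> V) :
  (forall i, P i -> lincomb f I C (g i)) -> lincomb f I C (\sum_(i <- r | P i) g i).
Proof.
move=> h; apply: (big_ind (lincomb f I C)) => //; first exact: lincomb0.
exact: lincombD.
Qed.

Lemma lincombZ f I C C' s x : lincomb f I C x -> (forall m c, C m c -> C' m (s * c)) ->
  lincomb f I C' (s *: x).
Proof.
move=> hx h; elim: x / hx => [|x m c _ IH mI hc]; first by rewrite scaler0; apply: lincomb0.
by rewrite scalerDr scalerA; apply: lincombS => //; apply: h.
Qed.

Lemma lincomb_sub f I J C C' x : lincomb f I C x -> {subset I <= J} ->
  (forall m c, m \in I -> C m c -> C' m c) -> lincomb f J C' x.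
Proof.
move=> hx IJ h; elim: x / hx => [|x m c _ IH mI hc]; first exact: lincomb0.
by apply: lincombS => //; [apply: IJ | apply: h].
Qed.

Lemma lincomb1 f I C m c : m \in I -> C m c -> lincomb f I C (c *: f m).
Proof. by move=> mI hc; rewrite -[_ *: _]add0r; apply: lincombS => //; apply: lincomb0. Qed.

Lemma lincomb_orth (B : {symmetric V}) f I C x y : lincomb f I C x ->
  {in I, forall m, B (f m) y = 0} -> B x y = 0.
Proof.
move=> hx h; elim: x / hx => [|x m c _ IH mI hc]; first by rewrite linear0l.
by rewrite linearDl linearZl_LR /= IH h // mulr0 addr0.
Qed.

Lemma lincomb_coef f I C x : uniq I -> lincomb f I C x ->
  exists c : nat -> F, x = \sum_(m <- I) c m *: f m.
Proof.
move=> uI; elim: x / => [|x m c _ [d ->] mI _].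
  by exists (fun=> 0); rewrite big1 // => i _; rewrite scale0r.
exists (fun i => d i + (if i == m then c else 0)).
rewrite [RHS](eq_bigr (fun i => d i *: f i + (if i == m then c else 0) *: f i)); last first.
  by move=> i _; rewrite scalerDl.
rewrite big_split /=; congr (_ + _); rewrite (bigD1_seq m) //= eqxx big1 ?addr0 // => i /negPf->.
by rewrite scale0r.
Qed.

Definition lspan f I : V -> Prop := lincomb f I (fun _ _ => true).

Lemma lspan_mem f I m : m \in I -> lspan f I (f m).
Proof. by move=> mI; rewrite -[f m]scale1r; apply: lincomb1. Qed.

Lemma lspan_trans f g I J x : {in I, forall i, lspan f J (g i)} -> lspan g I x -> lspan f J x.
Proof.
move=> gJ; elim: x / => [|x m c _ IHx mI _]; first exact: lincomb0.
by apply: lincombD => //; apply: lincombZ (gJ _ mI) _.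
Qed.

Lemma lincomb_lspan f I J C x : {subset I <= J} -> lincomb f I C x -> lspan f J x.
Proof. by move=> IJ h; apply: lincomb_sub h IJ _. Qed.

End LinearCombinations.

Section Filtration.

Variables (V : lmodType F) (B : {symmetric V}).
Local Notation "''[' x , y ]" := (B x y) : ring_scope.
Local Notation "''[' x ]" := (B x x) : ring_scope.
Implicit Types (f g : nat -> V) (a : nat -> nat) (I J : seq nat) (x y : V).

Definition level f a I (t : int) : V -> Prop := lincomb f I (fun m c => vge2 c (t - (a m)%:Z)).

Lemma level_le f a I J t t' x : level f a I t x -> {subset I <= J} -> t' <= t -> level f a J t' x.
Proof. by move=> h IJ tt; apply: lincomb_sub h IJ _ => m c _ hc; apply: vge2_le hc _; lia. Qed.

Lemma levelZ f a I t t' s r x : level f a I t x -> vge2 s r -> t' <= t + r ->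
  level f a I t' (s *: x).
Proof. by move=> h hs ht; apply: (lincombZ h) => m c hc; apply: (vge2M_le hs hc); lia. Qed.

Lemma levelN f a I t x : level f a I t x -> level f a I t (- x).
Proof.
by move=> h; rewrite -scaleN1r; apply: (levelZ h (r := 0)); rewrite ?vge2N ?vge2_1 ?addr0.
Qed.

Lemma level_mem f a I m : m \in I -> level f a I (a m)%:Z (f m).
Proof. by move=> mI; rewrite -[f m]scale1r; apply: lincomb1 => //; apply: vge2_1; goal_lia. Qed.

Lemma level1 f a I t m c : m \in I -> vge2 c (t - (a m)%:Z) -> level f a I t (c *: f m).
Proof. by move=> mI hc; apply: lincomb1. Qed.

Lemma level_trans f f' a I I' t x : {in I', forall m, level f a I (a m)%:Z (f' m)} ->
  level f' a I' t x -> level f a I t x.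
Proof.
move=> h; elim: x / => [|x m c _ IH mI hc]; first exact: lincomb0.
apply: lincombD => //; apply: (levelZ (h _ mI) hc); goal_lia.
Qed.

Definition bounded f a I : Prop :=
  {in I, forall i, vge2 '[f i] (2 * (a i)%:Z)} /\
  {in I &, forall i j, i != j -> vge2 (2 * '[f i, f j]) ((a i)%:Z + (a j)%:Z)}.

Lemma bounded_sub f a I J : {subset J <= I} -> bounded f a I -> bounded f a J.
Proof. by move=> JI [norm off]; split=> [i /JI|i j /JI iI /JI jI]; [apply: norm|apply: off]. Qed.

Lemma level_form f a I s t x y : bounded f a I -> level f a I s x -> level f a I t y ->
  vge2 (2 * '[x, y]) (s + t).
Proof.
move=> [norm off] hx hy; elim: x / hx => [|x i c _ IHx iI hc].
  by rewrite linear0l mulr0 vge2_0.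
rewrite linearDl mulrDr; apply: vge2D => //; rewrite linearZl_LR /= mulrCA.
have hiy : vge2 (2 * '[f i, y]) ((a i)%:Z + t).
  elim: y / hy {IHx} => [|y j d _ IHy jI hd]; first by rewrite linear0r mulr0 vge2_0.
  rewrite linearDr mulrDr; apply: vge2D => //; rewrite linearZr_LR /= mulrCA.
  apply: (vge2M_le hd (l := (a i)%:Z + (a j)%:Z)); last by goal_lia.
  have [->|ij] := eqVneq i j; last exact: off.
  apply: (vge2_mul2 (norm _ jI)); goal_lia.
apply: (vge2M_le hc hiy); goal_lia.
Qed.

Lemma level_norm f a I s x : bounded f a I -> level f a I s x -> vge2 '[x] (2 * s).
Proof.
move=> hb hx; have [norm off] := hb; elim: x / hx => [|x i c hx IHx iI hc].
  by rewrite linear0l vge2_0.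
rewrite symnormDZ expr2; apply: vge2D; last first.
  by apply: (vge2M_le (vge2M hc hc) (norm _ iI)); goal_lia.
have -> : 2 * c * '[x, f i] = c * (2 * '[x, f i]) by ring.
apply: vge2D => //; by apply: (vge2M_le hc (level_form hb hx (level_mem f a iI))); goal_lia.
Qed.

(* The forms induced on the associated graded pieces agree. *)
Definition gram_congr f f' a I : Prop :=
  {in I, forall i, vge2 ('[f' i] - '[f i]) (2 * (a i)%:Z + 2)} /\
  {in I &, forall i j, i != j ->
     vge2 (2 * '[f' i, f' j] - 2 * '[f i, f j]) ((a i)%:Z + (a j)%:Z + 1)}.

Lemma gram_congr_refl f a I : gram_congr f f a I.
Proof. by split=> [i _|i j _ _ _]; rewrite subrr vge2_0. Qed.

Lemma gram_congr_sym f f' a I : gram_congr f f' a I -> gram_congr f' f a I.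
Proof.
move=> [dnorm doff].
by split=> [i iI|i j iI jI ij]; rewrite -vge2N opprB; [apply: dnorm|apply: doff].
Qed.

Lemma gram_congr_trans g f f' a I : gram_congr f g a I -> gram_congr g f' a I ->
  gram_congr f f' a I.
Proof.
have subE (p q r : F) : r - p = (q - p) + (r - q) by ring.
move=> [dnorm doff] [dnorm' doff']; split=> [i iI|i j iI jI ij].
  by rewrite (subE _ '[g i]); apply: vge2D; [apply: dnorm|apply: dnorm'].
by rewrite (subE _ (2 * '[g i, g j])); apply: vge2D; [apply: doff|apply: doff'].
Qed.

Lemma gram_congr_sub f f' a I J : {subset J <= I} -> gram_congr f f' a I -> gram_congr f f' a J.
Proof.
by move=> JI [dnorm doff]; split=> [i /JI|i j /JI iI /JI jI]; [apply: dnorm|apply: doff].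
Qed.

Lemma level_gram_congr g f f' a I J : bounded g a I ->
  {in J, forall i, level g a I (a i)%:Z (f i)} ->
  {in J, forall i, level g a I ((a i)%:Z + 1) (f' i - f i)} -> gram_congr f f' a J.
Proof.
move=> hb hf hd.
split=> [i iI|i j iI jI ij]; have /= hfi := hf i iI; have /= hdi := hd i iI.
  have -> : '[f' i] - '[f i] = 2 * '[f i, f' i - f i] + '[f' i - f i].
    by rewrite !(linearBl, linearBr) /= [B (f' i) (f i)]symformC; ring.
  apply: vge2D; first by apply: (vge2_parity (level_form hb hfi hdi)); goal_lia.
  by apply: vge2_le (level_norm hb hdi) _; goal_lia.
have hfj := hf j jI; have hdj := hd j jI.
have -> : 2 * '[f' i, f' j] - 2 * '[f i, f j] =
     2 * '[f i, f' j - f j] + 2 * '[f' i - f i, f j] + 2 * '[f' i - f i, f' j - f j].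
  by rewrite !(linearBl, linearBr) /=; ring.
apply: vge2D; first apply: vge2D.
- by apply: vge2_le (level_form hb hfi hdj) _; goal_lia.
- by apply: vge2_le (level_form hb hdi hfj) _; goal_lia.
- by apply: vge2_le (level_form hb hdi hdj) _; goal_lia.
Qed.

(* The indices are matched into pairs [ps] spanning planes of unramified discriminant, except for
   the singles [ss] (at most two, by [reduced_parity]); everything else vanishes in the associated
   graded form. *)
Record reduced f a (ps : seq (nat * nat)) (ss : seq nat) : Prop := {
  reduced_uniq : uniq (support ps ss);
  reduced_norm : {in support ps ss, forall i, vge2 '[f i] (2 * (a i)%:Z)};
  reduced_pair : {in ps, forall p, veq2 (2 * '[f p.1, f p.2]) ((a p.1)%:Z + (a p.2)%:Z)};
  reduced_off : {in support ps ss &, forall i j, i != j -> ~~ matched ps i j ->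
    vge2 (2 * '[f i, f j]) ((a i)%:Z + (a j)%:Z + 1)};
  reduced_single : {in ss, forall i, veq2 '[f i] (2 * (a i)%:Z)};
  reduced_parity : {in ss &, forall i j, i != j -> odd (a i + a j)} }.

Implicit Types (ps : seq (nat * nat)) (ss : seq nat).

Lemma reduced_matched f a ps ss i j : reduced f a ps ss -> matched ps i j ->
  veq2 (2 * '[f i, f j]) ((a i)%:Z + (a j)%:Z).
Proof. by move=> h /orP[] /(reduced_pair h) //=; rewrite symformC addrC. Qed.

Lemma reduced_bounded f a ps ss : reduced f a ps ss -> bounded f a (support ps ss).
Proof.
move=> h; split=> [|i j iI jI ij]; first exact: reduced_norm h.
have [/(reduced_matched h)/veq2W //|hl] := boolP (matched ps i j).
by apply: vge2_le (reduced_off h iI jI ij hl) _; goal_lia.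
Qed.

Lemma reduced_congr f f' a ps ss : reduced f a ps ss -> gram_congr f f' a (support ps ss) ->
  reduced f' a ps ss.
Proof.
move=> h [dnorm doff].
have normE i : '[f' i] = '[f i] + ('[f' i] - '[f i]) by ring.
have formE i j :
  2 * '[f' i, f' j] = 2 * '[f i, f j] + (2 * '[f' i, f' j] - 2 * '[f i, f j]) by ring.
split; first exact: reduced_uniq h.
- move=> i iI; rewrite normE; apply: vge2D; first exact: (reduced_norm h).
  by apply: vge2_le (dnorm _ iI) _; goal_lia.
- move=> p pI; rewrite formE; have p12 := pair_support ss pI.
  apply: (veq2D (reduced_pair h pI)); apply: doff; rewrite ?p12 //.
  exact: paired_neq (support_uniq_paired (reduced_uniq h)) pI.
- move=> i j iI jI ij hl; rewrite formE; apply: vge2D; last exact: doff.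
  exact: (reduced_off h).
- move=> i iI; rewrite normE; apply: (veq2D (reduced_single h iI)).
  by apply: vge2_le (dnorm i (single_support _ iI)) _; goal_lia.
exact: reduced_parity h.
Qed.

Lemma reduced_eq_in f f' a a' ps ss : reduced f a ps ss -> {in support ps ss, f =1 f'} ->
  {in support ps ss, a =1 a'} -> reduced f' a' ps ss.
Proof.
move=> h hf ha; have sI i : i \in ss -> i \in support ps ss by apply: single_support.
split; first exact: reduced_uniq h.
- by move=> i iI; rewrite -hf // -ha //; apply: (reduced_norm h).
- by move=> p pI; rewrite -!hf -?ha ?(pair_support ss pI) //; apply: (reduced_pair h).
- by move=> i j iI jI ij hl; rewrite -!hf // -!ha //; apply: (reduced_off h).
- by move=> i iI; rewrite -hf ?sI // -ha ?sI //; apply: (reduced_single h).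
- by move=> i j iI jI ij; rewrite -!ha ?sI //; apply: (reduced_parity h).
Qed.

Lemma reduced_perm f a ps ss ss' : perm_eq ss ss' -> reduced f a ps ss -> reduced f a ps ss'.
Proof.
move=> pp h; have pI : perm_eq (support ps ss) (support ps ss') by rewrite perm_cat2r.
have m := perm_mem pI; have ms := perm_mem pp.
split; first by rewrite -(perm_uniq pI); apply: reduced_uniq h.
- by move=> i; rewrite -m; apply: (reduced_norm h).
- exact: reduced_pair h.
- by move=> i j; rewrite -!m; apply: (reduced_off h).
- by move=> i; rewrite -ms; apply: (reduced_single h).
- by move=> i j; rewrite -!ms; apply: (reduced_parity h).
Qed.

Lemma reduced_behead f a p ps ss : reduced f a (p :: ps) ss -> reduced f a ps ss.
Proof.
move=> h; have [_ u out] := support_cons_uniq (reduced_uniq h).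
have sub i : i \in support ps ss -> i \in support (p :: ps) ss.
  by rewrite mem_support_cons !inE => ->; rewrite !orbT.
split=> //.
- by move=> i /sub; apply: (reduced_norm h).
- by move=> q qp; apply: (reduced_pair h); rewrite inE qp orbT.
- move=> i j iI jI ij hl; apply: (reduced_off h); rewrite ?sub //.
  by rewrite matched_cons_out // out.
- exact: reduced_single h.
exact: reduced_parity h.
Qed.

Lemma reduced_paired f a ps ss : reduced f a ps ss -> reduced f a ps [::].
Proof.
move=> h; have sub i : i \in paired ps -> i \in support ps ss by apply: paired_support.
split=> //.
- exact: support_uniq_paired (reduced_uniq h).
- by move=> i /sub; apply: (reduced_norm h).
- exact: reduced_pair h.
- by move=> i j /sub iI /sub jI; apply: (reduced_off h).
Qed.

Lemma plane_projection p q x (A C t : int) : vge2 '[p] (2 * A) -> vge2 '[q] (2 * C) ->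
  veq2 (2 * '[p, q]) (A + C) -> vge2 (2 * '[p, x]) (A + t) -> vge2 (2 * '[q, x]) (C + t) ->
  exists c d, [/\ vge2 c (t - A), vge2 d (t - C),
    '[p, x - (c *: p + d *: q)] = 0 & '[q, x - (c *: p + d *: q)] = 0].
Proof.
move=> hp hq hpq hpx hqx; have n2 := two_neq0; have n4 := four_neq0.
pose D := '[p] * '[q] - '[p, q] ^+ 2.
have e4D : veq2 (4 * D) (2 * (A + C)).
  have -> : 4 * D = - (2 * '[p, q]) ^+ 2 + 4 * ('[p] * '[q]) by rewrite /D; ring.
  apply: veq2D; first by rewrite veq2N veq2_sqr.
  by apply: vge2_mul4 (vge2M hp hq) _; goal_lia.
have D0 : D != 0 by apply: contraNneq (veq2_neq0 e4D) => ->; rewrite mulr0.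
exists (('[p, x] * '[q] - '[q, x] * '[p, q]) / D), (('[q, x] * '[p] - '[p, x] * '[p, q]) / D).
rewrite !linearBr !linearDr !linearZr_LR /= [B q p]symformC.
move: D0 e4D hpx hqx; rewrite /D; set qp := '[p]; set qq := '[q]; set b := '[p, q].
move: '[p, x] '[q, x] => X Y D0 e4D hX hY; split; [| |by field|by field].
- have -> : (X * qq - Y * b) / (qp * qq - b ^+ 2) =
      ((2 * X) * (2 * qq) - (2 * Y) * (2 * b)) / (4 * (qp * qq - b ^+ 2)) by field; rewrite D0 n4.
  apply: (vge2_div (k := A + t + 2 * C) _ e4D); last by goal_lia.
  apply: vge2B; first by apply: (vge2M_le hX (vge2_mul2 hq (lexx _))); goal_lia.
  by apply: (vge2M_le hY (veq2W hpq)); goal_lia.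
- have -> : (Y * qp - X * b) / (qp * qq - b ^+ 2) =
      ((2 * Y) * (2 * qp) - (2 * X) * (2 * b)) / (4 * (qp * qq - b ^+ 2)) by field; rewrite D0 n4.
  apply: (vge2_div (k := C + t + 2 * A) _ e4D); last by goal_lia.
  apply: vge2B; first by apply: (vge2M_le hY (vge2_mul2 hp (lexx _))); goal_lia.
  by apply: (vge2M_le hX (veq2W hpq)); goal_lia.
Qed.

Lemma reduced_projection f a i j ps ss t x : reduced f a ((i, j) :: ps) ss ->
  vge2 (2 * '[f i, x]) ((a i)%:Z + t) -> vge2 (2 * '[f j, x]) ((a j)%:Z + t) ->
  exists y, [/\ level f a [:: i; j] t y, '[f i, x - y] = 0 & '[f j, x - y] = 0].
Proof.
move=> h hi hj; have ij : (i, j) \in (i, j) :: ps by rewrite mem_head.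
have [/= iI jI] := pair_support ss ij.
have [c [d [hc hd oi oj]]] := plane_projection (reduced_norm h iI) (reduced_norm h jI)
  (reduced_pair h ij) hi hj.
exists (c *: f i + d *: f j); split=> //.
by apply: lincombD; apply: level1; rewrite ?inE ?eqxx ?orbT.
Qed.

Lemma reduced_split_plane f a i j ps ss : reduced f a ((i, j) :: ps) ss -> exists f',
  [/\ reduced f' a ps ss, gram_congr f f' a (support ps ss),
      {in support ps ss, forall l, level f a [:: i; j] ((a l)%:Z + 1) (f' l - f l)} &
      {in support ps ss, forall l, '[f i, f' l] = 0 /\ '[f j, f' l] = 0}].
Proof.
move=> h; have [_ u out] := support_cons_uniq (reduced_uniq h).
have mem l : l \in [:: i, j & support ps ss] -> l \in support ((i, j) :: ps) ss.
  by rewrite mem_support_cons !inE.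
have subI : {subset support ps ss <= support ((i, j) :: ps) ss}.
  by move=> l lI; apply: mem; rewrite !inE lI !orbT.
have iI : i \in support ((i, j) :: ps) ss by apply: mem; rewrite !inE eqxx.
have jI : j \in support ((i, j) :: ps) ss by apply: mem; rewrite !inE eqxx orbT.
have sub2 : {subset [:: i; j] <= support ((i, j) :: ps) ss}.
  by move=> l; rewrite !inE => /orP[] /eqP->.
have proj l : exists y, l \in support ps ss ->
    [/\ level f a [:: i; j] ((a l)%:Z + 1) y, '[f i, f l - y] = 0 & '[f j, f l - y] = 0].
  have [lI|_] := boolP (l \in support ps ss); last by exists 0.
  have unmatched k : k \in [:: i; j] -> ~~ matched ((i, j) :: ps) k l.
    move=> kij; rewrite matched_sym matched_cons_out ?out // matched_sym.
    apply/negP => /matched_paired/andP[/(paired_support ss)/out /= /andP[ki kj] _].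
    by move: kij; rewrite !inE (negPf ki) (negPf kj).
  have /andP[/= li lj] := out l lI.
  have [||y hy] := @reduced_projection f a i j ps ss ((a l)%:Z + 1) (f l) h; last by exists y.
  - rewrite addrA; apply: (reduced_off h iI (subI _ lI)); first by rewrite eq_sym.
    by apply: unmatched; rewrite inE eqxx.
  - rewrite addrA; apply: (reduced_off h jI (subI _ lI)); first by rewrite eq_sym.
    by apply: unmatched; rewrite !inE eqxx orbT.
have [y hy] := choice proj; exists (fun l => f l - y l).
have diff : {in support ps ss, forall l, level f a [:: i; j] ((a l)%:Z + 1) (f l - y l - f l)}.
  by move=> l /hy[hl _ _]; rewrite addrAC subrr add0r; apply: levelN.
have congr_f : gram_congr f (fun l => f l - y l) a (support ps ss).
  apply: (level_gram_congr (reduced_bounded h)) => l lI; first by apply: level_mem; apply: subI.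
  exact: level_le (diff l lI) sub2 (lexx _).
split=> //; first exact: reduced_congr (reduced_behead h) congr_f.
by move=> l /hy[_ -> ->].
Qed.

(* Orthogonal projection onto the planes, one plane at a time, does not lower the level. *)
Lemma reduced_projection_all f a ps ss t x : reduced f a ps ss ->
  {in paired ps, forall l, vge2 (2 * '[f l, x]) ((a l)%:Z + t)} ->
  exists2 y, level f a (paired ps) t y & {in paired ps, forall l, '[f l, x - y] = 0}.
Proof.
move=> /reduced_paired; elim: ps f x => [|[i j] ps IH] f x h hx.
  by exists 0 => //; apply: lincomb0.
have /= mem l : l \in [:: i, j & paired ps] -> l \in paired ((i, j) :: ps) by [].
have sub2 : {subset [:: i; j] <= paired ((i, j) :: ps)}.
  by move=> l; rewrite !inE => /orP[]->; rewrite ?orbT.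
have subI : {subset paired ps <= paired ((i, j) :: ps)} by move=> l lI; rewrite !inE lI !orbT.
have hb : bounded f a (paired ((i, j) :: ps)) := reduced_bounded h.
have [||y0 [hy0 oi oj]] := @reduced_projection f a i j ps [::] t x h;
  try by apply: hx; rewrite mem ?inE ?eqxx ?orbT.
have [f' [h' _ diff orth]] := reduced_split_plane h.
have f'_plane l z : l \in paired ps -> '[f i, z] = 0 -> '[f j, z] = 0 -> '[f' l - f l, z] = 0.
  by move=> lI zi zj; apply: lincomb_orth (diff l lI) _ => m; rewrite !inE => /orP[] /eqP->.
have [|y1 hy1 o1] := IH f' (x - y0) h'.
  move=> l lI; rewrite -(subrK (f l) (f' l)) linearDl /= f'_plane // add0r linearBr mulrBr /=.
  apply: vge2B; first by apply: hx; apply: subI.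
  exact: level_form hb (level_mem f a (subI _ lI)) (level_le hy0 sub2 (lexx _)).
have y1_plane k : k \in [:: i; j] -> '[f k, y1] = 0.
  rewrite symformC => kij; apply: lincomb_orth hy1 _ => l /orth[zi zj].
  by rewrite symformC; move: kij; rewrite !inE => /orP[] /eqP->.
have oi' : '[f i, x - y0 - y1] = 0 by rewrite linearBr /= oi y1_plane ?subrr ?inE ?eqxx.
have oj' : '[f j, x - y0 - y1] = 0 by rewrite linearBr /= oj y1_plane ?subrr ?inE ?eqxx ?orbT.
exists (y0 + y1).
  apply: lincombD; first exact: level_le hy0 sub2 (lexx _).
  apply: level_trans hy1 => m mI; rewrite -(subrK (f m) (f' m)); apply: lincombD.
    by apply: (level_le (diff m mI) sub2); goal_lia.
  by apply: level_mem; apply: subI.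
move=> l; rewrite opprD addrA !inE => /or3P[/eqP->|/eqP->|lI] //.
by rewrite -(subKr (f' l) (f l)) linearBl /= o1 // f'_plane // subr0.
Qed.

Definition single_reps f a ps ss (r : nat -> V) : Prop :=
  [/\ {in ss, forall i, level f a (support ps ss) (a i)%:Z (r i)},
      {in ss & paired ps, forall i l, '[f l, r i] = 0},
      {in ss &, forall i j, '[f j, r i] = '[r j, r i]},
      {in ss, forall i, veq2 '[r i] (2 * (a i)%:Z)} &
      {in ss &, forall i j, i != j -> vge2 (2 * '[r i, r j]) ((a i)%:Z + (a j)%:Z + 1)}].

Lemma single_reps_exist f a ps ss : reduced f a ps ss -> exists r, single_reps f a ps ss r.
Proof.
move=> h; have u := reduced_uniq h.
have proj i : exists y, i \in ss -> level f a (paired ps) ((a i)%:Z + 1) y /\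
    {in paired ps, forall l, '[f l, f i - y] = 0}.
  have [iss|_] := boolP (i \in ss); last by exists 0.
  have [|y hy oy] := @reduced_projection_all f a ps ss ((a i)%:Z + 1) (f i) h; last by exists y.
  move=> l lI; rewrite addrA.
  apply: (reduced_off h (paired_support ss lI) (single_support ps iss)).
    by apply: contraTneq lI => ->; apply: single_notin_paired iss.
  by have /andP[] := single_unmatched l u iss.
have [y hy] := choice proj; pose r i := f i - y i.
have subP : {subset paired ps <= support ps ss} by move=> l; apply: paired_support.
have r_f i : i \in ss -> level f a (support ps ss) ((a i)%:Z + 1) (r i - f i).
  move=> /hy[hl _]; rewrite /r addrAC subrr add0r.
  by apply: levelN; apply: level_le hl subP (lexx _).
have orth i l : i \in ss -> l \in paired ps -> '[f l, r i] = 0 by move=> /hy[_]; apply.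
have sI := single_support ps; have [dnorm doff] : gram_congr f r a ss.
  by apply: (level_gram_congr (reduced_bounded h)) => i /[dup] iss /sI iI;
    [apply: level_mem | apply: r_f].
have {dnorm doff}hr : reduced r a [::] ss.
  apply: (@reduced_congr f); rewrite ?support0 //; split; rewrite ?support0 //.
  - exact: support_uniq_single u.
  - by move=> i /sI; apply: (reduced_norm h).
  - move=> i j iss jss ij _; apply: (reduced_off h) ij _; rewrite ?sI //.
    by have /andP[] := single_unmatched j u iss.
  - exact: reduced_single h.
  - exact: reduced_parity h.
exists r; split=> //.
- move=> i iss; rewrite -(subrK (f i) (r i)); apply: lincombD; last exact/level_mem/sI.
  by apply: (level_le (r_f i iss)) => //; goal_lia.
- move=> i j iss jss; have [hl _] := hy j jss; rewrite /r [RHS]linearBl /=.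
  have -> : '[y j, f i - y i] = 0 by apply: lincomb_orth hl _ => l lI; apply: orth.
  by rewrite subr0.
- exact: reduced_single hr.
- by move=> i j iss jss ij; apply: (reduced_off hr); rewrite ?support0.
Qed.

End Filtration.

(** * Diagonalizing reduced systems *)

Definition represents (al be ga c : F) : Prop :=
  exists x y, al * x ^+ 2 + 2 * be * x * y + ga * y ^+ 2 = c.

Lemma isnorm_represents al be ga c : al != 0 -> isnorm (be ^+ 2 - al * ga) (c * al) ->
  represents al be ga c.
Proof.
move=> al0 [s [t e]]; exists ((s - be * t) / al), t; apply: (mulIf al0); rewrite e.
by field.
Qed.

Lemma represents_hyperbolic al be ga c : be != 0 -> eqsq (be ^+ 2 - al * ga) 1 ->
  represents al be ga c.
Proof.
move=> b0 [r r0 e]; have [a0|a0] := eqVneq al 0; last first.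
  by apply: isnorm_represents => //; rewrite e mul1r; apply: isnorm_square.
by exists ((c - ga) / (2 * be)), 1; rewrite a0; field; rewrite b0 two_neq0.
Qed.

Section PlaneDiscriminant.

Variables (al be ga : F) (A C : int).
Hypotheses (hal : vge2 al (2 * A)) (hga : vge2 ga (2 * C)) (hbe : veq2 (2 * be) (A + C)).

Definition plane_param : F := al * ga / (2 * be) ^+ 2.

Lemma plane_cross_neq0 : be != 0.
Proof. by apply: contraNneq (veq2_neq0 hbe) => ->; rewrite mulr0. Qed.

Lemma plane_param_int : vge2 plane_param 0.
Proof. by apply: (vge2_div (vge2M hal hga) (veq2X 2 hbe)); goal_lia. Qed.

Lemma plane_disc_eqsq : eqsq (be ^+ 2 - al * ga) (1 - 4 * plane_param).
Proof.
have b0 := plane_cross_neq0; exists be => //.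
by rewrite /plane_param; field; rewrite b0 two_neq0.
Qed.

Lemma plane_disc_unram : unram_disc (be ^+ 2 - al * ga).
Proof. by exists plane_param; [exact: plane_param_int | exact: plane_disc_eqsq]. Qed.

Lemma plane_anisotropic_unit : ~ eqsq (be ^+ 2 - al * ga) 1 -> veq2 al (2 * A) /\ veq2 ga (2 * C).
Proof.
move=> nsq; have param_unit : veq2 plane_param 0.
  apply: vge2_unit plane_param_int _; apply/negP => h; apply: nsq.
  apply: eqsq_trans plane_disc_eqsq _; rewrite -mulrN; apply: artin_schreier_square.
  by exists 0; rewrite ?vge2_0 // expr0n !add0r opprK.
have : veq2 (al * ga) (2 * A + 2 * C).
  apply: (veq2_congr (veq2M param_unit (veq2X 2 hbe))); last by goal_lia.
  by rewrite /plane_param divfK // expf_neq0 // (veq2_neq0 hbe).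
case/veq2P; rewrite mulf_eq0 negb_or => /andP[a0 g0]; rewrite valM // => vag.
by move/vge2P/(_ a0): hal; move/vge2P/(_ g0): hga; split; apply/veq2P; split=> //; lia.
Qed.

End PlaneDiscriminant.

Section CongruentPlanes.

Variables (al be ga al1 be1 ga1 : F) (A C : int).
Hypotheses (hal : vge2 al (2 * A)) (hga : vge2 ga (2 * C)) (hbe : veq2 (2 * be) (A + C)).
Hypotheses (hal1 : vge2 al1 (2 * A)) (hga1 : vge2 ga1 (2 * C)) (hbe1 : veq2 (2 * be1) (A + C)).
Hypotheses (dal : vge2 (al1 - al) (2 * A + 2)) (dga : vge2 (ga1 - ga) (2 * C + 2)).
Hypothesis (dbe : vge2 (2 * be1 - 2 * be) (A + C + 1)).

Lemma plane_param_congr : vge2 (plane_param al1 be1 ga1 - plane_param al be ga) 2.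
Proof.
have [z zE] := veq2_even hbe; rewrite /plane_param.
have : vge2 (2 * be1 - 2 * be) (A + C + 2) by apply: (vge2_parity dbe); move: zE; goal_lia.
move: hbe hbe1; set b := 2 * be; set b1 := 2 * be1 => hb hb1 db.
have b0 := veq2_neq0 hb; have b10 := veq2_neq0 hb1.
have -> : al1 * ga1 / b1 ^+ 2 - al * ga / b ^+ 2 =
    (((al1 - al) * ga1 + al * (ga1 - ga)) * b ^+ 2 -
      al * ga * ((b1 - b) * (b1 + b))) / (b ^+ 2 * b1 ^+ 2) by field; rewrite b0 b10.
apply: (vge2_div (k := 4 * (A + C) + 2) _ (veq2M (veq2X 2 hb) (veq2X 2 hb1))); last by goal_lia.
apply: vge2B.
  apply: (vge2M_le (k := 2 * (A + C) + 2) _ (veq2W (veq2X 2 hb))); last by goal_lia.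
  by apply: vge2D; [apply: (vge2M_le dal hga1); goal_lia | apply: (vge2M_le hal dga); goal_lia].
apply: (vge2M_le (vge2M hal hga) (l := 2 * (A + C) + 2)); last by goal_lia.
apply: (vge2M_le db (l := A + C)); last by goal_lia.
by apply: vge2D; apply: veq2W.
Qed.

Lemma plane_disc_congr : eqsq (be1 ^+ 2 - al1 * ga1) (be ^+ 2 - al * ga).
Proof.
apply: eqsq_trans (plane_disc_eqsq _ _ hbe1) _.
apply: eqsq_trans (eqsq_sym (plane_disc_eqsq _ _ hbe)).
apply: near_unit_eqsq; first exact: unit_1m4 (plane_param_int hal hga hbe).
have -> : 1 - 4 * plane_param al1 be1 ga1 - (1 - 4 * plane_param al be ga) =
    - (4 * (plane_param al1 be1 ga1 - plane_param al be ga)) by ring.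
by rewrite vge2N; apply: vge2_mul4 plane_param_congr _.
Qed.

Lemma congruent_planes_common_value : exists2 c, c != 0 &
  represents al be ga c /\ represents al1 be1 ga1 c.
Proof.
have [sq|nsq] := pselect (eqsq (be ^+ 2 - al * ga) 1).
  exists 1; rewrite ?oner_eq0 //; split; apply: represents_hyperbolic => //.
  - exact: plane_cross_neq0 hbe.
  - exact: plane_cross_neq0 hbe1.
  - exact: eqsq_trans plane_disc_congr sq.
have [xal _] := plane_anisotropic_unit hal hga hbe nsq.
have [|xal1 _] := plane_anisotropic_unit hal1 hga1 hbe1.
  by move=> sq; apply: nsq; apply: eqsq_trans (eqsq_sym plane_disc_congr) sq.
have al0 := veq2_neq0 xal; have al10 := veq2_neq0 xal1; exists al => //; split.
  by exists 1, 0; ring.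
apply: isnorm_represents => //; apply: (isnorm_eqsql (plane_disc_eqsq _ _ hbe1)).
apply: (@isnorm_eqsq _ _ (al / al1)); first by exists al1 => //; field.
apply: isnorm_unram_unit; first exact: plane_param_int hal1 hga1 hbe1.
by apply: (veq2_congr (veq2M xal (veq2V xal1))) => //; goal_lia.
Qed.

End CongruentPlanes.

Section CommonDiagonalization.

Variables (V : lmodType F) (B : {symmetric V}).
Local Notation "''[' x , y ]" := (B x y) : ring_scope.
Local Notation "''[' x ]" := (B x x) : ring_scope.
Implicit Types (f g h : nat -> V) (a : nat -> nat) (ps : seq (nat * nat)) (ss I : seq nat).

Lemma plane_orthogonal_basis (p q : V) c D : c != 0 -> D != 0 ->
  eqsq ('[p, q] ^+ 2 - '[p] * '[q]) D -> represents '[p] '[p, q] '[q] c ->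
  exists x y x' y', let u := x *: p + y *: q in let w := x' *: p + y' *: q in
   [/\ '[u] = c, '[w] = - (c * D) & '[u, w] = 0].
Proof.
move=> c0 D0 [s s0 dE] [x [y cE]].
exists x, y, (- (x * '[p, q] + y * '[q]) / s), ((x * '[p] + y * '[p, q]) / s) => /=.
rewrite !linearDl !linearDr !linearZl_LR !linearZr_LR /= [B q p]symformC.
move: dE cE; move: '[p] '[p, q] '[q] => al be ga dE cE; split.
- by rewrite -cE; ring.
- have -> : D = (be ^+ 2 - al * ga) / s ^+ 2 by rewrite dE mulfK // expf_neq0.
  by rewrite -cE; field.
- by field.
Qed.

Record diagonalized h a ps ss : Prop := {
  diag_orth : {in support ps ss &, forall i j, i != j -> ~~ ((i \in ss) && (j \in ss)) ->
    '[h i, h j] = 0};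
  diag_plane : {in ps, forall p, [/\ '[h p.1] != 0, '[h p.2] != 0 &
    unram_disc (- ('[h p.1] * '[h p.2]))]};
  diag_single : {in ss, forall i, veq2 '[h i] (2 * (a i)%:Z)};
  diag_off : {in ss &, forall i j, i != j ->
    vge2 (2 * '[h i, h j]) ((a i)%:Z + (a j)%:Z + 1)} }.

Lemma diagonalized_singles f a ss : reduced B f a [::] ss -> diagonalized f a [::] ss.
Proof.
move=> hR; have sI i : i \in ss -> i \in support [::] ss by apply: single_support.
split=> //.
- by move=> i j; rewrite !support0 => iss jss _; rewrite iss jss.
- exact: reduced_single hR.
- by move=> i j /sI iI /sI jI ij; apply: (reduced_off hR).
Qed.

Lemma diagonalized_cons h a i j ps ss u w : uniq (support ((i, j) :: ps) ss) ->
  diagonalized h a ps ss -> {in support ps ss, forall l, '[u, h l] = 0 /\ '[w, h l] = 0} ->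
  '[u, w] = 0 -> '[u] != 0 -> '[w] != 0 -> unram_disc (- ('[u] * '[w])) ->
  diagonalized (update2 h i j u w) a ((i, j) :: ps) ss.
Proof.
move=> uI hd orth uw u0 w0 unr; have [/= ij _ out] := support_cons_uniq uI.
have outE l : l \in support ps ss -> update2 h i j u w l = h l.
  by move=> /out; apply: update2_out.
have sI l : l \in ss -> l \in support ps ss by apply: single_support.
have iss : i \notin ss by apply/negP => /sI/out; rewrite eqxx.
have jss : j \notin ss by apply/negP => /sI/out; rewrite eqxx andbF.
have hi : update2 h i j u w i = u by rewrite update2_fst.
have hj : update2 h i j u w j = w by rewrite update2_snd.
split.
- move=> k l; rewrite !mem_support_cons !inE.
  case/or3P=> [/eqP->|/eqP->|kI] /or3P[/eqP->|/eqP->|lI] kl; rewrite ?hi ?hj ?outE //.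
  + by rewrite eqxx in kl.
  + by have [] := orth l lI.
  + by rewrite symformC.
  + by rewrite eqxx in kl.
  + by have [] := orth l lI.
  + by rewrite symformC; have [] := orth k kI.
  + by rewrite symformC; have [] := orth k kI.
  + exact: (diag_orth hd).
- move=> p; rewrite inE => /orP[/eqP->|pI] /=; first by rewrite hi hj.
  by rewrite !outE ?(pair_support ss pI) //; apply: (diag_plane hd).
- by move=> k kss; rewrite outE ?sI //; apply: (diag_single hd).
- by move=> k l kss lss kl; rewrite !outE ?sI //; apply: (diag_off hd).
Qed.

Lemma diagonalization_cons f g h a i j ps ss u w : uniq (support ((i, j) :: ps) ss) ->
  {in support ps ss, forall l, level f a [:: i; j] ((a l)%:Z + 1) (g l - f l)} ->
  {in support ps ss, forall l, '[f i, g l] = 0 /\ '[f j, g l] = 0} ->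
  {in support ps ss, forall l, lspan g (support ps ss) (h l)} -> diagonalized h a ps ss ->
  lspan f [:: i; j] u -> lspan f [:: i; j] w ->
  '[u, w] = 0 -> '[u] != 0 -> '[w] != 0 -> unram_disc (- ('[u] * '[w])) ->
  {in support ((i, j) :: ps) ss, forall l,
    lspan f (support ((i, j) :: ps) ss) (update2 h i j u w l)} /\
  diagonalized (update2 h i j u w) a ((i, j) :: ps) ss.
Proof.
move=> uI g_f fg gh dh fu fw uw u0 w0 unr; have [/= ij _ out] := support_cons_uniq uI.
have sub l : l \in [:: i, j & support ps ss] -> l \in support ((i, j) :: ps) ss.
  by rewrite mem_support_cons !inE.
have sub2 : {subset [:: i; j] <= support ((i, j) :: ps) ss}.
  by move=> l; rewrite !inE => lij; apply: sub; rewrite !inE orbA lij.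
have orth_h l k : l \in support ps ss -> k \in [:: i; j] -> '[f k, h l] = 0.
  move=> lI kij; rewrite symformC; apply: lincomb_orth (gh l lI) _ => m /fg[oi oj].
  by rewrite symformC; move: kij; rewrite !inE => /orP[] /eqP->.
split; last first.
  apply: diagonalized_cons => // l lI.
  by split; [apply: lincomb_orth fu _|apply: lincomb_orth fw _] => k; apply: orth_h.
move=> l; rewrite mem_support_cons !inE => /or3P[/eqP->|/eqP->|lI].
- by rewrite update2_fst //; apply: lincomb_lspan sub2 fu.
- by rewrite update2_snd; apply: lincomb_lspan sub2 fw.
rewrite update2_out ?out //; apply: lspan_trans (gh l lI) => m mI.
rewrite -(subrK (f m) (g m)); apply: lincombD; first exact: lincomb_lspan sub2 (g_f m mI).
by apply: lspan_mem; apply: sub; rewrite !inE mI !orbT.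
Qed.

Lemma congruent_plane_bases f f1 a i j ps ss :
  reduced B f a ((i, j) :: ps) ss -> gram_congr B f f1 a (support ((i, j) :: ps) ss) ->
  exists u w u1 w1, [/\ lspan f [:: i; j] u, lspan f [:: i; j] w,
      lspan f1 [:: i; j] u1 & lspan f1 [:: i; j] w1] /\
    [/\ '[u, w] = 0, '[u1, w1] = 0, '[u1] = '[u] /\ '[w1] = '[w], '[u] != 0 /\ '[w] != 0 &
        unram_disc (- ('[u] * '[w]))].
Proof.
move=> hR hc; have hR1 := reduced_congr hR hc.
have pI : (i, j) \in (i, j) :: ps by rewrite mem_head.
have [/= iI jI] := pair_support ss pI.
have [/= ij _ _] := support_cons_uniq (reduced_uniq hR).
have [hc1 hc2] := hc; have bR := reduced_norm hR; have bR1 := reduced_norm hR1.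
have pR := reduced_pair hR pI; have pR1 := reduced_pair hR1 pI.
have [c c0 [rep rep1]] := congruent_planes_common_value (bR i iI) (bR j jI) pR
  (bR1 i iI) (bR1 j jI) pR1 (hc1 i iI) (hc1 j jI) (hc2 i j iI jI ij).
have := plane_disc_congr (bR i iI) (bR j jI) pR (bR1 j jI) pR1
  (hc1 i iI) (hc1 j jI) (hc2 i j iI jI ij).
have := plane_disc_unram (bR i iI) (bR j jI) pR.
rewrite /=; set D := '[f i, f j] ^+ 2 - _ => unr dd1; have D0 := unram_disc_neq0 unr.
have [x [y [x' [y' /= [nu nw ouw]]]]] := plane_orthogonal_basis c0 D0 (eqsq_refl D) rep.
have [x1 [y1 [x1' [y1' /= [nu1 nw1 ouw1]]]]] := plane_orthogonal_basis c0 D0 dd1 rep1.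
have lspan2 (k : nat -> V) p q : lspan k [:: i; j] (p *: k i + q *: k j).
  by apply: lincombD; apply: lincomb1; rewrite ?inE ?eqxx ?orbT.
exists (x *: f i + y *: f j), (x' *: f i + y' *: f j).
exists (x1 *: f1 i + y1 *: f1 j), (x1' *: f1 i + y1' *: f1 j).
split; split=> //; rewrite ?nu ?nw ?nu1 ?nw1 // ?oppr_eq0 ?mulf_neq0 //.
by apply: eqsq_unram_disc unr; exists c => //; ring.
Qed.

(* Congruent systems can be diagonalized with the same norms on every plane: split off one plane at
   a time, choosing for both systems plane vectors of the same norms. *)
Lemma common_diagonalization f f1 a ps ss :
  reduced B f a ps ss -> gram_congr B f f1 a (support ps ss) -> exists h h1,
   [/\ {in support ps ss, forall i, lspan f (support ps ss) (h i)},
       {in support ps ss, forall i, lspan f1 (support ps ss) (h1 i)},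
       diagonalized h a ps ss, diagonalized h1 a ps ss &
       {in paired ps, forall i, '[h1 i] = '[h i]}].
Proof.
elim: ps f f1 => [|[i j] ps IH] f f1 hR hc; have hR1 := reduced_congr hR hc.
  by exists f, f1; split; try apply: diagonalized_singles; rewrite // => l; apply: lspan_mem.
have uI := reduced_uniq hR; have [/= ij _ out] := support_cons_uniq uI.
have subI : {subset support ps ss <= support ((i, j) :: ps) ss}.
  by move=> l lI; rewrite mem_support_cons !inE lI !orbT.
have [g [hg fg g_f og]] := reduced_split_plane hR.
have [g1 [hg1 fg1 g1_f og1]] := reduced_split_plane hR1.
have gg1 : gram_congr B g g1 a (support ps ss).
  apply: gram_congr_trans (gram_congr_sym fg) _.
  exact: gram_congr_trans (gram_congr_sub subI hc) fg1.
have [h [h1 [gh gh1 dh dh1 hh1]]] := IH g g1 hg gg1.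
have [u [w [u1 [w1 [[fu fw fu1 fw1] [uw uw1 [uu1 ww1] [u0 w0] unr]]]]]] :=
  congruent_plane_bases hR hc.
have [s d] := diagonalization_cons uI g_f og gh dh fu fw uw u0 w0 unr.
rewrite -uu1 -ww1 in u0 w0 unr.
have [s1 d1] := diagonalization_cons uI g1_f og1 gh1 dh1 fu1 fw1 uw1 u0 w0 unr.
exists (update2 h i j u w), (update2 h1 i j u1 w1); split=> //.
move=> l; rewrite /= !inE => /or3P[/eqP->|/eqP->|lI].
- by rewrite !update2_fst.
- by rewrite !update2_snd.
- by rewrite !update2_out ?out ?paired_support // hh1.
Qed.

End CommonDiagonalization.

(** * Invariants of reduced systems *)

Definition mxcongr k (M N : 'M[F]_k) : Prop := exists Y : 'M[F]_k, Y^T *m M *m Y = N.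

Lemma mxcongr_trans k (M N P : 'M[F]_k) : mxcongr M N -> mxcongr N P -> mxcongr M P.
Proof. by move=> [X <-] [Y <-]; exists (X *m Y); rewrite trmx_mul !mulmxA. Qed.

Lemma mxcongr_det k (M N : 'M[F]_k) : mxcongr M N -> \det N != 0 -> eqsq (\det N) (\det M).
Proof.
move=> [Y <-]; rewrite !det_mulmx det_tr => h; exists (\det Y); last by ring.
by apply: contraNneq h => ->; rewrite mulr0.
Qed.

Lemma xi_mxcongr k s (M N : 'M[F]_k) : mxcongr M N -> \det N != 0 -> k = s.*2 ->
  xi v M = disc_xi v ((-1) ^+ s * \det N).
Proof.
move=> MN N0 kE; rewrite /xi (_ : k./2 = s); last by rewrite kE doubleK.
apply: disc_xi_eqsq.
apply: eqsqM; last exact: eqsq_sym (mxcongr_det MN N0).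
exists (2 ^+ s); first by rewrite expf_neq0 ?two_neq0.
by rewrite -exprM mulnC exprM -exprMn; congr (_ ^+ _); ring.
Qed.

Lemma odd_val_det_mxcongr k (M N : 'M[F]_k) : mxcongr M N -> \det N != 0 ->
  odd `|v (\det M)| = odd `|v (\det N)|.
Proof. by move=> MN N0; rewrite (eqsq_val_odd N0 (mxcongr_det MN N0)). Qed.

Lemma prod_paired (n : nat -> F) ps :
  \prod_(l <- paired ps) n l = \prod_(p <- ps) (n p.1 * n p.2).
Proof. by elim: ps => [|p ps IH]; rewrite ?big_nil //= !big_cons IH mulrA. Qed.

Lemma planes_disc_unram (n : nat -> F) ps : {in ps, forall p, unram_disc (- (n p.1 * n p.2))} ->
  unram_disc ((-1) ^+ size ps * \prod_(l <- paired ps) n l).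
Proof.
rewrite prod_paired; elim: ps => [|p ps IH] h; first by rewrite big_nil mulr1; apply: unram_disc1.
rewrite /= big_cons exprS mulrACA mulN1r; apply: unram_discM; first by apply: h; rewrite mem_head.
by apply: IH => q qI; apply: h; rewrite inE qI orbT.
Qed.

Lemma ram_disc_pair (x y z : F) (A C : int) : veq2 x (2 * A) -> veq2 y (2 * C) -> odd `|A + C| ->
  vge2 (2 * z) (A + C + 1) -> ram_disc (z ^+ 2 - x * y).
Proof.
move=> hx hy oAC hz; have hxy := veq2M hx hy.
have [hz3|hz3] := boolP (vge2 (2 * z) (A + C + 3)).
  left; have : veq2 (4 * (z ^+ 2 - x * y)) (2 * (A + C + 2)).
    have -> : 4 * (z ^+ 2 - x * y) = - (4 * (x * y)) + (2 * z) * (2 * z) by ring.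
    apply: veq2D; last by apply: (vge2M_le hz3 hz3); goal_lia.
    by rewrite veq2N; apply: (veq2_congr (veq2M veq2_4 hxy)) => //; goal_lia.
  case/veq2P; rewrite mulf_eq0 negb_or => /andP[_ n0]; have /veq2P[_ v4] := veq2_4.
  rewrite valM ?four_neq0 // => vz; apply: eqsq_2unit => //.
  by move: v4 vz oAC; move: (v 4) (v _) => p q; goal_lia.
have [m mE] : exists m : int, A + C + 1 = 2 * m.
  by exists ((A + C + 1) %/ 2)%Z; move: oAC; goal_lia.
right; have hz1 : veq2 (2 * z) (A + C + 1).
  rewrite mE; apply: vge2_eq; first by rewrite -mE.
  by apply: contra hz3 => h; apply: vge2_le h _; move: mE; goal_lia.
have z0 : z != 0 by apply: contraNneq (veq2_neq0 hz1) => ->; rewrite mulr0.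
exists (- (2 * (x * y) / (2 * z) ^+ 2)); last by exists z => //; field; rewrite z0 two_neq0.
rewrite veq2N; apply: (veq2_congr (veq2M (veq2M veq2_2 hxy) (veq2V (veq2X 2 hz1)))) => //.
by goal_lia.
Qed.

Lemma hilb_planes_prod (n : nat -> F) ps x : x != 0 -> {in paired ps, forall l, n l != 0} ->
  hilb (-1) x ^+ size ps * \prod_(l <- paired ps) hilb x (n l) =
  \prod_(p <- ps) hilb x (- (n p.1 * n p.2)).
Proof.
move=> x0; elim: ps => [|p ps IH] hn; first by rewrite !big_nil expr0 mulr1.
rewrite /= !big_cons -IH; last by move=> l lf; apply: hn; rewrite !inE lf !orbT.
have n1 : n p.1 != 0 by apply: hn; rewrite inE eqxx.
have n2 : n p.2 != 0 by apply: hn; rewrite !inE eqxx orbT.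
have m1 : (-1 : F) != 0 by rewrite oppr_eq0 oner_eq0.
have -> : - (n p.1 * n p.2) = -1 * (n p.1 * n p.2) by rewrite mulN1r.
rewrite hilbMr ?mulf_neq0 // hilbMr // [hilb x (-1)]hilbC exprS; ring.
Qed.

Lemma hilb_unram_val x y D : x != 0 -> y != 0 -> v x = v y -> unram_disc D ->
  hilb x D = hilb y D.
Proof.
move=> x0 y0 vxy uD; have D0 := unram_disc_neq0 uD.
have yx : veq2 (y / x) 0.
  by apply/veq2P; rewrite mulf_neq0 ?invr_eq0 // valM ?invr_eq0 // valV // vxy subrr mulr0.
have yE : y = x * (y / x) by rewrite mulrC divfK.
by rewrite [in RHS]yE hilbMl ?(veq2_neq0 yx) // [hilb (y / x) D]hilbC (hilb_unram_unit uD yx) mulr1.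
Qed.

Section Gram.

Variables (V : lmodType F) (B : {symmetric V}).
Local Notation "''[' x , y ]" := (B x y) : ring_scope.
Local Notation "''[' x ]" := (B x x) : ring_scope.
Implicit Types (f g h : nat -> V) (a : nat -> nat) (ps : seq (nat * nat)) (ss I : seq nat).

Definition gram f k : 'M[F]_k := \matrix_(i, j) '[f i, f j].

Lemma gram_lspan f h k : (forall l, (l < k)%N -> lspan f (iota 0 k) (h l)) ->
  mxcongr (gram f k) (gram h k).
Proof.
move=> span_h.
have /(fin_all_exists (P := fun (l : 'I_k) c => h l = \sum_(m <- iota 0 k) c m *: f m))[c cE] :
    forall l : 'I_k, exists c : nat -> F, h l = \sum_(m <- iota 0 k) c m *: f m.
  by move=> l; apply: lincomb_coef (iota_uniq _ _) (span_h l (ltn_ord l)).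
have {}cE (l : 'I_k) : h l = \sum_(m < k) c l m *: f m.
  by rewrite cE -(big_mkord xpredT (fun m => c l m *: f m)) /index_iota subn0.
exists (\matrix_(m, l) c l m); apply/matrixP => i j.
rewrite [RHS]mxE !cE symform_sumr mxE; apply: eq_bigr => n _.
rewrite [X in _ * X]mxE linearZr_LR /= mulrC; congr (_ * _).
by rewrite symform_suml mxE; apply: eq_bigr => m _; rewrite linearZl_LR /= !mxE.
Qed.

Lemma gram_orth h k : (forall i j, (i < k)%N -> (j < k)%N -> i != j -> '[h i, h j] = 0) ->
  gram h k = diag_mx (\row_l '[h l]).
Proof.
move=> o; apply/matrixP => i j; rewrite !mxE.
have [->|ij] := eqVneq i j; first by rewrite mulr1n.
by rewrite mulr0n o.
Qed.

Lemma det_gram_orth h k : (forall i j, (i < k)%N -> (j < k)%N -> i != j -> '[h i, h j] = 0) ->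
  \det (gram h k) = \prod_(l <- iota 0 k) '[h l].
Proof.
move=> /gram_orth->; rewrite det_diag -[in RHS](subn0 k) -/(index_iota 0 k) big_mkord.
by apply: eq_bigr => i _; rewrite mxE.
Qed.

Lemma det_gram_last f k : (forall l, (l < k)%N -> '[f l, f k] = 0) ->
  \det (gram f k.+1) = '[f k] * \det (gram f k).
Proof.
move=> h; rewrite (expand_det_row _ ord_max) (bigD1 ord_max) //= big1 ?addr0 => [|j jm].
  rewrite mxE /cofactor /= addnn -signr_odd odd_double expr0 mul1r; congr (_ * \det _).
  by apply/matrixP => i j; rewrite !mxE !lift_max.
rewrite mxE symformC h ?mul0r //; have := ltn_ord j; rewrite ltnS leq_eqVlt => /orP[/eqP jk|//].
by move/eqP: jm; case; apply: val_inj.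
Qed.

Lemma mxcongr_gram_lspan k (M : 'M[F]_k) f h ps ss : perm_eq (support ps ss) (iota 0 k) ->
  mxcongr M (gram f k) -> {in support ps ss, forall l, lspan f (support ps ss) (h l)} ->
  mxcongr M (gram h k).
Proof.
move=> pk Mf fh; apply: mxcongr_trans Mf (gram_lspan _) => l.
by rewrite -(mem_support_iota _ pk) => /fh; apply: lincomb_lspan => m; rewrite (perm_mem pk).
Qed.

Definition single_invariants k (M : 'M[F]_k) a ss : Prop :=
  match ss with
  | [::] => [/\ ~~ odd k, xi v M != 0 & ~~ odd `|v (\det M)|]
  | [:: s] => [/\ odd k, \det M != 0 & odd `|v (\det M)| = odd (a s)]
  | [:: _; _] => ~~ odd k /\ xi v M = 0
  | _ => False
  end.

Section Diagonal.

Variables (k : nat) (h : nat -> V) (a : nat -> nat) (ps : seq (nat * nat)).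

Lemma diagonalized_norm_neq0 ss : diagonalized B h a ps ss ->
  {in support ps ss, forall l, '[h l] != 0}.
Proof.
move=> hd l; rewrite mem_cat => /orP[/(diag_single hd)/veq2_neq0 //|/pairedP[p pI]].
by have [n1 n2 _] := diag_plane hd pI; rewrite !inE => /orP[] /eqP->.
Qed.

Lemma diagonalized_prod_neq0 ss : diagonalized B h a ps ss ->
  \prod_(l <- paired ps) '[h l] != 0.
Proof.
move=> hd; rewrite prodf_seq_neq0; apply/allP => l lI.
by apply: (diagonalized_norm_neq0 hd); apply: paired_support.
Qed.

Lemma diagonalized_planes_unram ss : diagonalized B h a ps ss ->
  unram_disc ((-1) ^+ size ps * \prod_(l <- paired ps) '[h l]).
Proof. by move=> hd; apply: planes_disc_unram => p /(diag_plane hd)[]. Qed.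

Lemma diagonalized_planes_val_even ss : diagonalized B h a ps ss ->
  ~~ odd `|v (\prod_(l <- paired ps) '[h l])|.
Proof.
move=> hd; have := unram_disc_val_even (diagonalized_planes_unram hd).
rewrite valM ?(diagonalized_prod_neq0 hd) ?expf_neq0 ?oppr_eq0 ?oner_eq0 //.
by rewrite valX ?oppr_eq0 ?oner_eq0 // valN val1 mulr0 add0r.
Qed.

Lemma diagonalized_orth ss : perm_eq (support ps ss) (iota 0 k) -> diagonalized B h a ps ss ->
  (size ss <= 1)%N -> forall i j, (i < k)%N -> (j < k)%N -> i != j -> '[h i, h j] = 0.
Proof.
move=> pk hd s1 i j; rewrite -!(mem_support_iota _ pk) => iI jI ij.
apply: (diag_orth hd) => //; case: ss s1 {pk hd iI jI} => [|s []] // _.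
by rewrite !inE; apply: contraNN ij => /andP[/eqP-> /eqP->].
Qed.

Lemma diagonalized_det ss : perm_eq (support ps ss) (iota 0 k) -> diagonalized B h a ps ss ->
  (size ss <= 1)%N -> \det (gram h k) = \prod_(l <- ss) '[h l] * \prod_(l <- paired ps) '[h l].
Proof.
move=> pk hd s1; rewrite (det_gram_orth (diagonalized_orth pk hd s1)).
by rewrite -(perm_big _ pk) big_cat.
Qed.

Lemma diagonalized_det_neq0 ss : perm_eq (support ps ss) (iota 0 k) -> diagonalized B h a ps ss ->
  (size ss <= 1)%N -> \det (gram h k) != 0.
Proof.
move=> pk hd s1; rewrite (diagonalized_det pk hd s1) mulf_neq0 ?(diagonalized_prod_neq0 hd) //.
rewrite prodf_seq_neq0; apply/allP => l lss.
by apply: (diagonalized_norm_neq0 hd); apply: single_support.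
Qed.

Lemma no_single_invariants (M : 'M[F]_k) : perm_eq (support ps [::]) (iota 0 k) ->
  diagonalized B h a ps [::] -> mxcongr M (gram h k) -> single_invariants M a [::].
Proof.
move=> pk hd Mh; have kE := support_size pk; have d0 := diagonalized_det_neq0 pk hd isT.
have dE := diagonalized_det pk hd isT; rewrite big_nil mul1r in dE; split.
- by rewrite kE odd_double.
- rewrite (xi_mxcongr Mh d0 kE) dE; apply: disc_xi_unram; exact: diagonalized_planes_unram hd.
by rewrite (odd_val_det_mxcongr Mh d0) dE (diagonalized_planes_val_even hd).
Qed.

Lemma one_single_invariants (M : 'M[F]_k) s : perm_eq (support ps [:: s]) (iota 0 k) ->
  diagonalized B h a ps [:: s] -> mxcongr M (gram h k) -> single_invariants M a [:: s].
Proof.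
move=> pk hd Mh; have kE := support_size pk; have d0 := diagonalized_det_neq0 pk hd isT.
have dE := diagonalized_det pk hd isT; rewrite big_seq1 in dE; split.
- by rewrite kE /= odd_double.
- exact: eqsq_neq0 (eqsq_sym (mxcongr_det Mh d0)) d0.
rewrite (odd_val_det_mxcongr Mh d0) dE; have := diagonalized_planes_val_even hd.
have /veq2P[n0 vs] := diag_single hd (mem_head s [::]).
rewrite valM ?(diagonalized_prod_neq0 hd) //.
by move: vs; move: (v _) (v _) (a s) => x y z; goal_lia.
Qed.

Lemma two_singles_orthogonalize s t : uniq (support ps [:: s; t]) ->
  diagonalized B h a ps [:: s; t] -> exists h',
  [/\ {in support ps [:: s; t] &, forall i j, i != j -> '[h' i, h' j] = 0},
      {in support ps [:: s; t], forall l, lspan h (support ps [:: s; t]) (h' l)},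
      forall l, l != t -> h' l = h l &
      '[h s] * '[h' t] = '[h s] * '[h t] - '[h s, h t] ^+ 2].
Proof.
move=> u hd; have sI : s \in support ps [:: s; t] by rewrite mem_head.
have tI : t \in support ps [:: s; t] by rewrite mem_cat !inE eqxx orbT.
have st := two_singles_neq u.
have s0 := diagonalized_norm_neq0 hd sI; pose c := - ('[h s, h t] / '[h s]).
have orth i j : i \in support ps [:: s; t] -> j \in support ps [:: s; t] -> i != j ->
    i \notin [:: s; t] -> '[h i, h j] = 0.
  by move=> iI jI ij /negPf iN; apply: (diag_orth hd); rewrite // iN.
have orth_st i : i \in support ps [:: s; t] -> i != t -> '[h i, h t + c *: h s] = 0.
  move=> iI it; rewrite linearDr linearZr_LR /=; have [->|is_] := eqVneq i s.
    by rewrite /c mulNr divfK // subrr.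
  by rewrite !orth ?inE ?negb_or ?is_ //; ring.
exists (update h t (h t + c *: h s)); split.
- move=> i j iI jI ij; have [it|it] := eqVneq i t.
    have jt : j != t by rewrite -it eq_sym.
    by rewrite it update_eq update_neq // symformC orth_st.
  have [->|jt] := eqVneq j t; first by rewrite update_eq update_neq // orth_st.
  rewrite !update_neq //; have [is_|is_] := eqVneq i s; last first.
    by apply: orth; rewrite // !inE negb_or is_.
  by rewrite symformC; apply: orth; rewrite 1?eq_sym // !inE negb_or jt andbT -is_ eq_sym.
- move=> l lI; rewrite /update; case: eqP => _; last exact: lspan_mem.
  by apply: lincombD; [apply: lspan_mem | apply: lincomb1].
- by move=> l lt; rewrite update_neq.
by rewrite update_eq symnormDZ [B (h t) (h s)]symformC /c; field.
Qed.

Lemma two_singles_invariants (M : 'M[F]_k) s t : perm_eq (support ps [:: s; t]) (iota 0 k) ->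
  odd (a s + a t) -> diagonalized B h a ps [:: s; t] -> mxcongr M (gram h k) ->
  single_invariants M a [:: s; t].
Proof.
move=> pk par hd Mh; have kE := support_size pk.
have u : uniq (support ps [:: s; t]) by rewrite (perm_uniq pk) iota_uniq.
have st := two_singles_neq u.
have [h' [orth' span' out' det_st]] := two_singles_orthogonalize u hd.
have sI : s \in [:: s; t] by rewrite mem_head.
have tI : t \in [:: s; t] by rewrite !inE eqxx orbT.
have ram : ram_disc (- ('[h s] * '[h' t])).
  rewrite det_st opprB; apply: (ram_disc_pair (diag_single hd sI) (diag_single hd tI)).
    by move: par; move: (a s) (a t) => p q; goal_lia.
  by apply: (diag_off hd).
have Mh' := mxcongr_gram_lspan pk Mh span'.
have dE : (-1) ^+ (size ps).+1 * \det (gram h' k) =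
    (-1) ^+ size ps * \prod_(l <- paired ps) '[h l] * - ('[h s] * '[h' t]).
  rewrite det_gram_orth => [|i j]; last by rewrite -!(mem_support_iota _ pk); apply: orth'.
  rewrite -(perm_big _ pk) !big_cons out' // exprS.
  have -> : \prod_(l <- paired ps) '[h' l] = \prod_(l <- paired ps) '[h l].
    rewrite big_seq [RHS]big_seq; apply: eq_bigr => l lI; rewrite out' //.
    by have := paired_notin_single u lI; rewrite !inE negb_or => /andP[].
  by rewrite /=; ring.
have ramd := unram_discM_ram (diagonalized_planes_unram hd) ram; rewrite -dE in ramd.
have d0 : \det (gram h' k) != 0.
  by have := ram_disc_neq0 ramd; rewrite mulf_eq0 negb_or => /andP[].
split; first by rewrite kE /= odd_double.
by rewrite (xi_mxcongr (s := (size ps).+1) Mh' d0) ?(disc_xi_ram ramd).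
Qed.

Lemma eta_one_single (M : 'M[F]_k) s : perm_eq (support ps [:: s]) (iota 0 k) ->
  diagonalized B h a ps [:: s] -> mxcongr M (gram h k) ->
  Defs.eta M = hilb (-1 : F) (-1) ^+ (k.+1 %/ 4) *
    hilb (-1) (\prod_(l <- paired ps) '[h l]) ^+ size ps *
    (\prod_(p <- ps) hilb '[h s] (- ('[h p.1] * '[h p.2]))) *
    hasse [seq '[h l] | l <- paired ps].
Proof.
move=> pk hd Mh; have kE := support_size pk; have orth := diagonalized_orth pk hd isT.
have d0 := diagonalized_det_neq0 pk hd isT; have dE := diagonalized_det pk hd isT.
have n0 := diagonalized_norm_neq0 hd; have ns := n0 s (mem_head s _).
have m1 : (-1 : F) != 0 by rewrite oppr_eq0 oner_eq0.
have dMh := mxcongr_det Mh d0; have dM := eqsq_neq0 (eqsq_sym dMh) d0.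
case: Mh => Y; rewrite (gram_orth orth) => YE.
rewrite (eta_congr_diag _ YE) /eta_diag; last 2 first.
- rewrite unitmxE unitfE; apply: contraNneq d0 => Y0.
  by rewrite (gram_orth orth) -YE !det_mulmx Y0 mulr0.
- by move=> i; rewrite mxE; apply: n0; rewrite (mem_support_iota _ pk).
rewrite -hasse_row.
have -> : [seq (\row_l '[h l]) 0 i | i <- enum 'I_k] = [seq '[h l] | l <- iota 0 k].
  by rewrite -val_enum_ord -map_comp; apply: eq_map => i; rewrite /= mxE.
rewrite -(hasse_perm (perm_map (fun l => '[h l]) pk)).
have -> : (k.-1 %/ 2)%N = size ps by rewrite kE add1n /= divn2 doubleK.
have -> : hilb (-1) (\det M) = hilb (-1) '[h s] * hilb (-1) (\prod_(l <- paired ps) '[h l]).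
  rewrite (hilb_eqsqr m1 dM (eqsq_sym dMh)) dE big_seq1.
  by rewrite hilbMr // (diagonalized_prod_neq0 hd).
rewrite -(hilb_planes_prod (n := fun l => '[h l]) ns) => [|l lI]; last exact/n0/paired_support.
by rewrite /= big_map exprMn; ring.
Qed.

End Diagonal.

Lemma reduced_single_invariants k (M : 'M[F]_k) f a ps ss : perm_eq (support ps ss) (iota 0 k) ->
  reduced B f a ps ss -> mxcongr M (gram f k) -> single_invariants M a ss.
Proof.
move=> pk hR Mf; have [h [_ [hs _ hd _ _]]] := common_diagonalization hR (gram_congr_refl B f a _).
have Mh := mxcongr_gram_lspan pk Mf hs.
have par := reduced_parity hR; have := support_uniq_single (reduced_uniq hR).
case: ss pk hR {hs} hd par => [|s [|t [|z ss]]] pk hR hd par us.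
- exact: no_single_invariants pk hd Mh.
- exact: one_single_invariants pk hd Mh.
- apply: (two_singles_invariants pk _ hd Mh); move: us; rewrite /= inE andbT => st.
  by apply: par; rewrite // !inE eqxx ?orbT.
move: us; rewrite /= !inE !negb_or -!andbA => /and5P[st sz _ tz _].
have p1 : odd (a s + a t) by apply: par; rewrite // !inE eqxx ?orbT.
have p2 : odd (a s + a z) by apply: par; rewrite // !inE eqxx ?orbT.
have : odd (a t + a z) by apply: par; rewrite // !inE eqxx ?orbT.
by move: p1 p2; move: (a s) (a t) (a z) => x y w; goal_lia.
Qed.

Lemma zeta_gram_congr k (M M1 : 'M[F]_k) f f1 a ps ss : perm_eq (support ps ss) (iota 0 k) ->
  reduced B f a ps ss -> gram_congr B f f1 a (support ps ss) ->
  mxcongr M (gram f k) -> mxcongr M1 (gram f1 k) -> zeta v M = zeta v M1.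
Proof.
move=> pk hR hc Mf Mf1; have hR1 := reduced_congr hR hc.
have := reduced_single_invariants pk hR1 Mf1; have := reduced_single_invariants pk hR Mf.
have [h [h1 [hs hs1 hd hd1 eq_h]]] := common_diagonalization hR hc.
have {hs}Mh := mxcongr_gram_lspan pk Mf hs; have {hs1}Mh1 := mxcongr_gram_lspan pk Mf1 hs1.
have nE : [seq '[h1 l] | l <- paired ps] = [seq '[h l] | l <- paired ps].
  by apply/eq_in_map => l; apply: eq_h.
have pE : \prod_(l <- paired ps) '[h1 l] = \prod_(l <- paired ps) '[h l].
  by rewrite big_seq [RHS]big_seq; apply: eq_bigr => l; apply: eq_h.
rewrite /zeta; case: ss pk {hR hR1 hc} hd hd1 => [|s [|t [|//]]] pk hd hd1 /=.
- case=> /negPf-> _ _ _; have kE := support_size pk.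
  rewrite (xi_mxcongr Mh _ kE) ?(diagonalized_det_neq0 pk hd) //.
  rewrite (xi_mxcongr Mh1 _ kE) ?(diagonalized_det_neq0 pk hd1) //.
  by rewrite (diagonalized_det pk hd isT) (diagonalized_det pk hd1 isT) !big_nil pE.
- case=> -> _ _ _; rewrite (eta_one_single pk hd Mh) (eta_one_single pk hd1 Mh1) nE pE.
  congr (_ * _ * _); rewrite big_seq [RHS]big_seq; apply: eq_bigr => p pI.
  have /andP[p1 p2] := mem_paired pI; rewrite (eq_h _ p1) (eq_h _ p2).
  have /veq2P[n0 v0] := diag_single hd (mem_head s _).
  have /veq2P[n1 v1] := diag_single hd1 (mem_head s _).
  apply: hilb_unram_val => //; last by case: (diag_plane hd pI).
  by move: v0 v1; move: (v _) (v _) (a s) => x y z; goal_lia.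
by case=> /negPf-> -> [_ ->].
Qed.

End Gram.

(** * Uniqueness of the Gross-Keating invariant *)

Lemma vge2_sign k x m : vge2 x m -> vge2 ((-1) ^+ k * x) m.
Proof. by rewrite -signr_odd; case: (odd k); rewrite ?expr1 ?expr0 ?mulN1r ?mul1r ?vge2N. Qed.

Lemma vge2_det n (U : 'M[F]_n) (f g : 'I_n -> int) :
  (forall i j, vge2 (U i j) (f i + g j)) -> vge2 (\det U) (\sum_i f i + \sum_j g j).
Proof.
move=> h; apply: vge2_sum => s _; apply: vge2_sign.
rewrite [X in _ + X](reindex_inj (@perm.perm_inj _ s)) /= -big_split /=.
exact: vge2_prod.
Qed.

Lemma vge2_det_block n (U : 'M[F]_n) p q : (p < q <= n)%N -> (forall i j, vge2 (U i j) 0) ->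
  (forall i j : 'I_n, (i < q)%N -> (p <= j)%N -> vge2 (U i j) 2) -> vge2 (\det U) 2.
Proof.
move=> /andP[pq qn] iU zU.
have sum_const (c : int) m : (m <= n)%N -> \sum_(i < n) (if (i < m)%N then c else 0) = c * m%:Z.
  move=> mn; rewrite -big_mkcond -(big_ord_widen n (fun=> c)) // sumr_const card_ord.
  by rewrite -mulr_natr natz.
have : vge2 (\det U) (\sum_(i < n) (if (i < q)%N then 2 else 0) +
                      \sum_(j < n) (if (j < p)%N then -2 else 0)).
  apply: vge2_det => i j; have := iU i j.
  case: ltnP => iq; case: ltnP => jp; rewrite ?addr0 ?subrr ?add0r // => hij; first exact: zU.
  by apply: vge2_le hij _.
by move/vge2_le; apply; rewrite !sum_const //; lia.
Qed.

Lemma vge2_invmx n (U : 'M[F]_n) (c : 'I_n -> int) : U \in unitmx -> veq2 (\det U) 0 ->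
  (forall i j, vge2 (U i j) (c j - c i)) -> forall i j, vge2 (invmx U i j) (c j - c i).
Proof.
move=> uU dU h i j; rewrite /invmx uU mxE [\adj U i j]mxE /cofactor.
apply: vge2_intM; first by have := veq2W (veq2V dU); rewrite oppr0.
apply: vge2_sign.
have /(_ _)/vge2_le := @vge2_det _ (row' j (col' i U)) (fun k => - c (lift j k))
  (fun k => c (lift i k)).
apply; first by move=> k l; rewrite !mxE addrC; apply: h.
have split_sum l : \sum_k c k = c l + \sum_k c (lift l k) by rewrite (bigD1_ord l).
have := split_sum i; rewrite (split_sum j) sumrN.
by move: (\sum_k c _) (\sum_k c _) => S T; lia.
Qed.

Section Lattice.

Variable n : nat.
Implicit Types (A M U W : 'M[F]_n) (a : seq nat) (x y : 'cV[F]_n) (m : nat).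

Lemma congr_sym A U : A^T = A -> (U^T *m A *m U)^T = U^T *m A *m U.
Proof. by move=> sA; rewrite !trmx_mul trmxK sA mulmxA. Qed.

Lemma congr_mul_invmx A U W : U \in unitmx ->
  (invmx U *m W)^T *m (U^T *m A *m U) *m (invmx U *m W) = W^T *m A *m W.
Proof.
move=> uU; rewrite trmx_mul trmx_inv !mulmxA -[_ *m U *m invmx U]mulmxA mulmxV // mulmx1.
by rewrite -[W^T *m invmx _ *m _]mulmxA mulVmx ?unitmx_tr // mulmx1.
Qed.

Lemma GLoP U : (forall i j, vge2 (U i j) 0) -> veq2 (\det U) 0 -> GLo v U.
Proof.
move=> iU dU; apply/andP; split; last by rewrite unit_veq2.
by apply/forallP => i; apply/forallP => j; rewrite integral_vge2.
Qed.

Lemma GLo_unit U : GLo v U -> [/\ U \in unitmx, veq2 (\det U) 0 & forall i j, vge2 (U i j) 0].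
Proof.
move=> /andP[/forallP iU dU]; rewrite unit_veq2 in dU; split=> //.
  by rewrite unitmxE unitfE (veq2_neq0 dU).
by move=> i j; have /forallP/(_ j) := iU i; rewrite integral_vge2.
Qed.

Lemma GLo1 : GLo v (1%:M : 'M[F]_n).
Proof.
apply: GLoP => [i j|]; last by rewrite det1 veq2_1.
by rewrite mxE; case: (i == j); rewrite ?vge2_0 ?vge2_1.
Qed.

Lemma GLo_mul U W : GLo v U -> GLo v W -> GLo v (U *m W).
Proof.
move=> /GLo_unit[_ dU iU] /GLo_unit[_ dW iW].
apply: GLoP => [i j|]; last by rewrite det_mulmx; apply: veq2M dU dW.
by rewrite mxE; apply: vge2_sum => k _; apply: vge2_intM.
Qed.

Lemma GLo_inv U : GLo v U -> GLo v (invmx U).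
Proof.
move=> /GLo_unit[uU dU iU]; apply: GLoP; last by rewrite det_inv; apply: veq2V dU.
exact: (vge2_invmx (c := fun=> 0) uU dU).
Qed.

Lemma inSU_sim M M' : sim v M M' -> inSU v M = inSU v M'.
Proof.
move=> [U [hU ->]]; have [uU _ _] := GLo_unit hU.
apply/funext => a; apply/propext; split=> -[W [hW h]].
  exists (invmx U *m W); split; first by apply: GLo_mul => //; apply: GLo_inv.
  by rewrite congr_mul_invmx.
exists (U *m W); split; first exact: GLo_mul.
by rewrite trmx_mul !mulmxA in h *.
Qed.

Lemma GK_sim M M' : sim v M M' -> GK v M = GK v M'.
Proof. by move=> h; rewrite /GK (inSU_sim h). Qed.

Lemma inS_entry M a i j : M^T = M -> inS v M a ->
  vge2 (2 * M i j) ((nth 0%N a i)%:Z + (nth 0%N a j)%:Z).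
Proof.
move=> sM [_ _ _ h]; case: (leqP i j) => ij; first by have := h i j ij; rewrite PoszD.
have <- : M j i = M i j by rewrite -{1}sM mxE.
by have := h j i (ltnW ij); rewrite PoszD addrC.
Qed.

Lemma mxform_unit A U j y : U \in unitmx ->
  mxform A (col j U) y = \sum_l (U^T *m A *m U) j l * (invmx U *m y) l 0.
Proof.
move=> uU; transitivity ((row j (U^T *m A *m U) *m (invmx U *m y)) 0 0).
  by rewrite mulmxA -row_mul mulmxK // row_mul -tr_col.
by rewrite mxE; apply: eq_bigr => l _; rewrite mxE.
Qed.

(* The integral vectors on which a form in [inS v A a] takes values of order at least [m]. *)
Definition cvlevel a m x : Prop :=
  forall i : 'I_n, vge2 (x i 0) (m%:Z - (nth 0%N a i)%:Z) && vge2 (x i 0) 0.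

(* The quadratic form induced on [cvlevel a m / cvlevel a m.+1] has trivial radical; for a form in
   [inS v A a] this makes the filtration [cvlevel a] intrinsic. *)
Definition graded_nondegenerate A a : Prop :=
  forall m x, cvlevel a m x -> vge2 (mxform A x x) (2 * m%:Z + 2) ->
    (forall y, cvlevel a m y -> vge2 (2 * mxform A x y) (2 * m%:Z + 2)) -> cvlevel a m.+1 x.

Definition trunc a m i : nat := minn (nth 0%N a i) m.

Lemma truncP a m i : (m < nth 0%N a i)%N /\ trunc a m i = m \/
  (nth 0%N a i <= m)%N /\ trunc a m i = nth 0%N a i.
Proof.
by rewrite /trunc; case: (leqP (nth 0%N a i) m); [right|left].
Qed.

Section ChangeOfBasis.

Variables (A U : 'M[F]_n) (a a' : seq nat).
Hypotheses (sA : A^T = A) (ndA : graded_nondegenerate A a) (hU : GLo v U).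
Hypothesis UA : inS v (U^T *m A *m U) a'.

Lemma column_level_step m : (forall i, (i < n)%N -> trunc a m i = trunc a' m i) ->
  (forall i j : 'I_n, vge2 (U i j) ((trunc a m j)%:Z - (nth 0%N a i)%:Z)) ->
  forall i j : 'I_n, (m < nth 0%N a' j)%N -> vge2 (U i j) ((m.+1)%:Z - (nth 0%N a i)%:Z).
Proof.
move=> aa' hUm i j mj; have [uU dU iU] := GLo_unit hU.
have sUA := congr_sym U sA.
have tj : trunc a m j = m by rewrite aa' // /trunc (minn_idPr (ltnW mj)).
have hUt k l : vge2 (U k l) ((trunc a m l)%:Z - (trunc a m k)%:Z).
  case: (truncP a m k) => -[_ ->]; last exact: hUm.
  by apply: vge2_le (iU k l) _; have := geq_minr (nth 0%N a l) m; rewrite /trunc; lia.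
have hUj : cvlevel a m (col j U).
  by move=> k; rewrite mxE iU andbT; have := hUm k j; rewrite tj.
have := ndA hUj _ _ i; rewrite mxE => /(_ _ _)/andP[] // {i}.
  rewrite mxform_col; have [_ _ /(_ j) + _] := UA; rewrite vge_vge2 => h.
  by apply: vge2_le h _; lia.
move=> y hy; rewrite mxform_unit // mulr_sumr; apply: vge2_sum => l _; rewrite mulrA.
have hyl : vge2 ((invmx U *m y) l 0) (m%:Z - (trunc a m l)%:Z).
  rewrite mxE; apply: vge2_sum => k _.
  apply: (vge2M_le (vge2_invmx uU dU hUt l k) (l := m%:Z - (trunc a m k)%:Z)); last by lia.
  have /andP[level_yk int_yk] := hy k; case: (truncP a m k) => -[_ ->] //.
  by apply: vge2_le int_yk _; lia.
apply: (vge2_parity (vge2M (inS_entry j l sUA UA) hyl)) => z.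
have := aa' l (ltn_ord l); have := geq_minl (nth 0%N a' l) m; rewrite -/(trunc a' m l).
by move: (trunc a m l) (trunc a' m l) (nth _ _ l) (nth _ _ j) mj => p q r s; goal_lia.
Qed.

Lemma column_level k :
  (forall m, (m <= k)%N -> forall i, (i < n)%N -> trunc a m i = trunc a' m i) ->
  forall i j : 'I_n, vge2 (U i j) ((trunc a k j)%:Z - (nth 0%N a i)%:Z).
Proof.
elim: k => [|m IH] aa' i j.
  by have [_ _ iU] := GLo_unit hU; apply: vge2_le (iU i j) _; rewrite /trunc minn0; lia.
have hUm := IH (fun m' h => aa' m' (leqW h)).
have am := aa' m (leqnSn m); have am1 := aa' m.+1 (leqnn _) j (ltn_ord j).
case: (leqP (nth 0%N a' j) m) => mj; last first.
  apply: vge2_le (column_level_step am hUm i mj) _.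
  by have := geq_minr (nth 0%N a j) m.+1; rewrite /trunc; lia.
apply: vge2_le (hUm i j) _; move: (am j (ltn_ord j)) am1 mj; rewrite /trunc.
by move: (nth 0%N a j) (nth 0%N a' j) (nth 0%N a i) => x y z; goal_lia.
Qed.

Lemma first_diff_contra p : sorted leq a -> size a = n -> (p < n)%N ->
  (forall i, (i < p)%N -> nth 0%N a i = nth 0%N a' i) -> ~~ (nth 0%N a p < nth 0%N a' p)%N.
Proof.
move=> so sa pn eq_p; apply/negP => lt_p; have [sa' so' _ _] := UA; have [_ dU iU] := GLo_unit hU.
have a_ge i : (p <= i < n)%N -> (nth 0%N a p <= nth 0%N a i)%N.
  by move=> /andP[pi in_]; apply: (sorted_leq_nth leq_trans leqnn 0%N so); rewrite ?inE ?sa.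
have a_le i : (i <= p)%N -> (nth 0%N a i <= nth 0%N a p)%N.
  move=> ip; apply: (sorted_leq_nth leq_trans leqnn 0%N so); rewrite ?inE ?sa //.
  exact: leq_ltn_trans pn.
have a'_ge i : (p <= i < n)%N -> (nth 0%N a' p <= nth 0%N a' i)%N.
  by move=> /andP[pi in_]; apply: (sorted_leq_nth leq_trans leqnn 0%N so'); rewrite ?inE ?sa'.
have eq_trunc m : (m <= nth 0%N a p)%N -> forall i, (i < n)%N -> trunc a m i = trunc a' m i.
  rewrite /trunc => mp i in_; case: (ltnP i p) => ip; first by rewrite eq_p.
  have := a_ge i; have := a'_ge i; rewrite ip in_ => /(_ isT) h' /(_ isT) h.
  by rewrite !(minn_idPr _) //; lia.
have hU1 := column_level_step (eq_trunc _ (leqnn _)) (column_level eq_trunc).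
have : vge2 (\det U) 2.
  apply: (vge2_det_block (p := p) (q := p.+1)); rewrite ?ltnSn // => i j ip pj.
  have pj' : (nth 0%N a p < nth 0%N a' j)%N.
    by apply: leq_trans lt_p (a'_ge _ _); rewrite pj ltn_ord.
  apply: (vge2_parity (hU1 i j pj')) => z; have := a_le i ip; lia.
by case/veq2P: dU => d0 vd /vge2P/(_ d0); rewrite vd.
Qed.

Lemma inS_lex_max : size a = n -> sorted leq a -> lexle a a' ->
  a' = a /\ forall i j, vge2 (invmx U i j) ((nth 0%N a j)%:Z - (nth 0%N a i)%:Z).
Proof.
move=> sa so le_aa'; have [sa' _ _ _] := UA; have [uU dU _] := GLo_unit hU.
case: (lexle_first_diff _ le_aa') => [|aa'|[p [pn eq_p lt_p]]].
- by rewrite sa sa'.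
- split=> //; pose k := \max_(x <- a) x.
  have tk i : (i < n)%N -> trunc a k i = nth 0%N a i.
    move=> in_; apply/minn_idPl; apply: (@leq_bigmax_seq _ _ xpredT id) => //.
    by rewrite mem_nth // sa.
  apply: (vge2_invmx uU dU) => i j; have := @column_level k _ i j.
  by rewrite tk //; apply => m _ l _; rewrite /trunc aa'.
by rewrite sa in pn; rewrite (negPf (first_diff_contra so sa pn eq_p)) in lt_p.
Qed.

End ChangeOfBasis.

Lemma GK_eq A a : A^T = A -> inS v A a -> graded_nondegenerate A a -> GK v A = a.
Proof.
move=> sA hA ndA; have [sa so _ _] := hA.
have a_max a' : inSU v A a' -> lexle a' a.
  move=> [U [hU hS]]; case/orP: (lexle_total a' a) => // le_aa'.
  by have [e _] := inS_lex_max sA ndA hU hS sa so le_aa'; rewrite e in le_aa' *.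
have inA : inSU v A a by exists 1%:M; split; [exact: GLo1 | rewrite trmx1 mul1mx mulmx1].
rewrite /GK; set P := (fun _ => _).
have [hin hmax] := @classical_sets.xgetPex _ [::] P (ex_intro _ a (conj inA a_max)).
by apply: lexle_anti; [case: (hin) => U [_ [-> _ _ _]] | exact: a_max | exact: hmax].
Qed.

End Lattice.

Section GradedNondegenerate.

Variables (V : lmodType F) (B : {symmetric V}).
Local Notation "''[' x , y ]" := (B x y) : ring_scope.
Local Notation "''[' x ]" := (B x x) : ring_scope.
Variables (n : nat) (A : 'M[F]_n) (f : nat -> V) (a : nat -> nat).
Hypotheses (Af : forall i j : 'I_n, A i j = '[f i, f j]) (bnd : bounded B f a (iota 0 n)).
Implicit Types x y : 'cV[F]_n.

Definition vector_of x : V := \sum_(i < n) x i 0 *: f i.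

Lemma mxform_vector_of x y : mxform A x y = '[vector_of x, vector_of y].
Proof.
rewrite /mxform mxE symform_sumr; apply: eq_bigr => j _.
rewrite linearZr_LR /= mulrC symform_suml mxE; congr (_ * _); apply: eq_bigr => i _.
by rewrite linearZl_LR /= mxE Af.
Qed.

Section Degree.

Variables (m k : nat) (ps : seq (nat * nat)) (ss : seq nat) (x : 'cV[F]_n).
Hypotheses (kn : (k <= n)%N) (a_le : forall i, (i < n)%N -> (i < k)%N = (a i <= m)%N).
Hypotheses (pk : perm_eq (support ps ss) (iota 0 k)) (hR : reduced B f a ps ss).
Hypothesis x_level : cvlevel (mkseq a n) m x.
Hypothesis x_norm : vge2 (mxform A x x) (2 * m%:Z + 2).
Hypothesis x_radical : forall y, cvlevel (mkseq a n) m y ->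
  vge2 (2 * mxform A x y) (2 * m%:Z + 2).

Lemma coef_level (i : 'I_n) : vge2 (x i 0) (m%:Z - (a i)%:Z).
Proof. by have /andP[] := x_level i; rewrite nth_mkseq. Qed.

Lemma coef_int (i : 'I_n) : vge2 (x i 0) 0.
Proof. by have /andP[] := x_level i. Qed.

Lemma radical_pairing j : (j < k)%N -> vge2 (2 * '[vector_of x, f j]) (m%:Z + (a j)%:Z + 1).
Proof.
move=> jk; have jn := leq_trans jk kn; have aj : (a j <= m)%N by rewrite -a_le.
pose h := uphalf (m - a j); pose y : 'cV[F]_n := \col_l (if (l == j :> nat) then 2 ^+ h else 0).
have yL : cvlevel (mkseq a n) m y.
  move=> l; rewrite mxE nth_mkseq //; case: eqP => [->|_]; last by rewrite !vge2_0.
  by rewrite !(veq2_ge (veq2_2X h)) // /h; lia.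
have yE : vector_of y = 2 ^+ h *: f j.
  rewrite /vector_of (bigD1 (Ordinal jn)) //= mxE eqxx big1 ?addr0 // => l lj.
  by rewrite mxE (negPf (_ : (l != j :> nat))) ?scale0r.
have := x_radical yL; rewrite mxform_vector_of yE linearZr_LR /= => hy.
rewrite (_ : 2 * _ = 2 * (2 ^+ h * '[vector_of x, f j]) / 2 ^+ h); last first.
  by field; apply: expf_neq0 two_neq0.
by apply: (vge2_div hy (veq2_2X h)); rewrite /h; lia.
Qed.

Lemma unmatched_term (i j l : 'I_n) : matched ps i j -> l != i ->
  vge2 (x l 0 * (2 * '[f l, f j])) (m%:Z + (a j)%:Z + 1).
Proof.
move=> ij li; have jI : (j : nat) \in support ps ss.
  by case/matched_paired/andP: ij => _; apply: paired_support.
have [->|lj] := eqVneq l j.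
  by apply: (vge2M_le (coef_level j) (vge2_mul2 (reduced_norm hR jI) (lexx _))); lia.
have [lk|lk] := ltnP l k.
  have lI : (l : nat) \in support ps ss by rewrite (mem_support_iota _ pk).
  apply: (vge2M_le (coef_level l) (reduced_off hR lI jI lj _)); last by lia.
  have u := support_uniq_paired (reduced_uniq hR).
  by apply: contra li => lj'; apply/eqP/val_inj; apply: matched_inj u ij lj'.
have al : (m < a l)%N by rewrite ltnNge -a_le // -leqNgt.
by apply: (vge2M_le (coef_int l) (bnd.2 l j _ _ lj)); rewrite ?mem_iota ?ltn_ord //; lia.
Qed.

Lemma paired_coef_level (i : 'I_n) : (i : nat) \in paired ps ->
  vge2 (x i 0) (m%:Z - (a i)%:Z + 1).
Proof.
case/matched_partner => j ij; have ex := reduced_matched hR ij.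
have jk : (j < k)%N.
  rewrite -(mem_support_iota _ pk); apply: paired_support.
  by case/matched_paired/andP: ij.
have := radical_pairing jk; rewrite /vector_of symform_suml (bigD1 i) //= mulrDr.
set T := 2 * _; set S := 2 * _ => hTS.
have hS : vge2 S (m%:Z + (a j)%:Z + 1).
  rewrite /S mulr_sumr; apply: vge2_sum => l li; rewrite linearZl_LR /= mulrCA.
  by apply: (unmatched_term (i := i) (j := Ordinal (leq_trans jk kn))).
have hT : vge2 T (m%:Z + (a j)%:Z + 1) by rewrite -(addrK S T); apply: vge2B.
have -> : x i 0 = T / (2 * '[f i, f j]).
  by rewrite /T linearZl_LR /= mulrCA mulfK // (veq2_neq0 ex).
by apply: (vge2_div hT ex); lia.
Qed.

Lemma nonsingle_coef_level (i : 'I_n) : (i : nat) \notin ss -> vge2 (x i 0) (m%:Z - (a i)%:Z + 1).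
Proof.
move=> iss; have [ik|ik] := ltnP i k.
  apply: paired_coef_level; move: ik.
  by rewrite -(mem_support_iota _ pk) mem_cat (negPf iss).
by apply: vge2_le (coef_int i) _; have := a_le (ltn_ord i); lia.
Qed.

Lemma single_coef_level (i : 'I_n) : (i : nat) \in ss -> vge2 (x i 0) (m%:Z - (a i)%:Z + 1).
Proof.
move=> iss; have [par|par] := boolP (odd (a i + m)).
  by apply: (vge2_parity (coef_level i)) => z; move: par; move: (a i) => p; goal_lia.
have inI (l : 'I_n) : (l : nat) \in iota 0 n by rewrite mem_iota ltn_ord.
pose R := \sum_(l < n | l != i) x l 0 *: f l.
have R_level : level f a (iota 0 n) (m%:Z + 1) R.
  apply: lincomb_sum => l li; apply: level1 => //.
  suff : vge2 (x l 0) (m%:Z - (a l)%:Z + 1) by rewrite addrAC.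
  have [lss|] := boolP ((l : nat) \in ss); last exact: nonsingle_coef_level.
  have := reduced_parity hR lss iss li; move: par => par parl.
  by apply: (vge2_parity (coef_level l)) => z; move: par parl; move: (a i) (a l) => p q; goal_lia.
have xi_level : level f a (iota 0 n) m%:Z (x i 0 *: f i) by apply: level1 => //; apply: coef_level.
move: x_norm; rewrite mxform_vector_of /vector_of (bigD1 i) //= -/R.
have -> : '[x i 0 *: f i + R] = x i 0 ^+ 2 * '[f i] + (2 * '[x i 0 *: f i, R] + '[R]).
  rewrite !(linearDl, linearDr) /= !(linearZl_LR, linearZr_LR) /= [B R (f i)]symformC; ring.
set T := _ * '[f i]; set S := _ + '[R] => hTS.
have hS : vge2 S (2 * m%:Z + 1).
  apply: vge2D; first by apply: vge2_le (level_form bnd xi_level R_level) _; lia.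
  by apply: vge2_le (level_norm bnd R_level) _; lia.
have hT : vge2 T (2 * m%:Z + 1) by rewrite -(addrK S T); apply: vge2B hS; apply: vge2_le hTS _; lia.
have : vge2 (x i 0 ^+ 2) (2 * m%:Z + 1 - 2 * (a i)%:Z).
  rewrite -(mulfK (veq2_neq0 (reduced_single hR iss)) (x i 0 ^+ 2)).
  exact: (vge2_div hT (reduced_single hR iss)).
have [->|xi0] := eqVneq (x i 0) 0; first by rewrite vge2_0.
move=> /vge2P; rewrite expf_neq0 // valX // => /(_ isT) hv; apply/vge2P => _.
by move: hv; move: (v _) (a i) => p q; goal_lia.
Qed.

End Degree.

Lemma reduced_graded_nondegenerate :
  (forall m, exists k ps ss, [/\ (k <= n)%N, forall i, (i < n)%N -> (i < k)%N = (a i <= m)%N,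
     perm_eq (support ps ss) (iota 0 k) & reduced B f a ps ss]) ->
  graded_nondegenerate A (mkseq a n).
Proof.
move=> hR m x x_level x_norm x_radical i; have [k [ps [ss [kn a_le pk red]]]] := hR m.
rewrite nth_mkseq // (coef_int x_level) andbT (_ : _ - _ = m%:Z - (a i)%:Z + 1); last by lia.
by have [iss|iss] := boolP ((i : nat) \in ss);
  [apply: (single_coef_level kn a_le pk red) | apply: (nonsingle_coef_level kn a_le pk red)].
Qed.

End GradedNondegenerate.

(** * Triangular systems *)

Section Extension.

Variables (V : lmodType F) (B : {symmetric V}).
Local Notation "''[' x , y ]" := (B x y) : ring_scope.
Local Notation "''[' x ]" := (B x x) : ring_scope.
Implicit Types (f : nat -> V) (a : nat -> nat) (ps : seq (nat * nat)) (ss : seq nat) (x y z : V).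

Lemma reduced_update f a ps ss k x c : reduced B f a ps ss -> k \notin support ps ss ->
  reduced B (update f k x) (update a k c) ps ss.
Proof.
by move=> h kI; apply: (reduced_eq_in h) => l lI; rewrite update_neq //; apply: contraNneq kI => <-.
Qed.

Lemma reduced_add_single f a ps ss k x c : reduced B f a ps ss -> k \notin support ps ss ->
  veq2 '[x] (2 * c%:Z) ->
  {in support ps ss, forall l, vge2 (2 * '[f l, x]) ((a l)%:Z + c%:Z + 1)} ->
  {in ss, forall l, odd (a l + c)} ->
  reduced B (update f k x) (update a k c) ps (k :: ss).
Proof.
move=> h kI hx hl par; have h' := reduced_update x c h kI.
have nk l : l \in support ps ss -> l != k by move=> lI; apply: contraNneq kI => <-.
split.
- by rewrite /= -/(support _ _) kI; apply: reduced_uniq h.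
- move=> i; rewrite in_cons => /orP[/eqP->|]; last exact: (reduced_norm h').
  by rewrite !update_eq veq2W.
- exact: reduced_pair h'.
- move=> i j; rewrite !in_cons => /orP[/eqP->|iI] /orP[/eqP->|jI]; rewrite ?eqxx // => ij hlk.
  + by rewrite !update_eq !update_neq ?nk // symformC [c%:Z + _]addrC; apply: hl.
  + by rewrite !update_eq !update_neq ?nk //; apply: hl.
  + exact: (reduced_off h').
- move=> i; rewrite in_cons => /orP[/eqP->|]; last exact: (reduced_single h').
  by rewrite !update_eq.
- move=> i j; rewrite !in_cons => /orP[/eqP->|iI] /orP[/eqP->|jI]; rewrite ?eqxx // => ij.
  + by rewrite update_eq update_neq ?nk ?single_support // addnC; apply: par.
  + by rewrite update_eq update_neq ?nk ?single_support //; apply: par.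
  + exact: (reduced_parity h').
Qed.

Lemma reduced_add_partner f a ps ss ss' i k x c : reduced B f a ps ss -> perm_eq ss (i :: ss') ->
  k \notin support ps ss -> vge2 '[x] (2 * c%:Z) -> veq2 (2 * '[f i, x]) ((a i)%:Z + c%:Z) ->
  {in support ps ss, forall l, l != i -> vge2 (2 * '[f l, x]) ((a l)%:Z + c%:Z + 1)} ->
  reduced B (update f k x) (update a k c) ((i, k) :: ps) ss'.
Proof.
move=> h pp kI hx hi hl; have h' := reduced_update x c h kI.
have pI := support_pair_single_perm ps k pp; have m := perm_mem pI.
have nk l : l \in support ps ss -> l != k by move=> lI; apply: contraNneq kI => <-.
have iI : i \in support ps ss by rewrite single_support // (perm_mem pp) mem_head.
have sub l : l \in ss' -> l \in ss by rewrite (perm_mem pp) inE => ->; rewrite orbT.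
have matched_ik : matched ((i, k) :: ps) i k by rewrite /matched mem_head.
split.
- by rewrite (perm_uniq pI) /= kI; apply: reduced_uniq h.
- move=> l; rewrite m in_cons => /orP[/eqP->|]; last exact: (reduced_norm h').
  by rewrite !update_eq.
- move=> p; rewrite in_cons => /orP[/eqP->|]; last exact: (reduced_pair h').
  by rewrite /= !update_eq !update_neq ?nk.
- move=> l j; rewrite !m !in_cons => /orP[/eqP->|lI] /orP[/eqP->|jI]; rewrite ?eqxx // => lj hlk.
  + rewrite !update_eq !update_neq ?nk // symformC [c%:Z + _]addrC; apply: hl => //.
    by apply: contraNneq hlk => ->; rewrite matched_sym.
  + rewrite !update_eq !update_neq ?nk //; apply: hl => //.
    by apply: contraNneq hlk => ->.
  + by apply: (reduced_off h' lI jI lj); apply: matched_behead hlk.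
- by move=> l /sub; apply: (reduced_single h').
- by move=> l j /sub lI /sub jI; apply: (reduced_parity h').
Qed.

Lemma reduced_add_plane f a ps ss k k' x x' c : reduced B f a ps ss ->
  uniq [:: k, k' & support ps ss] -> vge2 '[x] (2 * c%:Z) -> vge2 '[x'] (2 * c%:Z) ->
  veq2 (2 * '[x, x']) (c%:Z + c%:Z) ->
  {in support ps ss, forall l, vge2 (2 * '[f l, x]) ((a l)%:Z + c%:Z + 1)} ->
  {in support ps ss, forall l, vge2 (2 * '[f l, x']) ((a l)%:Z + c%:Z + 1)} ->
  reduced B (update2 f k k' x x') (update2 a k k' c c) ((k, k') :: ps) ss.
Proof.
move=> h u hx hx' hxx' hl hl'; have pI := support_cons_perm (k, k') ps ss; rewrite /= in pI.
have m := perm_mem pI; rewrite -(perm_uniq pI) in u; have [/= kk' _ nk] := support_cons_uniq u.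
have h' : reduced B (update2 f k k' x x') (update2 a k k' c c) ps ss.
  by apply: (reduced_eq_in h) => l lI; rewrite update2_out ?nk.
have lkk : matched ((k, k') :: ps) k k' by rewrite /matched mem_head.
have lkk' : matched ((k, k') :: ps) k' k by rewrite matched_sym.
split=> //.
- move=> l; rewrite m !in_cons => /or3P[/eqP->|/eqP->|]; last exact: (reduced_norm h').
    by rewrite !update2_fst.
  by rewrite !update2_snd.
- move=> p; rewrite in_cons => /orP[/eqP->|]; last exact: (reduced_pair h').
  by rewrite /= !update2_snd !update2_fst.
- move=> l j; rewrite !m !in_cons => /or3P[/eqP->|/eqP->|lI] /or3P[/eqP->|/eqP->|jI];
    rewrite ?eqxx ?lkk ?lkk' // => lj hlk.
  + by rewrite !update2_fst // !update2_out ?nk // symformC [c%:Z + _]addrC; apply: hl.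
  + by rewrite !update2_snd // !update2_out ?nk // symformC [c%:Z + _]addrC; apply: hl'.
  + by rewrite !update2_fst // !update2_out ?nk //; apply: hl.
  + by rewrite !update2_snd // !update2_out ?nk //; apply: hl'.
  + by apply: (reduced_off h' lI jI lj); apply: matched_behead hlk.
- exact: reduced_single h'.
- exact: reduced_parity h'.
Qed.

(* The residue field is perfect, so the leading term of [x] is minus a square times that of [y]. *)
Lemma cancel_leading_term (x y : F) (m n : nat) : vge2 x (2 * m%:Z) -> veq2 y (2 * n%:Z) ->
  ~~ odd (m + n) -> exists s, [/\ vge2 s (m%:Z - n%:Z), vge2 (x + s ^+ 2 * y) (2 * m%:Z + 2) &
    veq2 x (2 * m%:Z) -> veq2 s (m%:Z - n%:Z)].
Proof.
move=> hx hy par; have [h hE] : exists h : int, m%:Z - n%:Z = 2 * h.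
  by exists ((m%:Z - n%:Z) %/ 2)%Z; move: par; goal_lia.
have [t t0 vt] := val_surj h; have y0 := veq2_neq0 hy.
have ht : veq2 t (m%:Z - n%:Z) by apply/veq2P; rewrite t0 vt hE.
have hyt := veq2M hy (veq2X 2 ht).
have hr : vge2 (- (x / (y * t ^+ 2))) 0 by rewrite vge2N; apply: (vge2_div hx hyt); goal_lia.
have [s0 hs0 hs] := residue_perfect hr; exists (s0 * t); split.
- by apply: vge2_intM hs0 (veq2W ht).
- have -> : x + (s0 * t) ^+ 2 * y = (s0 ^+ 2 - - (x / (y * t ^+ 2))) * (y * t ^+ 2).
    by field; rewrite t0 y0.
  by apply: (vge2M_le hs (veq2W hyt)); goal_lia.
move=> ex; suff es : veq2 s0 0 by apply: (veq2_congr (veq2M es ht)); rewrite ?add0r.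
have sqrE : s0 ^+ 2 = - (x / (y * t ^+ 2)) + (s0 ^+ 2 - - (x / (y * t ^+ 2))) by ring.
rewrite -veq2_sqr sqrE.
apply: veq2D; last by apply: vge2_le hs _.
by rewrite veq2N; apply: (veq2_congr (veq2M ex (veq2V hyt))) => //; goal_lia.
Qed.

Variable e : nat -> V.

Definition integral_span k : V -> Prop := lincomb e (iota 0 k) (fun _ c => vge2 c 0).

Lemma integral_span_leq i j x : (i <= j)%N -> integral_span i x -> integral_span j x.
Proof.
by move=> ij h; apply: lincomb_sub h _ _ => // m; rewrite !mem_iota /= => h; apply: leq_trans h ij.
Qed.

Lemma integral_span_mem l k : (l < k)%N -> integral_span k (e l).
Proof. by move=> lk; rewrite -[e l]scale1r; apply: lincomb1; rewrite ?mem_iota // vge2_1. Qed.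

Lemma integral_spanZ k c x : vge2 c 0 -> integral_span k x -> integral_span k (c *: x).
Proof. by move=> hc h; apply: lincombZ h _ => m d; apply: vge2_intM. Qed.

Lemma integral_span_orth k x z : (forall l, (l < k)%N -> '[e l, z] = 0) -> integral_span k x ->
  '[x, z] = 0.
Proof. by move=> h hx; apply: lincomb_orth hx _ => l; rewrite mem_iota => /h. Qed.

Record triangular_system k f a ps ss : Prop := {
  system_support : perm_eq (support ps ss) (iota 0 k);
  system_reduced : reduced B f a ps ss;
  system_triangular : forall l, (l < k)%N -> integral_span l (f l - e l) }.

Section Triangular.

Variables (k : nat) (f : nat -> V).
Hypothesis tri : forall l, (l < k)%N -> integral_span l (f l - e l).

Lemma triangular_span l : (l < k)%N -> integral_span l.+1 (f l).
Proof.
move=> lk; rewrite -[f l](subrK (e l)); apply: lincombD; last exact: integral_span_mem.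
exact: integral_span_leq (leqnSn l) (tri lk).
Qed.

Lemma triangular_orth l z : (l < k)%N -> (forall m, (m <= l)%N -> '[e m, z] = 0) -> '[f l, z] = 0.
Proof. by move=> lk h; apply: integral_span_orth (triangular_span lk). Qed.

Lemma level_integral_span a K ps ss y : perm_eq (support ps ss) (iota 0 k) ->
  (forall l, (l < k)%N -> (a l <= K.+1)%N) -> level f a (support ps ss) K%:Z y -> integral_span k y.
Proof.
move=> pk aK; elim: y / => [|y m c _ IH mI hc]; first exact: lincomb0.
have mk : (m < k)%N by rewrite -(mem_support_iota _ pk).
apply: lincombD => //; apply: integral_spanZ; last exact: integral_span_leq mk (triangular_span mk).
by apply: (vge2_parity hc); have := aK _ mk; move: (a m) => p; goal_lia.
Qed.

Lemma triangular_gram : mxcongr (gram B e k) (gram B f k).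
Proof.
apply: gram_lspan => l lk; apply: lincomb_lspan (triangular_span lk).
by move=> m; rewrite !mem_iota /= => h; apply: leq_trans h lk.
Qed.

End Triangular.

Section NewVectors.

Variables (k K : nat) (f : nat -> V) (a : nat -> nat) (ps : seq (nat * nat)) (ss : seq nat).
Hypothesis sys : triangular_system k f a ps ss.

Let pk := system_support sys.
Let red := system_reduced sys.

Lemma new_index_notin l : (k <= l)%N -> l \notin support ps ss.
Proof. by rewrite (mem_support_iota _ pk) -leqNgt. Qed.

Lemma new_indices_uniq : uniq [:: k, k.+1 & support ps ss].
Proof. by rewrite /= inE negb_or neq_ltn ltnSn !new_index_notin ?(reduced_uniq red). Qed.

Lemma triangular_system_add1 y c ps' ss' : integral_span k y ->
  reduced B (update f k (e k + y)) (update a k c) ps' ss' ->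
  perm_eq (support ps' ss') (k :: support ps ss) ->
  triangular_system k.+1 (update f k (e k + y)) (update a k c) ps' ss'.
Proof.
move=> hy red' pp; split=> //; first exact: perm_iotaS pp pk.
move=> l; rewrite ltnS leq_eqVlt => /orP[/eqP->|lk].
  by rewrite update_eq addrAC subrr add0r.
by rewrite update_neq ?ltn_eqF //; apply: (system_triangular sys).
Qed.

Lemma triangular_system_add2 y y' c : integral_span k y -> integral_span k y' ->
  reduced B (update2 f k k.+1 (e k + y) (e k.+1 + y')) (update2 a k k.+1 c c)
    ((k, k.+1) :: ps) ss ->
  triangular_system k.+2 (update2 f k k.+1 (e k + y) (e k.+1 + y')) (update2 a k k.+1 c c)
    ((k, k.+1) :: ps) ss.
Proof.
move=> hy hy' red'; split=> //.
  apply: (@perm_iotaS (k :: support ps ss)); last exact: perm_iotaS.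
  apply: perm_trans (support_cons_perm _ _ _) _.
  by apply/permPl; apply: (perm_catCA [:: k] [:: k.+1]).
move=> l; rewrite /update2 ltnS leq_eqVlt => /orP[/eqP->|].
  by rewrite update_eq addrAC subrr add0r; apply: integral_span_leq hy'.
rewrite ltnS leq_eqVlt => /orP[/eqP->|lk].
  by rewrite update_neq ?ltn_eqF // update_eq addrAC subrr add0r.
by rewrite !update_neq ?ltn_eqF ?(leqW lk) //; apply: (system_triangular sys).
Qed.

Lemma system_orth z l : (forall m, (m < k)%N -> '[e m, z] = 0) -> l \in support ps ss ->
  '[f l, z] = 0.
Proof.
move=> ez; rewrite (mem_support_iota _ pk) => lk.
apply: (triangular_orth (system_triangular sys) lk) => m ml.
by apply: ez; apply: leq_ltn_trans ml lk.
Qed.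

Definition new_vector z : Prop := (forall l, (l < k)%N -> '[e l, z] = 0) /\ veq2 '[z] (2 * K%:Z).

Lemma extend_single : new_vector (e k) -> {in ss, forall l, odd (a l + K)} ->
  exists x, triangular_system k.+1 (update f k x) (update a k K) ps (k :: ss).
Proof.
move=> [eo eK] par; exists (e k + 0); apply: triangular_system_add1 => //; first exact: lincomb0.
rewrite addr0; apply: reduced_add_single => //; first exact: new_index_notin.
by move=> l lI; rewrite system_orth // mulr0 vge2_0.
Qed.

Lemma extend_plane : (forall l, (l < k)%N -> '[e l, e k] = 0) ->
  (forall l, (l < k)%N -> '[e l, e k.+1] = 0) -> vge2 '[e k] (2 * K%:Z) ->
  vge2 '[e k.+1] (2 * K%:Z) -> veq2 (2 * '[e k, e k.+1]) (K%:Z + K%:Z) ->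
  exists x x', triangular_system k.+2 (update2 f k k.+1 x x') (update2 a k k.+1 K K)
    ((k, k.+1) :: ps) ss.
Proof.
move=> eo eo' ek ek' ee'; exists (e k + 0), (e k.+1 + 0).
apply: triangular_system_add2; try exact: lincomb0.
rewrite !addr0; apply: reduced_add_plane => //; first exact: new_indices_uniq.
  by move=> l lI; rewrite system_orth // mulr0 vge2_0.
by move=> l lI; rewrite system_orth // mulr0 vge2_0.
Qed.

Section Corrections.

Hypothesis aK : forall l, (l < k)%N -> (a l <= K.+1)%N.
Variables (r : nat -> V) (reps : single_reps B f a ps ss r).

Lemma rep_orth z i : (forall l, (l < k)%N -> '[e l, z] = 0) -> i \in ss -> '[z, r i] = 0.
Proof.
have [rL _ _ _ _] := reps; move=> ez /rL hi; rewrite symformC.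
by apply: lincomb_orth hi _ => l; apply: system_orth.
Qed.

Lemma correction_span i s : i \in ss -> vge2 s (K%:Z - (a i)%:Z) -> integral_span k (s *: r i).
Proof.
have [rL _ _ _ _] := reps; move=> /rL hi hs.
apply: (level_integral_span (system_triangular sys) pk aK).
by apply: (levelZ hi hs); goal_lia.
Qed.

Lemma correction i z : i \in ss -> ~~ odd (K + a i) -> new_vector z -> exists s,
  veq2 s (K%:Z - (a i)%:Z) /\ vge2 '[z + s *: r i] (2 * K%:Z + 2).
Proof.
move=> iss par [ez zK]; have [_ _ _ rx _] := reps.
have [s [_ hs es]] := cancel_leading_term (veq2W zK) (rx i iss) par.
by exists s; split; [exact: es | rewrite symnormDZ rep_orth // mulr0 addr0].
Qed.

Section CorrectedVector.

Variables (i : nat) (z : V) (s : F).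
Hypotheses (iss : i \in ss) (new_z : new_vector z) (es : veq2 s (K%:Z - (a i)%:Z)).

Lemma corrected_paired l : l \in paired ps -> '[f l, z + s *: r i] = 0.
Proof.
have [_ ro _ _ _] := reps; move=> lI.
rewrite linearDr linearZr_LR /= ro // mulr0 addr0.
by rewrite system_orth ?(paired_support ss) //; case: new_z.
Qed.

Lemma corrected_single j : j \in ss -> 2 * '[f j, z + s *: r i] = s * (2 * '[r i, r j]).
Proof.
have [_ _ rb _ _] := reps; move=> jss; rewrite linearDr linearZr_LR /= (rb _ _ iss jss).
rewrite [B (r j) _]symformC system_orth ?single_support //; last by case: new_z.
by rewrite add0r mulrCA.
Qed.

Lemma corrected_own : veq2 (2 * '[f i, z + s *: r i]) (K%:Z + (a i)%:Z + 2).
Proof.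
have [_ _ _ rx _] := reps; rewrite corrected_single //.
by apply: (veq2_congr (veq2M es (veq2M veq2_2 (rx i iss)))) => //; goal_lia.
Qed.

Lemma corrected_pairing l : l \in support ps ss ->
  (l \in ss -> l != i -> vge2 (2 * '[r i, r l]) ((a i)%:Z + (a l)%:Z + 3)) ->
  vge2 (2 * '[f l, z + s *: r i]) ((a l)%:Z + K%:Z + 2).
Proof.
rewrite mem_cat => /orP[lss|lI] hl; last by rewrite corrected_paired // mulr0 vge2_0.
have [->|li] := eqVneq l i; first by apply: veq2_ge corrected_own _; goal_lia.
by rewrite corrected_single //; apply: (vge2M_le (veq2W es) (hl lss li)); goal_lia.
Qed.

End CorrectedVector.

Lemma extend_corrected_plane i : i \in ss -> ~~ odd (K + a i) ->
  {in ss, forall j, j != i -> vge2 (2 * '[r i, r j]) ((a i)%:Z + (a j)%:Z + 3)} ->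
  new_vector (e k) -> new_vector (e k.+1) -> '[e k, e k.+1] = 0 ->
  exists x x', triangular_system k.+2 (update2 f k k.+1 x x') (update2 a k k.+1 K.+1 K.+1)
    ((k, k.+1) :: ps) ss.
Proof.
move=> iss par hi new_k new_k' kk'; have [_ _ _ rx _] := reps.
have [s [es norm_s]] := correction iss par new_k.
have [s' [es' norm_s']] := correction iss par new_k'.
exists (e k + s *: r i), (e k.+1 + s' *: r i); apply: triangular_system_add2.
- exact: correction_span (veq2W es).
- exact: correction_span (veq2W es').
apply: reduced_add_plane => //; first exact: new_indices_uniq.
- by apply: vge2_le norm_s _; goal_lia.
- by apply: vge2_le norm_s' _; goal_lia.
- rewrite symformDZ kk' [B (r i) (e _)]symformC (rep_orth new_k.1 iss) (rep_orth new_k'.1 iss).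
  apply: (veq2_congr (veq2M veq2_2 (veq2M (veq2M es es') (rx i iss)))); first by ring.
  by goal_lia.
- move=> l lI; apply: vge2_le (corrected_pairing iss new_k es lI _) _; last by goal_lia.
  by move=> lss; apply: hi.
move=> l lI; apply: vge2_le (corrected_pairing iss new_k' es' lI _) _; last by goal_lia.
by move=> lss; apply: hi.
Qed.

Lemma extend_odd i : ss = [:: i] -> ~~ odd (K + a i) -> new_vector (e k) -> exists x,
  triangular_system k.+1 (update f k x) (update a k K.+2) ((i, k) :: ps) [::] \/
  triangular_system k.+1 (update f k x) (update a k K.+1) ps [:: k; i].
Proof.
move=> ssE par new_k; have iss : i \in ss by rewrite ssE mem_head.
have [s [es norm_s]] := correction iss par new_k; have hs := correction_span iss (veq2W es).
have other l : l \in ss -> l != i -> vge2 (2 * '[r i, r l]) ((a i)%:Z + (a l)%:Z + 3).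
  by rewrite ssE inE => /eqP->; rewrite eqxx.
exists (e k + s *: r i).
have [large|small] := boolP (vge2 '[e k + s *: r i] (2 * K.+2%:Z)); [left|right].
  apply: triangular_system_add1 => //; last by apply: support_pair_single_perm; rewrite ssE.
  apply: (reduced_add_partner red (i := i)) => //.
  - by rewrite ssE.
  - exact: new_index_notin.
  - by apply: (veq2_congr (corrected_own iss new_k es)) => //; goal_lia.
  move=> l lI li; move: (lI); rewrite mem_cat ssE inE (negPf li) => lp.
  by rewrite corrected_paired // mulr0 vge2_0.
rewrite -ssE; apply: triangular_system_add1 => //; apply: reduced_add_single => //.
- exact: new_index_notin.
- apply: vge2_eq; first by apply: vge2_le norm_s _; goal_lia.
  by apply: contra small => h; apply: vge2_le h _; goal_lia.
- by move=> l lI; apply: vge2_le (corrected_pairing iss new_k es lI (@other l)) _; goal_lia.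
by move=> l; rewrite ssE inE => /eqP->; move: par; move: (a i) => p; goal_lia.
Qed.

Lemma extend_even_plane i j : ss = [:: i; j] -> ~~ odd (K + a i) -> new_vector (e k) ->
  ~~ vge2 (2 * '[r i, r j]) ((a i)%:Z + (a j)%:Z + 3) ->
  exists x, triangular_system k.+1 (update f k x) (update a k K.+1) ((j, k) :: ps) [:: i].
Proof.
move=> ssE par new_k small; have [_ _ _ _ rr] := reps.
have iss : i \in ss by rewrite ssE mem_head.
have jss : j \in ss by rewrite ssE !inE eqxx orbT.
have ij : i != j by apply: (@two_singles_neq ps); rewrite -ssE (reduced_uniq red).
have [s [es norm_s]] := correction iss par new_k.
have [m mE] : exists m : int, (a i)%:Z + (a j)%:Z + 1 = 2 * m.
  exists (((a i)%:Z + (a j)%:Z + 1) %/ 2)%Z; have := reduced_parity red iss jss ij.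
  by move: (a i) (a j) => p q; goal_lia.
have erij : veq2 (2 * '[r i, r j]) ((a i)%:Z + (a j)%:Z + 1).
  rewrite mE; apply: vge2_eq; first by rewrite -mE; apply: rr.
  by apply: contra small => h; apply: vge2_le h _; move: mE; goal_lia.
have pij : perm_eq ss (j :: [:: i]) by rewrite ssE; apply/permPl; apply: (perm_catC [:: i] [:: j]).
exists (e k + s *: r i); apply: triangular_system_add1.
- exact: correction_span (veq2W es).
- apply: (reduced_add_partner red pij); first exact: new_index_notin.
  + by apply: vge2_le norm_s _; goal_lia.
  + by rewrite corrected_single //; apply: (veq2_congr (veq2M es erij)) => //; goal_lia.
  move=> l lI lj; apply: vge2_le (corrected_pairing iss new_k es lI _) _; last by goal_lia.
  by rewrite ssE !inE => /orP[] /eqP lE; rewrite lE eqxx in lj *.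
exact: support_pair_single_perm.
Qed.

Lemma extend_even_partner i j : ss = [:: i; j] -> ~~ odd (K + a i) -> new_vector (e k) ->
  vge2 (2 * '[r i, r j]) ((a i)%:Z + (a j)%:Z + 3) ->
  exists x, triangular_system k.+1 (update f k x) (update a k K.+2) ((i, k) :: ps) [:: j].
Proof.
move=> ssE par new_k rij; have [rL ro rb rx _] := reps.
have iss : i \in ss by rewrite ssE mem_head.
have jss : j \in ss by rewrite ssE !inE eqxx orbT.
have ij : i != j by apply: (@two_singles_neq ps); rewrite -ssE (reduced_uniq red).
have [s [es norm_s]] := correction iss par new_k.
have par' : ~~ odd (K.+1 + a j).
  by have := reduced_parity red iss jss ij; move: par; move: (a i) (a j) => p q; goal_lia.
have norm_s1 : vge2 '[e k + s *: r i] (2 * K.+1%:Z) by apply: vge2_le norm_s _; goal_lia.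
have [s' [hs' norm_s' _]] := cancel_leading_term norm_s1 (rx j jss) par'.
exists (e k + (s *: r i + s' *: r j)); apply: triangular_system_add1.
- apply: lincombD; first exact: correction_span (veq2W es).
  by apply: correction_span => //; apply: vge2_le hs' _; goal_lia.
- rewrite addrA; apply: (reduced_add_partner red (i := i) (ss' := [:: j])); rewrite -?ssE //.
  + exact: new_index_notin.
  + rewrite symnormDZ [B (_ + _) (r j)]linearDl linearZl_LR /= (rep_orth new_k.1 jss) add0r addrAC.
    apply: vge2D; first by apply: vge2_le norm_s' _; goal_lia.
    rewrite (_ : 2 * s' * _ = s * s' * (2 * '[r i, r j])); last by ring.
    by apply: (vge2M_le (vge2M (veq2W es) hs') rij); goal_lia.
  + rewrite linearDr linearZr_LR /= mulrDr mulrCA (rb _ _ jss iss).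
    apply: (veq2_congr (veq2D (corrected_own iss new_k es) _) erefl); last by goal_lia.
    by apply: (vge2M_le hs' rij); goal_lia.
  move=> l lI li; rewrite linearDr linearZr_LR /= mulrDr mulrCA.
  move: (lI); rewrite mem_cat => /orP[lss|lp]; last first.
    by rewrite corrected_paired // ro // !mulr0 addr0 vge2_0.
  have {lss li} -> : l = j by apply/eqP; move: lss; rewrite ssE !inE (negPf li).
  apply: vge2D; first by rewrite corrected_single //; apply: (vge2M_le (veq2W es) rij); goal_lia.
  rewrite (rb _ _ jss jss).
  by apply: (vge2M_le hs' (vge2_mul2 (veq2W (rx j jss)) (lexx _))); goal_lia.
by apply: support_pair_single_perm; rewrite ssE.
Qed.

End Corrections.

End NewVectors.

End Extension.

(** * Pre-optimal forms *)

Lemma mxeE m (M : 'M[F]_m) (i j : 'I_m) : mxe M i j = M i j.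
Proof. by rewrite /mxe !valK. Qed.

Lemma mxe_out m (M : 'M[F]_m) i j : ~~ ((i < m)%N && (j < m)%N) -> mxe M i j = 0.
Proof.
rewrite /mxe negb_and => /orP[h|h]; first by rewrite insubF // (negPf h).
by rewrite [insub j]insubF ?(negPf h) //; case: (insub i).
Qed.

Section Blocks.

Implicit Types (b : blk F) (s : seq (nat * blk F)).

Lemma degs_cat s1 s2 : degs (s1 ++ s2) = (degs s1 + degs s2)%N.
Proof. by rewrite /degs map_cat sumn_cat. Qed.

Lemma blk_entryC b i j : blk_entry b i j = blk_entry b j i.
Proof.
case: b => [s|x y z] /=; first by rewrite eq_sym; case: eqP => // ->.
by rewrite [(j == 0%N) && _]andbC [(j == 1%N) && (i == 1%N)]andbC orbC [(j == 0%N) && _]andbC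
  [(j == 1%N) && _]andbC.
Qed.

Lemma entC s i j : ent s i j = ent s j i.
Proof.
elim: s i j => [|[k b] s IH] i j //=.
by rewrite [(j < _)%N && _]andbC [(_ <= j)%N && _]andbC blk_entryC IH.
Qed.

Lemma ent_catl s1 s2 i j : (i < degs s1)%N -> (j < degs s1)%N -> ent (s1 ++ s2) i j = ent s1 i j.
Proof.
elim: s1 i j => [|[k b] s1 IH] i j //=; rewrite /degs /= -/(degs s1) => hi hj.
case: ifP => // _; case: ifP => // /andP[di dj]; apply: IH; lia.
Qed.

Lemma ent_catr s1 s2 i j : ent (s1 ++ s2) (degs s1 + i) (degs s1 + j) = ent s2 i j.
Proof.
elim: s1 i j => [|[k b] s1 IH] i j //=; rewrite /degs /= -/(degs s1) => //.
have -> : (deg b + degs s1 + i < deg b)%N = false by lia.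
have -> : (deg b <= deg b + degs s1 + i)%N by lia.
have -> : (deg b <= deg b + degs s1 + j)%N by lia.
by rewrite /= -!addnA !addKn.
Qed.

Lemma ent_cat_off s1 s2 i j : (i < degs s1)%N -> (degs s1 <= j)%N -> ent (s1 ++ s2) i j = 0.
Proof.
elim: s1 i j => [|[k b] s1 IH] i j //=; rewrite /degs /= -/(degs s1) => hi hj.
have -> : (j < deg b)%N = false by lia.
rewrite andbF; case: ifP => // /andP[di dj]; apply: IH; lia.
Qed.

Lemma assemble_sym s : (assemble s)^T = assemble s.
Proof. by apply/matrixP => i j; rewrite !mxE entC. Qed.

Definition block_form s : {symmetric 'cV[F]_(degs s)} := symmxform (assemble_sym s).

Definition basis_cv n j : 'cV[F]_n := \col_i (i == j :> nat)%:R.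

Lemma mxform_basis n (M : 'M[F]_n) (i j : 'I_n) : mxform M (basis_cv n i) (basis_cv n j) = M i j.
Proof.
have colE (l : 'I_n) : basis_cv n l = col l 1%:M by apply/colP => x; rewrite !mxE.
by rewrite !colE mxform_col trmx1 mul1mx mulmx1.
Qed.

Lemma block_form_basis s i j : (i < degs s)%N -> (j < degs s)%N ->
  block_form s (basis_cv _ i) (basis_cv _ j) = ent s i j.
Proof.
by move=> hi hj; have := mxform_basis (assemble s) (Ordinal hi) (Ordinal hj); rewrite mxE.
Qed.

End Blocks.

Section PrefixDegrees.

Variable bl : seq (nat * blk F).
Notation off t := (degs (take t bl)).
Notation n := (degs bl).
Notation e := (basis_cv n).

Lemma offS t : (t < size bl)%N -> off t.+1 = (off t + deg (Cb bl t.+1))%N.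
Proof.
by move=> ht; rewrite (take_nth (0%N, BD [::]) ht) -cats1 degs_cat /= /degs /= addn0.
Qed.

Lemma off_leq t t' : (t <= t')%N -> (off t <= off t')%N.
Proof.
by move=> tt; rewrite -(cat_take_drop t (take t' bl)) take_takel // degs_cat leq_addr.
Qed.

Lemma off_leq_degs t : (off t <= n)%N.
Proof. by rewrite -{2}(cat_take_drop t bl) degs_cat leq_addr. Qed.

Lemma ent_take t i j : (i < off t)%N -> (j < off t)%N -> ent (take t bl) i j = ent bl i j.
Proof. by move=> hi hj; rewrite -{2}(cat_take_drop t bl) ent_catl. Qed.

Lemma ent_off t i j : (i < off t)%N -> (off t <= j)%N -> ent bl i j = 0.
Proof. by move=> hi hj; rewrite -(cat_take_drop t bl) ent_cat_off. Qed.

Lemma ent_blk t x y : (t < size bl)%N -> (x < deg (Cb bl t.+1))%N -> (y < deg (Cb bl t.+1))%N ->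
  ent bl (off t + x) (off t + y) = 2 ^+ (kb bl t.+1) * blk_entry (Cb bl t.+1) x y.
Proof.
move=> ht; rewrite /Cb /kb /=; set d := (0%N, _) => hx hy.
rewrite -{1}(cat_take_drop t bl) ent_catr (drop_nth d ht).
by case: (nth d bl t) hx hy => k b /= -> ->.
Qed.

Lemma block_form_off t i j : (i < off t)%N -> (off t <= j)%N -> block_form bl (e i) (e j) = 0.
Proof.
move=> hi hj; have [hn|hn] := ltnP j n.
  by rewrite block_form_basis ?(ent_off hi hj) // (leq_trans hi) ?off_leq_degs.
have -> : e j = 0 by apply/colP => x; rewrite !mxE (ltn_eqF (leq_trans (ltn_ord x) hn)).
by rewrite linear0r.
Qed.

Lemma Bpre_gram t : Bpre bl t = gram (block_form bl) e (off t).
Proof.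
apply/matrixP => i j; rewrite !mxE ent_take // block_form_basis //.
  exact: leq_trans (ltn_ord i) (off_leq_degs t).
exact: leq_trans (ltn_ord j) (off_leq_degs t).
Qed.

Lemma ulsub_Bpre t x y : mxe (ulsub (off t) (assemble bl)) x y = mxe (Bpre bl t) x y.
Proof.
have [/andP[hx hy]|h] := boolP ((x < off t)%N && (y < off t)%N); last by rewrite !mxe_out.
have hx' := leq_trans hx (off_leq_degs t); have hy' := leq_trans hy (off_leq_degs t).
rewrite (mxeE _ (Ordinal hx) (Ordinal hy)) (mxeE (Bpre bl t) (Ordinal hx) (Ordinal hy)) !mxE /=.
by rewrite (mxeE _ (Ordinal hx') (Ordinal hy')) mxE ent_take.
Qed.

End PrefixDegrees.

Section Stages.

Variable bl : seq (nat * blk F).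
Notation off t := (degs (take t bl)).
Notation n := (degs bl).
Notation e := (basis_cv n).
Notation form := (block_form bl).
Implicit Types (t k c : nat) (f : nat -> 'cV[F]_n) (a : nat -> nat).
Implicit Types (ps : seq (nat * nat)) (ss : seq nat).

Definition reduced_prefix f a c : Prop := exists t ps ss,
  [/\ (t <= size bl)%N, off t = c, perm_eq (support ps ss) (iota 0 c) & reduced form f a ps ss].

Lemma reduced_prefix_agree f f' a a' k c : (c <= k)%N -> (forall l, (l < k)%N -> f' l = f l) ->
  (forall l, (l < k)%N -> a' l = a l) -> reduced_prefix f a c -> reduced_prefix f' a' c.
Proof.
move=> ck ff aa [t [ps [ss [tsz tc pk red]]]]; exists t, ps, ss; split=> //.
apply: (reduced_eq_in red) => l; rewrite (mem_support_iota _ pk) => lc.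
  by rewrite ff // (leq_trans lc).
by rewrite aa // (leq_trans lc).
Qed.

Record stage t f a ps ss : Prop := {
  stage_system : triangular_system form e (off t) f a ps ss;
  stage_mono : forall i j, (i <= j)%N -> (j < off t)%N -> (a i <= a j)%N;
  stage_jump : forall c, (c.+1 < off t)%N -> (a c < a c.+1)%N -> reduced_prefix f a c.+1 }.

Lemma stage0 : stage 0 (fun=> 0) (fun=> 0%N) [::] [::].
Proof. by split; rewrite ?take0 //; split. Qed.

Lemma stage_perm t f a ps ss ss' : perm_eq ss ss' -> stage t f a ps ss -> stage t f a ps ss'.
Proof.
move=> pp [[pk red tri] mono jump]; split=> //; split=> //; last exact: reduced_perm pp red.
by apply: perm_trans pk; rewrite perm_cat2r perm_sym.
Qed.

Lemma system_single_invariants t f a ps ss : triangular_system form e (off t) f a ps ss ->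
  single_invariants (Bpre bl t) a ss.
Proof.
move=> [pk red tri]; apply: reduced_single_invariants pk red _.
by rewrite Bpre_gram; apply: triangular_gram.
Qed.

Lemma stage_extend t t' f a ps ss f' a' ps' ss' c : stage t f a ps ss ->
  (t <= t' <= size bl)%N -> triangular_system form e (off t') f' a' ps' ss' ->
  (forall l, (l < off t)%N -> f' l = f l) -> (forall l, (l < off t)%N -> a' l = a l) ->
  (forall l, (off t <= l < off t')%N -> a' l = c) -> (forall l, (l < off t)%N -> (a l <= c)%N) ->
  stage t' f' a' ps' ss'.
Proof.
move=> [sys mono jump] /andP[tt tsz] sys' ff aa ac al; have ot := off_leq bl tt; split=> //.
  move=> i j ij jt'; have [jt|jt] := ltnP j (off t).
    by rewrite !aa ?(leq_ltn_trans ij) //; apply: mono.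
  rewrite (ac j) ?jt //; have [it|it] := ltnP i (off t); first by rewrite aa // al.
  by rewrite ac // it (leq_ltn_trans ij).
move=> c0 ct' jump_c0; have [ct|ct] := ltnP c0.+1 (off t).
  apply: (reduced_prefix_agree (ltnW ct) ff aa); apply: jump => //.
  by move: jump_c0; rewrite !aa // ltnW.
move: ct; rewrite leq_eqVlt => /orP[/eqP ct|ct].
  apply: (reduced_prefix_agree _ ff aa); first by rewrite ct.
  exists t, ps, ss; rewrite -ct; split=> //; first exact: leq_trans tt tsz.
    exact: system_support sys.
  exact: system_reduced sys.
have a'c0 : a' c0 = c by apply: ac; rewrite -ltnS ct (ltnW ct').
have a'c1 : a' c0.+1 = c by apply: ac; rewrite (ltnW ct) ct'.
by move: jump_c0; rewrite a'c0 a'c1 ltnn.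
Qed.

Lemma stage_extend1 t f a ps ss x c ps' ss' : stage t f a ps ss -> (t < size bl)%N ->
  off t.+1 = (off t).+1 -> (forall l, (l < off t)%N -> (a l <= c)%N) ->
  triangular_system form e (off t).+1 (update f (off t) x) (update a (off t) c) ps' ss' ->
  stage t.+1 (update f (off t) x) (update a (off t) c) ps' ss'.
Proof.
move=> hS ht kS al sys; apply: (stage_extend hS (c := c)) => //; first by rewrite leqnSn.
- by rewrite kS.
- by move=> l lk; rewrite update_neq // ltn_eqF.
- by move=> l lk; rewrite update_neq // ltn_eqF.
by rewrite kS => l; rewrite ltnS -eqn_leq => /eqP <-; rewrite update_eq.
Qed.

Lemma stage_extend2 t t' f a ps ss x x' c ps' ss' : stage t f a ps ss -> (t < t' <= size bl)%N ->
  off t' = (off t).+2 -> (forall l, (l < off t)%N -> (a l <= c)%N) ->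
  triangular_system form e (off t).+2 (update2 f (off t) (off t).+1 x x')
    (update2 a (off t) (off t).+1 c c) ps' ss' ->
  stage t' (update2 f (off t) (off t).+1 x x') (update2 a (off t) (off t).+1 c c) ps' ss'.
Proof.
move=> hS /andP[tt tsz] kS al sys; apply: (stage_extend hS (c := c)) => //.
- by rewrite ltnW.
- by rewrite kS.
- by move=> l lk; rewrite update2_out // !ltn_eqF // leqW.
- by move=> l lk; rewrite update2_out // !ltn_eqF // leqW.
rewrite kS => l; case: (ltngtP l (off t)) => //= [lk lk'|-> _].
  by have -> : l = (off t).+1 by [lia]; rewrite update2_snd.
by rewrite update2_fst // neq_ltn ltnSn.
Qed.

End Stages.

Section PreOptimal.

Variable bl : seq (nat * blk F).
Hypotheses (blocks_ok : all (fun p => blk_ok v p.2) bl) (preopt : pre_optimal v bl).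
Notation off t := (degs (take t bl)).
Notation n := (degs bl).
Notation e := (basis_cv n).
Notation form := (block_form bl).
Local Notation "''[' x , y ]" := (form x y) : ring_scope.
Local Notation "''[' x ]" := (form x x) : ring_scope.
Implicit Types (t k K : nat) (f : nat -> 'cV[F]_n) (a : nat -> nat).
Implicit Types (ps : seq (nat * nat)) (ss : seq nat).

Lemma blk_okP t : (t < size bl)%N -> blk_ok v (Cb bl t.+1).
Proof. by move=> ht; have /(all_nthP (0%N, BD [::]))/(_ t ht) := blocks_ok. Qed.

Lemma deg_gt0 t : (t < size bl)%N -> (0 < deg (Cb bl t.+1))%N.
Proof. by move=> /blk_okP; case: (Cb bl t.+1) => //= s /andP[]. Qed.

Lemma sum_diag_deg_le2 js K : uniq js ->
  {in js, forall j, [/\ (1 <= j <= size bl)%N, kb bl j = K & isD (Cb bl j)]} ->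
  (\sum_(j <- js) deg (Cb bl j) <= 2)%N.
Proof.
move=> u h; have [po1 _] := preopt; apply: leq_trans (po1 K).
rewrite -[leqRHS]big_filter; set s := filter _ _.
have sub : {subset js <= s}.
  by move=> j /h[hj kE jD]; rewrite mem_filter kE eqxx jD mem_index_iota ltnS.
have pp : perm_eq s (js ++ filter (fun j => j \notin js) s).
  apply: uniq_perm; first by rewrite filter_uniq // iota_uniq.
    rewrite cat_uniq u !filter_uniq ?iota_uniq // andbT /=; apply/hasPn => j.
    by rewrite mem_filter => /andP[].
  by move=> j; rewrite mem_cat mem_filter; case: (boolP (j \in js)) => [/sub->|].
by rewrite (perm_big _ pp) big_cat leq_addr.
Qed.

Lemma diag_block_norm t x : (t < size bl)%N -> isD (Cb bl t.+1) -> (x < deg (Cb bl t.+1))%N ->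
  veq2 '[e (off t + x)] (2 * (kb bl t.+1)%:Z).
Proof.
move=> ht hD hx; have hn : (off t + x < n)%N.
  by apply: leq_trans (off_leq_degs bl t.+1); rewrite offS // ltn_add2l.
rewrite block_form_basis // ent_blk //; have := blk_okP ht.
case: (Cb bl t.+1) hD hx => //= s _ hx /andP[_ /allP hu]; rewrite eqxx.
have := hu _ (mem_nth 0 hx); rewrite unit_veq2 => hu'.
by apply: (veq2_congr (veq2M (veq2_2X _) hu')); rewrite ?addr0.
Qed.

Lemma diag_block_orth t : (t < size bl)%N -> isD (Cb bl t.+1) -> deg (Cb bl t.+1) = 2%N ->
  '[e (off t), e (off t).+1] = 0.
Proof.
move=> ht hD d2; have hn : ((off t).+1 < n)%N.
  by apply: leq_trans (off_leq_degs bl t.+1); rewrite offS // d2 addn2.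
have := @ent_blk bl t 0 1 ht; rewrite d2 addn0 addn1 => /(_ isT isT).
rewrite block_form_basis ?(ltnW hn) // => ->.
by case: (Cb bl t.+1) hD => //= s _; rewrite mulr0.
Qed.

Lemma plane_block t : (t < size bl)%N -> ~~ isD (Cb bl t.+1) ->
  [/\ off t.+1 = (off t).+2, vge2 '[e (off t)] (2 * (kb bl t.+1)%:Z),
      vge2 '[e (off t).+1] (2 * (kb bl t.+1)%:Z) &
      veq2 (2 * '[e (off t), e (off t).+1]) ((kb bl t.+1)%:Z + (kb bl t.+1)%:Z)].
Proof.
move=> ht hE; have d2 : deg (Cb bl t.+1) = 2%N by case: (Cb bl t.+1) hE.
have kS := offS ht; rewrite d2 addn2 in kS.
have hn1 : ((off t).+1 < n)%N by rewrite -kS off_leq_degs.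
have entry x y : (x < 2)%N -> (y < 2)%N -> '[e (off t + x), e (off t + y)] =
    2 ^+ (kb bl t.+1) * blk_entry (Cb bl t.+1) x y.
  by move=> hx hy; rewrite block_form_basis ?ent_blk ?d2 //; lia.
have := entry 0%N 0%N isT isT; have := entry 1%N 1%N isT isT; have := entry 0%N 1%N isT isT.
rewrite addn0 addn1 => -> -> ->; split=> //; move: hE (blk_okP ht) {d2 entry};
  case: (Cb bl t.+1) => //= x y z _;
  rewrite !vge_vge2 integral_vge2 unit_veq2 => /and4P[hx hz hy hu];
  rewrite mulr1 in hx hz.
- by rewrite -[2 * (kb _ _)%:Z]addr0; apply: vge2M; [apply/veq2W/veq2_2X | apply: vge2_half hx _].
- by rewrite -[2 * (kb _ _)%:Z]addr0; apply: vge2M; [apply/veq2W/veq2_2X | apply: vge2_half hz _].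
have unit_2y : veq2 (2 * y) 0.
  rewrite -veq2_sqr (_ : (2 * y) ^+ 2 = - (2 * x * (2 * z) - (2 * y) ^+ 2) + (2 * x) * (2 * z)).
    by rewrite mulr0; apply: veq2D; rewrite ?veq2N //; apply: (vge2M_le hx hz).
  by ring.
by apply: (veq2_congr (veq2M (veq2_2X (kb bl t.+1)) unit_2y)); [ring | lia].
Qed.

Definition next_diag t K : Prop := [/\ (t < size bl)%N, isD (Cb bl t.+1) & kb bl t.+1 = K].

(* How far the exponents may exceed the scale of the last block; (PO1)-(PO6) exclude the blocks
   that would then break the monotonicity of [a]. *)
Definition near_scale t a ss : Prop :=
  (0 < t)%N ->
  if isD (Cb bl t) then
    [\/ (forall l, (l < off t)%N -> (a l <= kb bl t)%N),
        (forall l, (l < off t)%N -> (a l <= (kb bl t).+1)%N) /\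
        (next_diag t (kb bl t) -> exists2 s, ss = [:: s] & ~~ odd (a s + kb bl t)) |
        [/\ (forall l, (l < off t)%N -> (a l <= (kb bl t).+2)%N), ~ next_diag t (kb bl t) &
         ss = [::] \/
         exists s, [/\ ss = [:: s], odd (a s + kb bl t), xi v (Bpre bl t.-1) = 0 & (2 <= t)%N]]]
  else forall l, (l < off t)%N -> (a l <= kb bl t)%N.

Lemma adjacent_scales t : (0 < t)%N -> (t < size bl)%N ->
  [/\ isD (Cb bl t) -> isD (Cb bl t.+1) -> (kb bl t <= kb bl t.+1)%N,
      ~~ isD (Cb bl t) -> ~~ isD (Cb bl t.+1) -> (kb bl t <= kb bl t.+1)%N,
      isD (Cb bl t) -> ~~ isD (Cb bl t.+1) -> (kb bl t + 1 <= kb bl t.+1)%N &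
      ~~ isD (Cb bl t) -> isD (Cb bl t.+1) -> (kb bl t <= kb bl t.+1 + 1)%N].
Proof. by move=> t0 ht; have [_ [_ [po2 _]]] := preopt; apply: po2. Qed.

Section Bounds.

Variables (t : nat) (f : nat -> 'cV[F]_n) (a : nat -> nat) (ps : seq (nat * nat)) (ss : seq nat).
Hypotheses (hS : stage t f a ps ss) (near : near_scale t a ss) (ht : (t < size bl)%N).
Notation k := (off t).
Notation K := (kb bl t.+1).

Lemma prefix_gt0 l : (l < k)%N -> (0 < t)%N.
Proof. by case: t => //; rewrite take0. Qed.

Lemma exponents_le_succ : isD (Cb bl t.+1) -> forall l, (l < k)%N -> (a l <= K.+1)%N.
Proof.
move=> hD l lk; have t0 := prefix_gt0 lk; have [DD _ _ ED] := adjacent_scales t0 ht.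
have := near t0; case: ifP => [hDt|/negbT hDt]; last first.
  by move/(_ l lk)/leq_trans; apply; rewrite -addn1; apply: ED.
have kK := DD hDt hD.
case=> [/(_ l lk)/leq_trans|[/(_ l lk)/leq_trans + _]|[/(_ l lk)/leq_trans + nx _]].
- by apply; apply: leqW.
- by apply; rewrite ltnS.
by apply; rewrite ltnS ltn_neqAle kK andbT; apply/eqP => kE; apply: nx.
Qed.

Lemma exponents_le_plane : ~~ isD (Cb bl t.+1) -> forall l, (l < k)%N -> (a l <= K)%N.
Proof.
move=> hE l lk; have t0 := prefix_gt0 lk; have [_ EE DE _] := adjacent_scales t0 ht.
have := near t0; case: ifP => [hDt|/negbT hDt]; last by move/(_ l lk)/leq_trans; apply; apply: EE.
have kK := DE hDt hE; rewrite addn1 in kK.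
case=> [/(_ l lk)/leq_trans|[/(_ l lk)/leq_trans + _]|[/(_ l lk)/leq_trans + nx hss]].
- by apply; apply: ltnW.
- by apply.
apply; rewrite ltn_neqAle kK andbT; apply/eqP => kE.
have [_ [_ [_ [_ [_ [po5 _]]]]]] := preopt.
have [|_] := po5 t t0 ht hDt hE _; first by rewrite addn1.
have := system_single_invariants (stage_system hS); case: hss => [->|[s [-> _ x0 t2]]].
  by case=> ko _ vo [[_]|[/(negP ko)//]]; rewrite /ord_det_odd (negPf vo).
by case=> ko _ _ [[/negP[]]|[_ /(_ t2)/eqP]].
Qed.

Definition no_even_single : Prop := ss = [::] \/ exists2 s, ss = [:: s] & odd (a s + K).

Lemma exponents_le_diag_after_diag : isD (Cb bl t) -> isD (Cb bl t.+1) -> no_even_single ->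
  forall l, (l < k)%N -> (a l <= K)%N.
Proof.
move=> hDt hD hss l lk; have t0 := prefix_gt0 lk; have [DD _ _ _] := adjacent_scales t0 ht.
have [_ [_ [_ [_ [_ [_ po6]]]]]] := preopt; have kK := DD hDt hD.
have := near t0; rewrite hDt.
case=> [/(_ l lk)/leq_trans|[/(_ l lk)/leq_trans + nx]|[/(_ l lk)/leq_trans + nx hC]].
- by apply.
- apply; rewrite ltn_neqAle kK andbT; apply/eqP => kE.
  have [//|s sE par] := nx; case: hss => [s0|[s' sE' par']]; first by rewrite s0 in sE.
  by move: par par'; rewrite sE in sE'; case: sE' => <-; rewrite kE => /negPf ->.
have lt_kK : (kb bl t < K)%N by rewrite ltn_neqAle kK andbT; apply/eqP => kE; apply: nx; split.
apply; rewrite ltn_neqAle lt_kK andbT; apply/eqP => kE.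
case: hC => [s0|[s [sE par _ _]]].
  have := system_single_invariants (stage_system hS); rewrite s0 => -[ko x0 _].
  by have := po6 t t0 ht ko hDt hD _; rewrite -kE addn1 => /(_ erefl) xE; rewrite xE eqxx in x0.
case: hss => [s0|[s' sE' par']]; first by rewrite s0 in sE.
by move: par'; rewrite sE in sE'; case: sE' => <-; rewrite -kE addnS /= par.
Qed.

Lemma val_det_next : isD (Cb bl t.+1) -> deg (Cb bl t.+1) = 1%N -> \det (Bpre bl t) != 0 ->
  v (\det (Bpre bl t.+1)) = K%:Z + v (\det (Bpre bl t)).
Proof.
move=> hD d1; have kS : off t.+1 = k.+1 by rewrite offS // d1 addn1.
have /veq2P[n0 vk] : veq2 '[e k] (2 * K%:Z).
  by have := diag_block_norm ht hD (_ : (0 < _)%N); rewrite d1 addn0 => /(_ isT).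
rewrite !Bpre_gram kS det_gram_last => [|l lk]; last exact: (block_form_off (t := t)).
by move=> d0; rewrite valM //; congr (_ + _); lia.
Qed.

Lemma exponents_le_diag_after_plane : ~~ isD (Cb bl t) -> isD (Cb bl t.+1) ->
  deg (Cb bl t.+1) = 1%N -> no_even_single -> forall l, (l < k)%N -> (a l <= K)%N.
Proof.
move=> hDt hD d1 hss l lk; have t0 := prefix_gt0 lk; have [_ _ _ ED] := adjacent_scales t0 ht.
have [_ [_ [_ [_ [po4 _]]]]] := preopt; have kK := ED hDt hD; rewrite addn1 in kK.
have := near t0; rewrite (negPf hDt) => /(_ l lk)/leq_trans; apply; rewrite leqNgt.
apply/negP => lt_Kk; have kE : (K + 1 = kb bl t)%N by apply/eqP; rewrite eqn_leq addn1 lt_Kk kK.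
have [] := po4 t.+1 _ kE hD hDt; first by rewrite !ltnS t0.
  by rewrite d1.
have oS : odd (off t.+1) = ~~ odd k by rewrite offS // d1 addn1.
move=> [_]; rewrite oS /ord_det_odd /=; have := system_single_invariants (stage_system hS).
case: hss => [->|[s -> par]] [].
  by move=> ko x0 _ [[/negPn]|[_ xz]]; [rewrite (negPf ko) | rewrite xz eqxx in x0].
move=> ko d0 vo [[_]|[]]; last by rewrite ko.
rewrite val_det_next //; move: vo par; move: (v _) (a s) (kb bl _) => x y z; goal_lia.
Qed.

Lemma exponents_le_diag : isD (Cb bl t.+1) -> deg (Cb bl t.+1) = 1%N -> no_even_single ->
  forall l, (l < k)%N -> (a l <= K)%N.
Proof.
move=> hD d1 hss; have [hDt|hDt] := boolP (isD (Cb bl t)).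
  exact: exponents_le_diag_after_diag.
exact: exponents_le_diag_after_plane.
Qed.

End Bounds.

Definition progress t : Prop := exists t' f a ps ss,
  [/\ (t < t' <= size bl)%N, stage t' f a ps ss & near_scale t' a ss].

Section Step.

Variables (t : nat) (f : nat -> 'cV[F]_n) (a : nat -> nat) (ps : seq (nat * nat)) (ss : seq nat).
Hypotheses (hS : stage t f a ps ss) (ht : (t < size bl)%N).
Notation k := (off t).
Notation K := (kb bl t.+1).

Let sys := stage_system hS.

Lemma step_plane : near_scale t a ss -> ~~ isD (Cb bl t.+1) -> progress t.
Proof.
move=> near hE; have [kS norm0 norm1 cross] := plane_block ht hE.
have aK := exponents_le_plane hS near ht hE.
have [||x [x' sys']] := extend_plane sys _ _ norm0 norm1 cross.
- by move=> l lk; apply: (block_form_off lk).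
- by move=> l lk; apply: (block_form_off lk).
have ext : (t < t.+1 <= size bl)%N by rewrite ltnSn ht.
have hS' := stage_extend2 hS ext kS aK sys'.
do 5![eexists]; split; [exact: ext | exact: hS' |].
move=> _; rewrite (negPf hE) kS; apply: update_leq => //; exact: update_leq.
Qed.

Hypotheses (hD : isD (Cb bl t.+1)) (aK : forall l, (l < k)%N -> (a l <= K.+1)%N).

Lemma new_basis_vector t' : (k <= off t')%N -> (t' < size bl)%N -> isD (Cb bl t'.+1) ->
  new_vector form e k (kb bl t'.+1) (e (off t')).
Proof.
move=> kt ht' hD'; split=> [l lk|]; first exact: (block_form_off lk).
by have := diag_block_norm ht' hD' (deg_gt0 ht'); rewrite addn0.
Qed.

Lemma new_k : new_vector form e k K (e k). Proof. exact: new_basis_vector. Qed.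

Lemma progress1 x c ps' ss' : off t.+1 = k.+1 -> (forall l, (l < k)%N -> (a l <= c)%N) ->
  triangular_system form e k.+1 (update f k x) (update a k c) ps' ss' ->
  near_scale t.+1 (update a k c) ss' -> progress t.
Proof.
move=> kS ac sys' near'; do 5![eexists]; split; last exact: near'.
  by rewrite ltnSn ht.
exact: stage_extend1 hS ht kS ac sys'.
Qed.

Lemma progress2 t' x x' ps' ss' : (t < t' <= size bl)%N -> off t' = k.+2 -> isD (Cb bl t') ->
  kb bl t' = K -> ~ next_diag t' K ->
  triangular_system form e k.+2 (update2 f k k.+1 x x') (update2 a k k.+1 K.+1 K.+1) ps' ss' ->
  progress t.
Proof.
move=> ext kS hD' kE nx sys'; have hS' := stage_extend2 hS ext kS aK sys'.
do 5![eexists]; split; [exact: ext | exact: hS' |].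
move=> _; rewrite hD' kS kE; apply: Or32; split=> //.
by apply: update_leq => //; apply: update_leq.
Qed.

Lemma even_single i j : ss = [:: i; j] ->
  exists i' j', perm_eq ss [:: i'; j'] /\ ~~ odd (K + a i').
Proof.
move=> ssE; have red := system_reduced sys.
have ij : i != j by apply: (@two_singles_neq ps); rewrite -ssE (reduced_uniq red).
have par : odd (a i + a j) by apply: (reduced_parity red); rewrite // ssE !inE eqxx ?orbT.
have [oi|oi] := boolP (odd (K + a i)); last by exists i, j; rewrite ssE.
exists j, i; rewrite ssE; split; first by apply/permPl; apply: (perm_catC [:: i] [:: j]).
by move: par oi; move: (a i) (a j) (kb _ _) => x y z; goal_lia.
Qed.

Section DegreeOne.

Hypothesis d1 : deg (Cb bl t.+1) = 1%N.

Lemma off_next : off t.+1 = k.+1. Proof. by rewrite offS // d1 addn1. Qed.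

Lemma step_single : near_scale t a ss -> no_even_single t a ss -> progress t.
Proof.
move=> near hss; have aK0 := exponents_le_diag hS near ht hD d1 hss.
have [|x sys'] := extend_single sys new_k.
  by case: hss => [->|[s -> hs]] // l; rewrite inE => /eqP ->.
apply: (progress1 off_next aK0 sys') => _; rewrite hD off_next; apply: Or31 => l.
exact: update_leq.
Qed.

Lemma next_diag_merge : next_diag t.+1 K ->
  [/\ (t.+1 < size bl)%N, off t.+2 = k.+2, isD (Cb bl t.+2), kb bl t.+2 = K & ~ next_diag t.+2 K].
Proof.
move=> [ht1 hD1 kE1]; have pos1 := deg_gt0 ht1.
have d2 : deg (Cb bl t.+2) = 1%N.
  have := @sum_diag_deg_le2 [:: t.+1; t.+2] K; rewrite !big_cons big_nil d1 => le2.
  suff : (1 + (deg (Cb bl t.+2) + 0) <= 2)%N by lia.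
  apply: le2 => [|j]; first by rewrite /= inE neq_ltn ltnSn.
  by rewrite !inE => /orP[] /eqP->; split=> //; lia.
split=> //; first by rewrite offS // d2 off_next addn1.
move=> [ht2 hD2 kE2]; have pos2 := deg_gt0 ht2.
have := @sum_diag_deg_le2 [:: t.+1; t.+2; t.+3] K; rewrite !big_cons big_nil d1 d2 => le2.
suff : (1 + (1 + (deg (Cb bl t.+3) + 0)) <= 2)%N by lia.
apply: le2 => [|j]; first by rewrite /= !inE; lia.
by rewrite !inE => /or3P[] /eqP->; split=> //; lia.
Qed.

Lemma step_merge r i : single_reps form f a ps ss r -> i \in ss -> ~~ odd (K + a i) ->
  {in ss, forall j, j != i -> vge2 (2 * '[r i, r j]) ((a i)%:Z + (a j)%:Z + 3)} ->
  next_diag t.+1 K -> progress t.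
Proof.
move=> reps iss par rij nx; have [ht1 kS hD1 kE1 nx1] := next_diag_merge nx.
have new_k1 : new_vector form e k K (e k.+1).
  have -> : k.+1 = off t.+1 by rewrite off_next.
  by rewrite -kE1; apply: new_basis_vector => //; apply: off_leq.
have kk : '[e k, e k.+1] = 0 by apply: (block_form_off (t := t.+1)); rewrite off_next.
have [x [x' sys']] := extend_corrected_plane sys aK reps iss par rij new_k new_k1 kk.
by apply: (progress2 _ kS hD1 kE1 nx1 sys'); rewrite ltnW.
Qed.

Lemma step_odd s : ss = [:: s] -> ~~ odd (K + a s) -> progress t.
Proof.
move=> ssE par; have [r reps] := single_reps_exist (system_reduced sys).
have [nx|nx] := EM (next_diag t.+1 K).
  apply: (step_merge reps _ par _ nx); first by rewrite ssE mem_head.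
  by move=> j; rewrite ssE inE => /eqP->; rewrite eqxx.
have [x [] sys'] := extend_odd sys aK reps ssE par new_k.
  have aK2 l : (l < k)%N -> (a l <= K.+2)%N by move=> /aK/leqW.
  apply: (progress1 off_next aK2 sys') => _; rewrite hD off_next; apply: Or33.
  by split=> //; [apply: update_leq | left].
apply: (progress1 off_next aK sys') => _; rewrite hD off_next; apply: Or32; split=> //.
exact: update_leq.
Qed.

Lemma step_even i j : ss = [:: i; j] -> ~~ odd (K + a i) -> progress t.
Proof.
move=> ssE par; have [r reps] := single_reps_exist (system_reduced sys).
have iss : i \in ss by rewrite ssE mem_head.
have jss : j \in ss by rewrite ssE !inE eqxx orbT.
have ltk l : l \in ss -> (l < k)%N.
  by move=> lss; rewrite -(mem_support_iota _ (system_support sys)) single_support.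
have [small|large] := boolP (vge2 (2 * '[r i, r j]) ((a i)%:Z + (a j)%:Z + 3)); last first.
  have [x sys'] := extend_even_plane sys aK reps ssE par new_k large.
  apply: (progress1 off_next aK sys') => _; rewrite hD off_next; apply: Or32; split.
    exact: update_leq.
  by move=> _; exists i; rewrite // update_neq ?ltn_eqF ?ltk // addnC.
have [nx|nx] := EM (next_diag t.+1 K).
  apply: (step_merge reps iss par _ nx) => l.
  by rewrite ssE !inE => /orP[] /eqP->; rewrite ?eqxx.
have aK2 l : (l < k)%N -> (a l <= K.+2)%N by move=> /aK/leqW.
have [x sys'] := extend_even_partner sys aK reps ssE par new_k small.
apply: (progress1 off_next aK2 sys') => _; rewrite hD off_next; apply: Or33; split=> //.
  exact: update_leq.
right; exists j; split=> //.
- rewrite update_neq ?ltn_eqF ?ltk //; have red := system_reduced sys.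
  have ij : i != j by apply: (@two_singles_neq ps); rewrite -ssE (reduced_uniq red).
  by have := reduced_parity red iss jss ij; move: par; move: (a i) (a j) => p q; goal_lia.
- by have := system_single_invariants sys; rewrite ssE => -[].
by rewrite ltnS; apply: prefix_gt0 (ltk i iss).
Qed.

End DegreeOne.

Section DegreeTwo.

Hypothesis d2 : deg (Cb bl t.+1) = 2%N.

Let kS : off t.+1 = k.+2. Proof. by rewrite offS // d2 addn2. Qed.

Lemma diag2_no_next : ~ next_diag t.+1 K.
Proof.
move=> [ht1 hD1 kE1]; have pos1 := deg_gt0 ht1.
have := @sum_diag_deg_le2 [:: t.+1; t.+2] K; rewrite !big_cons big_nil d2 => le2.
suff : (2 + (deg (Cb bl t.+2) + 0) <= 2)%N by lia.
apply: le2 => [|j]; first by rewrite /= inE neq_ltn ltnSn.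
by rewrite !inE => /orP[] /eqP->; split=> //; lia.
Qed.

Lemma diag2_new_vector : new_vector form e k K (e k.+1).
Proof.
split=> [l lk|]; first by apply: (block_form_off lk).
by have := @diag_block_norm t 1 ht hD; rewrite d2 addn1; apply.
Qed.

Lemma step2_merge r i : single_reps form f a ps ss r -> i \in ss -> ~~ odd (K + a i) ->
  {in ss, forall j, j != i -> vge2 (2 * '[r i, r j]) ((a i)%:Z + (a j)%:Z + 3)} -> progress t.
Proof.
move=> reps iss par rij; have kk := diag_block_orth ht hD d2.
have [x [x' sys']] := extend_corrected_plane sys aK reps iss par rij new_k diag2_new_vector kk.
by apply: (progress2 _ kS hD erefl diag2_no_next sys'); rewrite ltnSn.
Qed.

Lemma step2_odd s : ss = [:: s] -> ~~ odd (K + a s) -> progress t.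
Proof.
move=> ssE par; have [r reps] := single_reps_exist (system_reduced sys).
apply: (step2_merge reps _ par); first by rewrite ssE mem_head.
by move=> j; rewrite ssE inE => /eqP->; rewrite eqxx.
Qed.

Lemma step2_even i j : ss = [:: i; j] -> ~~ odd (K + a i) -> xi v (Bpre bl t.+1) = 0 -> progress t.
Proof.
move=> ssE par xi0; have [r reps] := single_reps_exist (system_reduced sys).
have iss : i \in ss by rewrite ssE mem_head.
have [small|large] := boolP (vge2 (2 * '[r i, r j]) ((a i)%:Z + (a j)%:Z + 3)).
  apply: (step2_merge reps iss par) => l.
  by rewrite ssE !inE => /orP[] /eqP->; rewrite ?eqxx.
have [x sys1] := extend_even_plane sys aK reps ssE par new_k large.
have ik : i != k.
  by rewrite ltn_eqF // -(mem_support_iota _ (system_support sys)) single_support.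
have new_k1 : new_vector form e k.+1 K (e k.+1).
  have [eo eK] := diag2_new_vector; split=> // l.
  by rewrite ltnS leq_eqVlt => /orP[/eqP->|/eo//]; apply: diag_block_orth.
have par1 : ~~ odd (K + update a k K.+1 i) by rewrite update_neq.
have [r1 reps1] := single_reps_exist (system_reduced sys1).
have aK1 := update_leq aK (leqnn K.+1).
have [x' [] sys2] := extend_odd sys1 aK1 reps1 erefl par1 new_k1.
  by rewrite -kS in sys2; have [_ /eqP] := system_single_invariants sys2; rewrite xi0.
have ext : (t < t.+1 <= size bl)%N by rewrite ltnSn ht.
have hS' := stage_extend2 hS ext kS aK sys2; do 5![eexists]; split; [exact: ext | exact: hS' |].
move=> _; rewrite hD kS; apply: Or32; split=> [|/diag2_no_next//].
exact: update_leq aK1 (leqnn _).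
Qed.

End DegreeTwo.

End Step.

Lemma step_diag1 t f a ps ss : stage t f a ps ss -> near_scale t a ss -> (t < size bl)%N ->
  isD (Cb bl t.+1) -> deg (Cb bl t.+1) = 1%N -> progress t.
Proof.
move=> hS near ht hD d1; have aK := exponents_le_succ near ht hD.
case: ss hS near (system_single_invariants (stage_system hS)) => [|s [|s' [|//]]] hS near _.
- by apply: (step_single hS ht hD d1 near); left.
- have [par|par] := boolP (odd (a s + kb bl t.+1)).
    by apply: (step_single hS ht hD d1 near); right; exists s.
  by apply: (step_odd hS ht hD aK d1 erefl); rewrite addnC.
have [i [j [pp par]]] := even_single hS erefl.
exact: (step_even (stage_perm pp hS) ht hD aK d1 erefl par).
Qed.

Lemma step_diag2 t f a ps ss : stage t f a ps ss -> near_scale t a ss -> (t < size bl)%N ->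
  isD (Cb bl t.+1) -> deg (Cb bl t.+1) = 2%N -> progress t.
Proof.
move=> hS near ht hD d2; have aK := exponents_le_succ near ht hD.
have [_ [_ [_ [po3 _]]]] := preopt; have [|_] := po3 t.+1 _ hD d2; first by rewrite ltnS ht.
have -> : odd (off t.+1) = odd (off t) by rewrite offS // d2 addn2 /= negbK.
rewrite /= => po3t.
case: ss hS near (system_single_invariants (stage_system hS)) => [|s [|s' [|//]]] hS near inv.
- case: inv => ko x0 _; case: po3t => [[_ [xz _]]|[ok _]]; first by rewrite xz eqxx in x0.
  by rewrite ok in ko.
- case: inv => ko _ vo; case: po3t => [[]|[_ od]]; first by rewrite ko.
  by apply: (step2_odd hS ht hD aK d2 erefl); move: od; rewrite !oddD vo addbC.
have xi0 : xi v (Bpre bl t.+1) = 0.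
  by case: inv => ko _; case: po3t => [[_ []]|[ok _]] //; rewrite ok in ko.
have [i [j [pp par]]] := even_single hS erefl.
exact: (step2_even (stage_perm pp hS) ht hD aK d2 erefl par xi0).
Qed.

Lemma stage_progress t f a ps ss : stage t f a ps ss -> near_scale t a ss -> (t < size bl)%N ->
  progress t.
Proof.
move=> hS near ht; have [hD|] := boolP (isD (Cb bl t.+1)); last exact: (step_plane hS ht near).
have : (deg (Cb bl t.+1) <= 2)%N.
  have := @sum_diag_deg_le2 [:: t.+1] (kb bl t.+1); rewrite big_cons big_nil addn0; apply=> //.
  by move=> j; rewrite inE => /eqP->; split=> //; rewrite ltnS ht.
move: (deg_gt0 ht); case dE: (deg _) => [|[|[|]]] // _ _.
  exact: step_diag1 hS near ht hD dE.
exact: step_diag2 hS near ht hD dE.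
Qed.

Lemma stage_total : exists f a ps ss, stage (size bl) f a ps ss.
Proof.
suff main d t f a ps ss : (size bl - t <= d)%N -> (t <= size bl)%N -> stage t f a ps ss ->
    near_scale t a ss -> exists f a ps ss, stage (size bl) f a ps ss.
  by apply: (main (size bl) 0%N) (stage0 bl) _; rewrite ?subn0.
elim: d t f a ps ss => [|d IH] t f a ps ss hd; rewrite leq_eqVlt => /orP[/eqP tE|ht] hS near.
- by rewrite -tE; exists f, a, ps, ss.
- by move: hd; rewrite leqNgt subn_gt0 ht.
- by rewrite -tE; exists f, a, ps, ss.
have [t' [f' [a' [ps' [ss' [/andP[tt' t's] hS' near']]]]]] := stage_progress hS near ht.
by apply: (IH t') hS' near' => //; lia.
Qed.

End PreOptimal.

(** * Optimal bases *)

Section Columns.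

Variable n : nat.
Notation e := (basis_cv n).
Implicit Type f : nat -> 'cV[F]_n.

Definition columns f : 'M[F]_n := \matrix_(i, j) f j i 0.

Lemma col_columns f (j : 'I_n) : col j (columns f) = f j.
Proof. by apply/colP => i; rewrite !mxE. Qed.

Lemma integral_span_entry l x : integral_span e l x -> forall i : 'I_n,
  ((l <= i)%N -> x i 0 = 0) /\ vge2 (x i 0) 0.
Proof.
move=> hx i; elim: x / hx => [|x m c _ [IH1 IH2] mI hc]; first by rewrite mxE vge2_0.
rewrite !mxE; split.
  move=> li; rewrite IH1 // add0r (_ : (i == m :> nat) = false) ?mulr0 //.
  by move: mI; rewrite mem_iota /= => ml; rewrite gtn_eqF // (leq_trans ml).
by apply: vge2D => //; case: (_ == _); rewrite ?mulr1 ?mulr0 ?vge2_0.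
Qed.

Lemma columns_GLo f : (forall l, (l < n)%N -> integral_span e l (f l - e l)) -> GLo v (columns f).
Proof.
move=> tri; have entryE (i j : 'I_n) : columns f i j = (f j - e j) i 0 + (i == j)%:R.
  by rewrite !mxE subrK.
apply: GLoP => [i j|].
  rewrite entryE; apply: vge2D; first by have [] := integral_span_entry (tri j (ltn_ord j)) i.
  by case: (i == j); rewrite ?vge2_0 ?vge2_1.
rewrite -det_tr det_trig; last first.
  apply/is_trig_mxP => i j ij; rewrite mxE entryE -val_eqE gtn_eqF // addr0.
  by have [->] := integral_span_entry (tri i (ltn_ord i)) j; rewrite // ltnW.
rewrite big1 ?veq2_1 // => i _; rewrite mxE entryE eqxx.
by have [->] := integral_span_entry (tri i (ltn_ord i)) i; rewrite // add0r.
Qed.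

Definition nat_col (U : 'M[F]_n) i : 'cV[F]_n := if insub i is Some i' then col i' U else 0.

Lemma nat_colE U (i : 'I_n) : nat_col U i = col i U.
Proof. by rewrite /nat_col valK. Qed.

Lemma col_mulmx_nat_col (U Z : 'M[F]_n) (j : 'I_n) :
  col j (U *m Z) = \sum_(i <- iota 0 n) mxe Z i j *: nat_col U i.
Proof.
have -> : \sum_(i <- iota 0 n) mxe Z i j *: nat_col U i = \sum_(i < n) mxe Z i j *: nat_col U i.
  by rewrite -(big_mkord xpredT (fun i => mxe Z i j *: nat_col U i)) /index_iota subn0.
apply/colP => x; rewrite !mxE summxE; apply: eq_bigr => i _.
by rewrite !mxE nat_colE mxE mxeE mulrC.
Qed.

Variables (A : 'M[F]_n) (sA : A^T = A).

Lemma symmxform_nat_col U (i j : 'I_n) :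
  symmxform sA (nat_col U i) (nat_col U j) = (U^T *m A *m U) i j.
Proof. by rewrite !nat_colE -mxform_col. Qed.

Lemma gram_nat_col U c : (c <= n)%N ->
  gram (symmxform sA) (nat_col U) c = ulsub c (U^T *m A *m U).
Proof.
move=> cn; apply/matrixP => i j; have hi := leq_trans (ltn_ord i) cn.
have hj := leq_trans (ltn_ord j) cn.
rewrite [LHS]mxE [RHS]mxE (mxeE _ (Ordinal hi) (Ordinal hj)).
exact: (symmxform_nat_col U (Ordinal hi) (Ordinal hj)).
Qed.

Lemma inS_bounded U a : inS v (U^T *m A *m U) (mkseq a n) ->
  bounded (symmxform sA) (nat_col U) a (iota 0 n).
Proof.
move=> inM; have [_ _ norm _] := inM; split=> [i|i j]; rewrite !mem_iota /= => hi.
  by have := norm (Ordinal hi); rewrite nth_mkseq // vge_vge2 -symmxform_nat_col.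
move=> hj _; have := inS_entry (Ordinal hi) (Ordinal hj) (congr_sym U sA) inM.
by rewrite !nth_mkseq // -symmxform_nat_col.
Qed.

End Columns.

Section Transition.

Variables (V : lmodType F) (B : {symmetric V}).
Implicit Types (f u g : nat -> V) (a : nat -> nat) (z : nat -> nat -> F).

(* At a jump of [a] the vectors [u i] with [c <= i] only contribute terms of higher level to the
   [f j] with [j < c]. *)
Lemma zeta_jump f u z a n c ps ss (M M1 : 'M[F]_c) : (c <= n)%N -> bounded B u a (iota 0 n) ->
  (forall j, (j < c)%N -> f j = \sum_(i <- iota 0 n) z i j *: u i) ->
  (forall i j, (i < n)%N -> (j < c)%N -> vge2 (z i j) ((a j)%:Z - (a i)%:Z) /\ vge2 (z i j) 0) ->
  (forall i l, (i < c <= l)%N -> (l < n)%N -> (a i < a l)%N) ->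
  perm_eq (support ps ss) (iota 0 c) -> reduced B f a ps ss ->
  mxcongr M (gram B f c) -> mxcongr M1 (gram B u c) -> zeta v M = zeta v M1.
Proof.
move=> cn bnd fE zv jump pk red Mf M1u; pose g j := \sum_(i <- iota 0 c) z i j *: u i.
have jc j : j \in support ps ss -> (j < c)%N by rewrite (mem_support_iota _ pk).
have sub_fg j : (j < c)%N -> g j - f j = - \sum_(i <- iota c (n - c)) z i j *: u i.
  move=> hj; rewrite fE // /g -[in iota 0 n](subnKC cn) iotaD add0n big_cat /=.
  by rewrite opprD addrA subrr sub0r.
have fg : gram_congr B f g a (support ps ss).
  apply: (level_gram_congr bnd) => j /jc hj.
    rewrite fE // big_seq; apply: lincomb_sum => i iI; apply: level1 => //.
    by move: iI; rewrite mem_iota => iI; have [] := zv i j iI hj.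
  rewrite sub_fg //; apply: levelN; rewrite big_seq; apply: lincomb_sum => i.
  rewrite mem_iota subnKC // => /andP[ci hi]; apply: level1; first by rewrite mem_iota.
  have [_ z0] := zv i j hi hj; apply: vge2_le z0 _.
  by have := jump j i; rewrite hj ci hi => /(_ isT isT); move: (a i) (a j) => p q; goal_lia.
apply: (zeta_gram_congr pk red fg Mf); apply: mxcongr_trans M1u (gram_lspan _ _) => l lc.
by rewrite /g big_seq; apply: lincomb_sum => i iI; apply: lincomb1.
Qed.

End Transition.

Section OptimalForm.

Variables (bl : seq (nat * blk F)) (f : nat -> 'cV[F]_(degs bl)) (a : nat -> nat).
Variables (ps : seq (nat * nat)) (ss : seq nat).
Hypothesis hS : stage (size bl) f a ps ss.
Notation n := (degs bl).
Notation A := (assemble bl).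
Notation form := (block_form bl).
Local Notation "''[' x , y ]" := (form x y) : ring_scope.

Let off_size : degs (take (size bl) bl) = n. Proof. by rewrite take_size. Qed.
Let mono i j : (i <= j)%N -> (j < n)%N -> (a i <= a j)%N.
Proof. by move=> ij jn; apply: (stage_mono hS ij); rewrite off_size. Qed.

Definition optimal_form : 'M[F]_n := (columns f)^T *m A *m columns f.

Lemma optimal_form_entry (i j : 'I_n) : optimal_form i j = '[f i, f j].
Proof. by rewrite -mxform_col !col_columns. Qed.

Lemma optimal_form_sym : optimal_form^T = optimal_form.
Proof. exact: congr_sym (assemble_sym bl). Qed.

Lemma columns_stage_GLo : GLo v (columns f).
Proof.
apply: columns_GLo => l ln; apply: (system_triangular (stage_system hS)).
by rewrite off_size.
Qed.

Lemma sim_optimal_form : sim v A optimal_form.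
Proof. by exists (columns f); split=> //; apply: columns_stage_GLo. Qed.

Lemma stage_bounded : bounded form f a (iota 0 n).
Proof.
have [pk red _] := stage_system hS; rewrite off_size in pk.
by apply: bounded_sub (reduced_bounded red) => l; rewrite (perm_mem pk).
Qed.

Lemma optimal_form_inS : inS v optimal_form (mkseq a n).
Proof.
have [norm cross] := stage_bounded; split.
- by rewrite size_mkseq.
- apply/(sortedP 0%N) => i; rewrite size_mkseq => hi.
  by rewrite !nth_mkseq // ?mono // ltnW.
- by move=> i; rewrite optimal_form_entry nth_mkseq // vge_vge2; apply: norm; rewrite mem_iota /=.
move=> i j ij; rewrite optimal_form_entry !nth_mkseq // PoszD.
have [->|ne] := eqVneq i j; last by apply: cross; rewrite ?mem_iota /=.
by apply: (vge2_mul2 (norm j _)); [rewrite mem_iota /= | lia].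
Qed.

Lemma jump_prefix c : (0 < c <= n)%N -> ((c < n)%N -> (a c.-1 < a c)%N) -> reduced_prefix f a c.
Proof.
move=> /andP[c0 cn] jump; move: cn; rewrite leq_eqVlt => /orP[/eqP->|cn].
  by have [pk red _] := stage_system hS; exists (size bl), ps, ss; rewrite -{2}off_size.
by case: c c0 jump cn => // c _ jump cn; apply: (stage_jump hS); rewrite ?off_size // jump.
Qed.

Lemma optimal_form_nondegenerate : graded_nondegenerate optimal_form (mkseq a n).
Proof.
apply: reduced_graded_nondegenerate optimal_form_entry stage_bounded _ => m.
have [k kn kE] := monotone_sublevel m mono.
have [k0|k0] := posnP k.
  by exists 0%N, [::], [::]; split=> // i /kE; rewrite k0.
have [||t [ps' [ss' [_ _ pk red]]]] := @jump_prefix k; first by rewrite k0 kn.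
  move=> kn'; have := kE k kn'; rewrite ltnn => /esym/negbT; rewrite -ltnNge; apply: leq_ltn_trans.
  by rewrite -kE prednK // (leq_trans _ kn) // prednK.
by exists k, ps', ss'.
Qed.

Lemma GK_assemble : GK v A = mkseq a n.
Proof.
rewrite (GK_sim sim_optimal_form).
exact: GK_eq optimal_form_sym optimal_form_inS optimal_form_nondegenerate.
Qed.

Lemma optimal_form_optimal : optimal v optimal_form.
Proof. by rewrite /optimal -(GK_sim sim_optimal_form) GK_assemble; apply: optimal_form_inS. Qed.

(* Both bases attain [a], so the base change between them respects the filtration. *)
Lemma optimal_transition (U : 'M[F]_n) : GLo v U -> optimal v (U^T *m A *m U) ->
  exists2 Z : 'M[F]_n, columns f = U *m Z &
    forall i j, vge2 (Z i j) ((a j)%:Z - (a i)%:Z) /\ vge2 (Z i j) 0.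
Proof.
set Q := columns f; set M := U^T *m A *m U => hU oM; have hQ := columns_stage_GLo.
have [uU _ _] := GLo_unit hU; have [uQ _ _] := GLo_unit hQ; pose W := invmx Q *m U.
have hW : GLo v W by apply: GLo_mul => //; apply: GLo_inv.
have MW : M = W^T *m optimal_form *m W by rewrite /W congr_mul_invmx.
have simM : sim v A M by exists U.
have hM : inS v (W^T *m optimal_form *m W) (mkseq a n).
  by move: oM; rewrite /optimal -(GK_sim simM) GK_assemble MW.
have [sz so _ _] := optimal_form_inS; have le_refl : lexle (mkseq a n) (mkseq a n).
  by case/orP: (lexle_total (mkseq a n) (mkseq a n)).
have [_ hZ] := inS_lex_max optimal_form_sym optimal_form_nondegenerate hW hM sz so le_refl.
have [uW _ _] := GLo_unit hW; have [_ _ iZ] := GLo_unit (GLo_inv hW).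
exists (invmx W) => [|i j]; last by split=> //; have := hZ i j; rewrite !nth_mkseq.
have WV : W *m (invmx U *m Q) = 1%:M by rewrite /W -mulmxA mulKVmx // mulVmx.
by rewrite -[invmx W]mulmx1 -WV mulKmx // mulKVmx.
Qed.

Lemma zeta_optimal (M : 'M[F]_n) c t ps' ss' : sim v A M -> optimal v M -> (c <= n)%N ->
  (forall i l, (i < c <= l)%N -> (l < n)%N -> (a i < a l)%N) ->
  degs (take t bl) = c -> perm_eq (support ps' ss') (iota 0 c) -> reduced form f a ps' ss' ->
  zeta v (ulsub c M) = zeta v (Bpre bl t).
Proof.
move=> [U [hU ->]] oM cn jump tc pk red; have [Z QE zv] := optimal_transition hU oM.
have inM : inS v (U^T *m A *m U) (mkseq a n).
  by move: oM; rewrite /optimal -(@GK_sim _ A) ?GK_assemble //; exists U.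
have fE j : (j < c)%N -> f j = \sum_(i <- iota 0 n) mxe Z i j *: nat_col U i.
  move=> jc; have jn := leq_trans jc cn.
  by rewrite -(col_mulmx_nat_col U Z (Ordinal jn)) -QE col_columns.
have zv' i j : (i < n)%N -> (j < c)%N ->
    vge2 (mxe Z i j) ((a j)%:Z - (a i)%:Z) /\ vge2 (mxe Z i j) 0.
  by move=> hi jc; rewrite (mxeE Z (Ordinal hi) (Ordinal (leq_trans jc cn))); apply: zv.
have tri l : (l < c)%N -> integral_span (basis_cv n) l (f l - basis_cv n l).
  move=> lc; apply: (system_triangular (stage_system hS)).
  by rewrite off_size; apply: leq_trans cn.
subst c; apply/esym.
apply: (zeta_jump cn (inS_bounded (assemble_sym bl) inM) fE zv' jump pk red).
  by rewrite Bpre_gram; apply: triangular_gram.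
by rewrite -(gram_nat_col (assemble_sym bl)) //; exists 1%:M; rewrite trmx1 mul1mx mulmx1.
Qed.

Lemma run_boundary rs j (c := sumn (take j (unzip1 rs))) : all (fun p => 0 < p.1)%N rs ->
  sorted ltn (unzip2 rs) -> expand_runs rs = mkseq a n -> (1 <= j <= size rs)%N ->
  exists t, [/\ (1 <= t <= size bl)%N, degs (take t bl) = c &
    forall M, sim v A M -> optimal v M -> zeta v (ulsub c M) = zeta v (Bpre bl t)].
Proof.
move=> pos so rsE hj; have sizeE : sumn (unzip1 rs) = n by rewrite -size_expand_runs rsE size_mkseq.
have cn : (c <= n)%N.
  by rewrite -sizeE -[in leqRHS](cat_take_drop j (unzip1 rs)) sumn_cat leq_addr.
have c0 : (0 < c)%N.
  rewrite /c; case: j rs pos hj {so rsE sizeE cn c} => [|j] [|p rs] //= /andP[p0 _] _.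
  exact: ltn_addr.
have jump i l : (i < c <= l)%N -> (l < n)%N -> (a i < a l)%N.
  move=> icl ln; have := nth_expand_runs_ltn so icl; rewrite rsE size_mkseq => /(_ ln).
  by rewrite !nth_mkseq //; have /andP[ic cl] := icl; apply: leq_trans ic cn.
have [||t [ps' [ss' [tsz tc pk red]]]] := @jump_prefix c; first by rewrite c0 cn.
  by move=> cn'; apply: jump; rewrite // prednK // !leqnn.
exists t; split=> // [|M simM optM]; last exact: zeta_optimal simM optM cn jump tc pk red.
by rewrite tsz andbT lt0n; apply: contraTneq c0 => t0; rewrite -tc t0 take0.
Qed.

End OptimalForm.

Lemma EGK_optimal n (A : 'M[F]_n) rs (z : nat -> int) : (exists M, sim v A M /\ optimal v M) ->
  runs (GK v A) = rs ->
  (forall M j, sim v A M -> optimal v M -> (1 <= j <= size rs)%N ->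
     zeta v (ulsub (sumn (take j (unzip1 rs))) M) = z j) ->
  EGK v A = (unzip1 rs, unzip2 rs, [seq z j | j <- iota 1 (size rs)]).
Proof.
move=> exM rsE hz; rewrite /EGK; set M := classical_sets.xget _ _.
have [simM optM] : sim v A M /\ optimal v M by apply: classical_sets.xgetPex exM.
rewrite -(GK_sim simM) rsE size_map; congr (_, _); apply/eq_in_map => j.
by rewrite mem_iota add1n ltnS => /hz->.
Qed.

End UnramifiedDyadic.

Theorem theorem4p2 (F : fieldType) (v : F -> int) (HF : unram2 v)
    (bl : seq (nat * blk F)) (ns ms : seq nat) :
  all (fun p => blk_ok v p.2) bl ->
  in_Hn v (assemble bl) ->
  pre_optimal v bl ->
  size ns = size ms -> all (fun x => 0 < x)%N ns -> sorted ltn ms ->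
  GK v (assemble bl) = flatten [seq nseq p.1 p.2 | p <- zip ns ms] ->
  exists l : nat -> nat,
    (forall j : nat, (1 <= j <= size ns)%N ->
       [/\ (1 <= l j <= size bl)%N,
           sumn (take j ns) = degs (take (l j) bl) &
           forall a b : nat,
             mxe (ulsub (sumn (take j ns)) (assemble bl)) a b =
             mxe (Bpre bl (l j)) a b]) /\
    EGK v (assemble bl) =
      (ns, ms, [seq zeta v (Bpre bl (l j)) | j <- iota 1 (size ns)]).
Proof.
move=> blocks_ok _ preopt sz; rewrite -/(expand_runs _).
have [nsE msE] : unzip1 (zip ns ms) = ns /\ unzip2 (zip ns ms) = ms.
  by rewrite unzip1_zip ?unzip2_zip ?sz.
move: (zip ns ms) nsE msE => rs <- <- {sz}; rewrite all_map size_map => pos so GK_rs.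
have [f [a [ps [ss hS]]]] := stage_total HF blocks_ok preopt.
have rsE : expand_runs rs = mkseq a (degs bl) by rewrite -GK_rs (GK_assemble HF hS).
have /choice[l hl] j : exists t, (1 <= j <= size rs)%N ->
    [/\ (1 <= t <= size bl)%N, degs (take t bl) = sumn (take j (unzip1 rs)) &
      forall M, sim v (assemble bl) M -> optimal v M ->
        zeta v (ulsub (sumn (take j (unzip1 rs))) M) = zeta v (Bpre bl t)].
  have [/(run_boundary HF hS pos so rsE)[t ht]|_] := boolP (1 <= j <= size rs)%N.
    by exists t.
  by exists 0%N.
exists l; split=> [j /hl[lj <- _]|].
  by split=> // x y; apply: ulsub_Bpre.
apply: (EGK_optimal HF) => [||M j simM optM /hl[_ _]]; last exact.
- exists (optimal_form f).
  by split; [exact: (sim_optimal_form HF hS) | exact: (optimal_form_optimal HF hS)].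
by rewrite GK_rs expand_runsK.
Qed.
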